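(* Let $n\ge 3$, let $(X^{d+1},g_+)$ be a conformally compact Einstein manifold with chosen boundary metric $\overline g$ on $M^d$ and associated special defining function $r$, let $\Sigma^n\subset M^d$ be a submanifold, and let $Y^{n+1}\subset (X,g_+)$ be a minimal surface asymptotic to $\Sigma$, written near the boundary in an adapted chart as the graph $y^\alpha=u^\alpha(x,r)$. Then the coefficient $u^{(4)}$ of $r^4$ in the expansion of $u$ is given by $$\begin{aligned} 8n(n-2)u^{(4)\alpha}={}&\Delta^\perp H^\alpha+g^{ij}g^{kl}\langle A_{ik},H\rangle A_{jl}^\alpha-\frac{2}{n^2}|H|^2H^\alpha\\ &+g^{ij}\overline{g}^{\alpha\gamma}H^\beta\overline{W}_{i\beta j\gamma}+(n-4)\overline{g}^{\alpha\gamma}\overline{P}_{\beta\gamma}H^\beta-g^{ij}\overline{P}_{ij}H^\alpha+2n\,g^{ik}g^{jl}\overline{P}_{kl}A_{ij}^\alpha\\ &+n\,\overline{g}^{\alpha\gamma}g^{ij}\big(\overline{\nabla}_\gamma\overline{P}_{ij}-2\overline{\nabla}_i\overline{P}_{j\gamma}\big)-\frac{n-2}{n}H^\beta H^\gamma\,\overline{\Gamma}^\alpha_{\beta\gamma}. \end{aligned}$$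
   Context: Setting: $\overline X$ is a $(d+1)$-manifold with boundary $M^d$ and interior $X$; $g_+$ is a conformally compact Einstein metric on $X$: $\mathrm{Ric}(g_+)=-d\,g_+$ and $\rho^2g_+$ extends to a metric on $\overline X$ for any defining function $\rho$ ($\rho>0$ on $X$, $\rho=0$ and $d\rho\ne0$ on $M$). The conformal infinity is the conformal class of $(\rho^2g_+)|_{TM}$. Fix a metric $\overline g$ in it. The special defining function $r$ is the one, uniquely determined near $M$, with $(r^2g_+)|_{TM}=\overline g$ and $|dr|_{r^2g_+}=1$. The flow of the $r^2g_+$-gradient of $r$ identifies a neighborhood of $M$ in $\overline X$ with $M\times[0,\epsilon)$, where $r^2g_+=dr^2+\widetilde g$, $\widetilde g$ being an $r$-dependent family of metrics on $M$ whose expansion starts $\widetilde g=\overline g+g^{(2)}r^2+\cdots$ (even powers up to order $d$, at which order $r^d$, and $r^d\log r$ if $d$ is even, appear), with $g^{(2)}=-\overline P$. $\Sigma^n\subset M^d$ ($n\le d-1$) is a submanifold with induced metric $g=\overline g|_\Sigma$. Adapted chart: local coordinates $(x^i,y^\alpha)$ of $M$, $1\le i\le n$, $n+1\le\alpha\le d$, with $\Sigma=\{y=0\}$ and $\overline g(\partial_{x^i},\partial_{y^\alpha})=0$ on $\Sigma$; extended with $r$ to coordinates of $\overline X$ by the identification above. Latin indices $i,j,k,l$ are tangential, Greek indices are normal, repeated indices are summed. $Y$ is the graph $\{y^\alpha=u^\alpha(x,r)\}$ with $u(x,0)=0$, and has the expansion: for $n$ odd $u=u^{(2)}r^2+(\text{even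 powers})+u^{(n+1)}r^{n+1}+u^{(n+2)}r^{n+2}+\cdots$; for $n$ even $u=u^{(2)}r^2+(\text{even powers})+u^{(n)}r^n+w_nr^{n+2}\log r+u^{(n+2)}r^{n+2}+\cdots$, with $u^{(2)}=\frac1{2n}H$. $A_{ij}^\alpha=\overline g^{\alpha\beta}\overline g(\overline\nabla_i\partial_j,\partial_\beta)$ is the second fundamental form of $\Sigma\subset(M,\overline g)$, $H^\alpha=g^{ij}A_{ij}^\alpha$ the mean curvature vector, $\langle\cdot,\cdot\rangle$ and $|\cdot|$ are with respect to $\overline g$; $\nabla^\perp$ is the normal connection and $\Delta^\perp=g^{ij}\nabla_i^\perp\nabla_j^\perp$. $\overline\nabla$, $\overline\Gamma$ are the Levi-Civita connection and Christoffel symbols of $\overline g$. $\overline P=\frac1{d-2}\big(\overline{\mathrm{Ric}}-\frac{\overline R}{2(d-1)}\overline g\big)$ is the Schouten tensor and $\overline W$ the Weyl tensor, with $\overline R_{ABCD}=\overline W_{ABCD}+\overline P_{AC}\overline g_{BD}+\overline P_{BD}\overline g_{AC}-\overline P_{AD}\overline g_{BC}-\overline P_{BC}\overline g_{AD}$, where $\overline R_{ABCD}=\overline g\big((\overline\nabla_A\overline\nabla_B-\overline\nabla_B\overline\nabla_A)\partial_D,\partial_C\big)$. All quantities are evaluated on $\Sigma$. *)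

(* Defs.v *)
From HB Require Import structures.
From mathcomp Require Import all_boot all_order all_algebra.
From mathcomp Require Import all_classical all_reals all_analysis.

Set Implicit Arguments.
Unset Strict Implicit.
Unset Printing Implicit Defensive.

Import Order.TTheory GRing.Theory Num.Theory.
Import numFieldNormedType.Exports.

Local Open Scope classical_set_scope.
Local Open Scope ring_scope.

(* Points of R^k are row vectors.  R^(d+1)
   carries the coordinates (z, r), with z in R^d first and r, the coordinate
   cutting out the half-space r >= 0, last.  When d = n + m, z = (x, y) with
   x in R^n tangential and y in R^m normal.  Tensors are given by their
   components in charts. *)

Section Calculus.
Variable R : realType.

Definition pd k (i : 'I_k) (f : 'rV[R]_k -> R) : 'rV[R]_k -> R :=
  fun p => 'D_(delta_mx 0 i) f p.

Definition pds k (s : seq 'I_k) (f : 'rV[R]_k -> R) : 'rV[R]_k -> R :=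
  foldr (@pd k) f s.

(* C^infinity on an open set O. *)
Definition smooth_open k (O : set 'rV[R]_k) (f : 'rV[R]_k -> R) : Prop :=
  forall (s : seq 'I_k) p, O p -> differentiable (pds s f) p.

(* C^infinity on an arbitrary S (here: relatively open in a half-space):
   f has smooth local extensions to open sets. *)
Definition smooth_extension k (S : set 'rV[R]_k) (f : 'rV[R]_k -> R)
    (p : 'rV[R]_k) (O : set 'rV[R]_k) (f' : 'rV[R]_k -> R) : Prop :=
  [/\ open O, O p, smooth_open O f' & forall q, O q -> S q -> f' q = f q].

Definition smooth_on k (S : set 'rV[R]_k) (f : 'rV[R]_k -> R) : Prop :=
  forall p, S p -> exists O f', smooth_extension S f p O f'.

Definition rlast d : 'I_(d + 1) := rshift d ord0.

Definition rcoord d (v : 'rV[R]_(d + 1)) : R := v 0 (rlast d).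

Definition at_boundary d (z : 'rV[R]_d) : 'rV[R]_(d + 1) := row_mx z 0.

(* f(z, r) = sum_(j <= N) a_j(z) r^j + w(z) r^N log r + o(r^N) as r -> 0+,
   with smooth coefficients on the open set O, with a_j = 0 for odd j < N, and
   with w = 0 if N is odd.  The remainder is o(r^N) locally uniformly in z,
   and stays so after any number of applications of d/dz^i and r d/dr. *)
Definition even_expansion k (O : set 'rV[R]_k) (N : nat)
    (f : 'rV[R]_(k + 1) -> R) (a : nat -> 'rV[R]_k -> R) : Prop :=
  exists w : 'rV[R]_k -> R,
    let rem v := f v
      - \sum_(j < N.+1) a j (lsubmx v) * rcoord v ^+ j
      - w (lsubmx v) * rcoord v ^+ N * ln (rcoord v) in
    [/\ (forall j, (j <= N)%N -> smooth_open O (a j)) /\ smooth_open O w,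
        forall j z, odd j -> (j < N)%N -> O z -> a j z = 0,
        forall z, odd N -> O z -> w z = 0 &
        forall (s : seq 'I_(k + 1)) z, O z -> forall e : R, 0 < e ->
          \forall v \near within [set v | 0 < rcoord v]
                                 (nbhs (at_boundary z)),
            `|rcoord v ^+ count_mem (rlast k) s * pds s rem v|
              <= e * rcoord v ^+ N].

End Calculus.

Section RiemannianGeometry.
Variables (R : realType) (k : nat) (G : 'rV[R]_k -> 'M[R]_k).
Implicit Types (p : 'rV[R]_k) (A B C D E F : 'I_k).

Definition sympos (M : 'M[R]_k) : Prop :=
  M^T = M /\ forall v : 'rV[R]_k, v != 0 -> 0 < (v *m M *m v^T) 0 0.

Definition ginv p A B : R := invmx (G p) A B.

(* christoffel p C A B = Gamma^C_(AB) *)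
Definition christoffel p C A B : R :=
  2^-1 * \sum_E ginv p C E *
    (pd A (fun q => G q E B) p + pd B (fun q => G q E A) p
     - pd E (fun q => G q A B) p).

(* (nabla_A nabla_B - nabla_B nabla_A) d_D = sum_E curv p A B D E * d_E *)
Definition curv p A B D E : R :=
  pd A (fun q => christoffel q E B D) p - pd B (fun q => christoffel q E A D) p
  + \sum_F (christoffel p E A F * christoffel p F B D
            - christoffel p E B F * christoffel p F A D).

(* R_(ABCD) = G((nabla_A nabla_B - nabla_B nabla_A) d_D, d_C) *)
Definition riemann p A B C D : R := \sum_E G p E C * curv p A B D E.

Definition ricci p B D : R :=
  \sum_A \sum_C ginv p A C * riemann p A B C D.

Definition scalar_curvature p : R := \sum_A \sum_B ginv p A B * ricci p A B.

Definition schouten p A B : R :=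
  (k%:R - 2)^-1 *
  (ricci p A B - scalar_curvature p / (2 * (k%:R - 1)) * G p A B).

Definition weyl p A B C D : R :=
  riemann p A B C D
  - (schouten p A C * G p B D + schouten p B D * G p A C
     - schouten p A D * G p B C - schouten p B C * G p A D).

(* (nabla_C T)_(AB) *)
Definition cov_deriv2 (T : 'rV[R]_k -> 'I_k -> 'I_k -> R) p C A B : R :=
  pd C (fun q => T q A B) p
  - \sum_E christoffel p E C A * T p E B
  - \sum_E christoffel p E C B * T p A E.

Definition gradient (f : 'rV[R]_k -> R) p A : R :=
  \sum_B ginv p A B * pd B f p.

Definition norm_sq_diff (f : 'rV[R]_k -> R) p : R :=
  \sum_A \sum_B ginv p A B * pd A f p * pd B f p.

(* Extrinsic geometry of a map F : R^l -> (R^k, G). *)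
Section Parametrized.
Variables (l : nat) (F : 'rV[R]_l -> 'rV[R]_k).
Implicit Types (q : 'rV[R]_l) (a b : 'I_l).

Definition tangent q a A : R := pd a (fun q' => F q' 0 A) q.

Definition first_form q : 'M[R]_l :=
  \matrix_(a, b) \sum_A \sum_B G (F q) A B * tangent q a A * tangent q b B.

(* nabla_(F_a) F_b *)
Definition accel q a b A : R :=
  pd a (fun q' => tangent q' b A) q
  + \sum_B \sum_C christoffel (F q) A B C * tangent q a B * tangent q b C.

Definition normal_part q (V : 'I_k -> R) A : R :=
  V A - \sum_a \sum_b invmx (first_form q) a b *
    (\sum_B \sum_C G (F q) B C * V B * tangent q a C) * tangent q b A.

Definition mean_curvature q A : R :=
  \sum_a \sum_b invmx (first_form q) a b * normal_part q (accel q a b) A.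

End Parametrized.
End RiemannianGeometry.

Record hchart (R : realType) (T : topologicalType) (d : nat) := HChart {
  cdom : set T ;
  cmap : T -> 'rV[R]_(d + 1) ;
  cinv : 'rV[R]_(d + 1) -> T }.

Section Charts.
Variables (R : realType) (T : topologicalType) (d : nat).
Implicit Types c : hchart R T d.

Definition cimg c : set 'rV[R]_(d + 1) := cmap c @` cdom c.

Definition is_hchart c : Prop :=
  [/\ open (cdom c),
      exists2 O, open O & cimg c = O `&` [set v | 0 <= rcoord v],
      forall p, cdom c p -> cinv c (cmap c p) = p,
      {within cdom c, continuous (cmap c)} &
      {within cimg c, continuous (cinv c)}].

Definition transition c c' (v : 'rV[R]_(d + 1)) : 'rV[R]_(d + 1) :=
  cmap c' (cinv c v).

Definition chart_compat c c' : Prop := forall A,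
  smooth_on (cmap c @` (cdom c `&` cdom c')) (fun v => transition c c' v 0 A)
  /\ smooth_on (cmap c' @` (cdom c `&` cdom c'))
               (fun v => transition c' c v 0 A).

End Charts.

Record bmanifold (R : realType) (d : nat) := BManifold {
  mcarrier :> topologicalType ;
  atlas : set (hchart R mcarrier d) ;
  mhausdorff : hausdorff_space mcarrier ;
  msecond_countable : @second_countable mcarrier ;
  atlas_hchart : forall c, atlas c -> is_hchart c ;
  atlas_cover : forall p, exists2 c, atlas c & cdom c p ;
  atlas_compat : forall c c', atlas c -> atlas c' -> chart_compat c c' ;
  atlas_maximal : forall c, is_hchart c -> (forall c', atlas c' -> chart_compat c c') ->
        atlas c }.

Section ConformallyCompact.
Variables (R : realType) (d : nat) (X : bmanifold R d).
Notation chart := (hchart R X d).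

Definition mboundary : set X :=
  [set p | exists2 c, atlas c & cdom c p /\ rcoord (cmap c p) = 0].

Definition minterior : set X :=
  [set p | exists2 c, atlas c & cdom c p /\ 0 < rcoord (cmap c p)].

(* Interior points and boundary points (as a subset of R^d) in a chart. *)
Definition cint (c : chart) : set 'rV[R]_(d + 1) :=
  cimg c `&` [set v | 0 < rcoord v].

Definition cbnd (c : chart) : set 'rV[R]_d := [set z | cimg c (at_boundary z)].

(* Components, in each chart, of a field of bilinear forms on the interior,
   resp. of a field of bilinear forms on the boundary. *)
Definition tensor2 := chart -> 'rV[R]_(d + 1) -> 'M[R]_(d + 1).
Definition btensor2 := chart -> 'rV[R]_d -> 'M[R]_d.

Definition interior_metric (gp : tensor2) : Prop :=
  forall c, atlas c ->
  [/\ forall A B, smooth_open (cint c) (fun v => gp c v A B),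
      forall v, cint c v -> sympos (gp c v) &
      forall c' v, atlas c' -> cint c v -> cdom c' (cinv c v) ->
        gp c v = jacobian (transition c c') v *m gp c' (transition c c' v)
                 *m (jacobian (transition c c') v)^T].

Definition btransition (c c' : chart) (z : 'rV[R]_d) : 'rV[R]_d :=
  lsubmx (transition c c' (at_boundary z)).

Definition boundary_metric (gb : btensor2) : Prop :=
  forall c, atlas c ->
  [/\ forall A B, smooth_open (cbnd c) (fun z => gb c z A B),
      forall z, cbnd c z -> sympos (gb c z) &
      forall c' z, atlas c' -> cbnd c z -> cdom c' (cinv c (at_boundary z)) ->
        gb c z = jacobian (btransition c c') z *m gb c' (btransition c c' z)
                 *m (jacobian (btransition c c') z)^T].

Definition einstein (gp : tensor2) : Prop :=
  forall c v A B, atlas c -> cint c v ->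
    ricci (gp c) v A B = - d%:R * gp c v A B.

Definition defining_function (rho : X -> R) : Prop :=
  [/\ forall c, atlas c -> smooth_on (cimg c) (rho \o cinv c),
      forall p, minterior p -> 0 < rho p,
      forall p, mboundary p -> rho p = 0 &
      forall c z, atlas c -> cbnd c z -> exists O f',
        smooth_extension (cimg c) (rho \o cinv c) (at_boundary z) O f' /\
        exists A, pd A f' (at_boundary z) != 0].

(* rho^2 g_+ *)
Definition compactified (rho : X -> R) (gp : tensor2) : tensor2 :=
  fun c v => rho (cinv c v) ^+ 2 *: gp c v.

Definition extends_to_metric (h : tensor2) : Prop :=
  forall c, atlas c -> exists h' : 'rV[R]_(d + 1) -> 'M[R]_(d + 1),
    [/\ {within cimg c, continuous h'},
        forall v, cimg c v -> sympos (h' v) &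
        forall v, cint c v -> h' v = h c v].

Definition conformally_compact_einstein (gp : tensor2) : Prop :=
  [/\ interior_metric gp, einstein gp &
      forall rho, defining_function rho ->
        extends_to_metric (compactified rho gp)].

(* h|_TM = gb, where h is continuous up to the boundary M. *)
Definition restricts_to_boundary (h : tensor2) (gb : btensor2) : Prop :=
  forall c z, atlas c -> cbnd c z ->
    (fun v => ulsubmx (h c v)) @ within (cint c) (nbhs (at_boundary z))
      --> gb c z.

Definition special_defining_function
    (gp : tensor2) (gb : btensor2) (r : X -> R) : Prop :=
  [/\ defining_function r,
      restricts_to_boundary (compactified r gp) gb &
      exists N : set X, [/\ open N, mboundary `<=` N &
        forall c v, atlas c -> cint c v -> N (cinv c v) ->
          norm_sq_diff (compactified r gp c) (r \o cinv c) v = 1]].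

(* Embedded l-dimensional submanifolds of the interior and of the boundary, by
   slice charts in which the last l coordinates (of R^(d+1), resp. of R^d)
   are free. *)
Definition interior_submanifold (l : nat) (Y : set X) : Prop :=
  Y `<=` minterior /\
  forall p, Y p -> exists2 c, atlas c & cdom c p /\
    forall q, cdom c q ->
      (Y q <-> forall A : 'I_(d + 1), (A + l < d + 1)%N -> cmap c q 0 A = 0).

Definition boundary_submanifold (l : nat) (S : set X) : Prop :=
  S `<=` mboundary /\
  forall p, S p -> exists2 c, atlas c & cdom c p /\
    forall q, cdom c q ->
      (S q <-> rcoord (cmap c q) = 0 /\
               forall A : 'I_d, (A + l < d)%N -> cmap c q 0 (lshift 1 A) = 0).

(* The mean curvature vanishes in all local parametrizations of Y. *)
Definition minimal_submanifold (gp : tensor2) (l : nat) (Y : set X) : Prop :=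
  interior_submanifold l Y /\
  forall c (W : set 'rV[R]_l) (F : 'rV[R]_l -> 'rV[R]_(d + 1)),
    atlas c -> open W ->
    (forall A, smooth_open W (fun q => F q 0 A)) ->
    (forall q, W q -> cint c (F q) /\ Y (cinv c (F q))) ->
    (forall q, W q -> first_form (gp c) F q \in unitmx) ->
    forall q A, W q -> mean_curvature (gp c) F q A = 0.

Definition asymptotic_to (Y S : set X) : Prop :=
  closure Y `&` mboundary = S.

End ConformallyCompact.

Section AdaptedChart.
Variables (R : realType) (n m : nat) (X : bmanifold R (n + m)).
Variables (gp : tensor2 X) (gb : btensor2 X) (r : X -> R).
Variables (c : hchart R X (n + m)).

Definition on_Sigma (x : 'rV[R]_n) : 'rV[R]_(n + m) := row_mx x 0.

(* A chart (x, y) of M, extended to (x, y, r) by the flow of the gradient of r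
   with respect to r^2 g_+: the last coordinate is r, and the curves of
   constant (x, y), which start on M, are the integral curves of grad r. *)
Definition normal_form_chart : Prop :=
  [/\ atlas c,
      exists (U : set 'rV[R]_(n + m)) (eps : R), [/\ open U, 0 < eps &
        cimg c = [set v | U (lsubmx v) /\ 0 <= rcoord v < eps]],
      forall p, cdom c p -> rcoord (cmap c p) = r p &
      forall v A, cint c v ->
        gradient (compactified r gp c) (r \o cinv c) v A
          = (A == rlast (n + m))%:R].

Definition adapted_chart (Sigma : set X) : Prop :=
  [/\ normal_form_chart,
      forall p, cdom c p ->
        (Sigma p <-> rsubmx (lsubmx (cmap c p)) = 0 :> 'rV[R]_m /\
                     rcoord (cmap c p) = 0) &
      forall x, cbnd c (on_Sigma x) -> ursubmx (gb c (on_Sigma x)) = 0].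

(* r^2 g_+ = dr^2 + gtilde in c; the expansion of gtilde, with coefficients
   gt j of r^j, and leading coefficient gb. *)
Definition metric_expansion
    (gt : nat -> 'rV[R]_(n + m) -> 'M[R]_(n + m)) : Prop :=
  (forall z, cbnd c z -> gt 0%N z = gb c z) /\
  forall A B, even_expansion (cbnd c) (n + m)
    (fun v => ulsubmx (compactified r gp c v) A B) (fun j z => gt j z A B).

Definition graph_map (u : 'rV[R]_(n + 1) -> 'rV[R]_m) (q : 'rV[R]_(n + 1)) :
    'rV[R]_(n + m + 1) :=
  row_mx (row_mx (lsubmx q) (u q)) (rsubmx q).

(* Near the points (x, 0, 0), x in V, Y is {y = u(x, r), 0 < r < delta}. *)
Definition is_graph (Y : set X) (V : set 'rV[R]_n) (delta : R)
    (u : 'rV[R]_(n + 1) -> 'rV[R]_m) : Prop :=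
  let Q := [set q : 'rV[R]_(n + 1) |
              V (lsubmx q) /\ 0 < rcoord q < delta] in
  [/\ open V /\ 0 < delta,
      forall a, smooth_open Q (fun q => u q 0 a),
      forall x, V x -> u (at_boundary x) = 0 &
      exists N : set X, [/\ open N, N `<=` cdom c,
        forall x, V x -> exists2 p, N p & cmap c p = at_boundary (on_Sigma x) &
        cmap c @` (Y `&` N) = graph_map u @` Q]].

(* The expansion of u, with coefficients uc j of r^j. *)
Definition graph_expansion (V : set 'rV[R]_n)
    (u : 'rV[R]_(n + 1) -> 'rV[R]_m) (uc : nat -> 'rV[R]_n -> 'rV[R]_m) :
    Prop :=
  (forall x, V x -> uc 0%N x = 0) /\
  forall a, even_expansion V (n + 2)
    (fun q => u q 0 a) (fun j x => uc j x 0 a).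

End AdaptedChart.

(* Extrinsic geometry of Sigma = {y = 0} in (R^(n+m), gb), for gb with
   gb(d_x, d_y) = 0 on Sigma. *)
Section SecondFundamentalForm.
Variables (R : realType) (n m : nat).
Variable gb : 'rV[R]_(n + m) -> 'M[R]_(n + m).
Implicit Types (x : 'rV[R]_n) (i j k : 'I_n) (a b : 'I_m).

Definition tdir i : 'I_(n + m) := lshift m i.
Definition ndir a : 'I_(n + m) := rshift n a.

Definition induced_metric x : 'M[R]_n := ulsubmx (gb (on_Sigma m x)).

(* V^alpha = gb^(alpha beta) gb(V, d_beta): the normal projection. *)
Definition normal_coord x (V : 'I_(n + m) -> R) a : R :=
  \sum_b ginv gb (on_Sigma m x) (ndir a) (ndir b) *
    \sum_C gb (on_Sigma m x) C (ndir b) * V C.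

(* A^a_(ij) *)
Definition second_form x i j a : R :=
  normal_coord x (fun C => christoffel gb (on_Sigma m x) C (tdir i) (tdir j)) a.

Definition mean_curvature_vector x a : R :=
  \sum_i \sum_j ginv induced_metric x i j * second_form x i j a.

Definition inner_normal x (nu mu : 'I_m -> R) : R :=
  \sum_a \sum_b gb (on_Sigma m x) (ndir a) (ndir b) * nu a * mu b.

(* The normal connection on sections nu = nu^a d_(y^a) of the normal bundle. *)
Definition nabla_perp i (nu : 'rV[R]_n -> 'I_m -> R) x a : R :=
  pd i (fun x' => nu x' a) x
  + \sum_b nu x b *
      normal_coord x
        (fun C => christoffel gb (on_Sigma m x) C (tdir i) (ndir b)) a.

(* g^(ij) nabla_i nabla_j, where the outer derivative also acts on the
   cotangent index j through the Levi-Civita connection of g. *)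
Definition laplacian_perp (nu : 'rV[R]_n -> 'I_m -> R) x a : R :=
  \sum_i \sum_j ginv induced_metric x i j *
    (nabla_perp i (nabla_perp j nu) x a
     - \sum_k christoffel induced_metric x k i j * nabla_perp k nu x a).

End SecondFundamentalForm.

(* Main.v *)
(* Let r^2 g_+ = dr^2 + T. As r -> 0, the tangential part of the Einstein
   equation becomes an algebraic equation for the r^2 coefficient of T, which
   gives T = gb - r^2 P + o(r^2). The conformal factor r^-2 enters the
   minimal surface equation of the graph y = u(x, r) only through one singular
   term: h^(ab) E_(ab) = (n + 1) u_r / r, where h is the metric induced by
   dr^2 + T and
   E_(ab) = u_(ab) + Gamma^al(F_a, F_b) - u_k Gamma^k(F_a, F_b) + u_r T_r(F_a, F_b) / 2
   with Gamma the Christoffel symbols of dr^2 + T. Both sides have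
   the form a + b r^2 + o(r^2). Comparing a yields 2 n u2 = H.  Comparing b
   expresses 8 n (n - 2) u4 by derivatives of H, gb and P, which assemble into
   the normal Laplacian of H, the curvature of gb and the covariant derivative of P. *)
Require Import Defs.
From HB Require Import structures.
From mathcomp Require Import all_boot all_order all_algebra.
From mathcomp Require Import all_classical all_reals all_analysis.
From mathcomp Require Import ring lra.

Set Implicit Arguments.
Unset Strict Implicit.
Unset Printing Implicit Defensive.

Import Order.TTheory GRing.Theory Num.Theory.
Import numFieldNormedType.Exports.

Local Open Scope classical_set_scope.
Local Open Scope ring_scope.

(** * Partial derivatives *)

(** The expansions control their remainder only under [d/dz] and [r d/dr], and a logarithm may occur
    at their last order, so no radial derivative is taken at [r = 0]: limits along curves ending on
    the boundary take its place. By parity the main quantities are [a + b t^2 + o(t^2)] there, and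
    [jet] computes with the pairs [(a, b)]. The graph over a fixed [x] leaves Sigma by
    [t^2 u2 + o(t^2)]. Along it the metric is therefore varied by the derivative of [gb] in the
    direction [u2] and by [- P]; in the Christoffel symbols the former leads to the Jacobi operator
    of Sigma, the latter to the covariant derivative of [P]. In coordinates the Jacobi part carries
    the non-tensorial term [- Gamma^al(H, H)]; the radial tangent vector adds [2 / n] times the
    opposite, whence the factor [- (n - 2) / n]. [E_(ab)] is an acceleration paired with
    [dy^al - u_k dx^k - u_r dr], which kills the tangent space of the graph, so no normal projection
    has to be expanded. The constant on the left is [2 n (4 (n + 1) - 12)]: [(n + 1) u_r / r]
    against [u_rr], times [2 n] for [H = 2 n u2]. *)

Section PartialDerivatives.
Variable R : realType.
Implicit Types k : nat.

Lemma nbhs_near_eq k (O : set 'rV[R]_k) (f g : 'rV[R]_k -> R) p :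
  open O -> O p -> (forall q, O q -> f q = g q) -> \forall q \near p, f q = g q.
Proof. by move=> oO Op fg; apply: filterS (open_nbhs_nbhs (conj oO Op)). Qed.

Lemma pd_near_eq k (f g : 'rV[R]_k -> R) i p :
  (\forall q \near p, f q = g q) -> pd i f p = pd i g p.
Proof. exact: near_eq_derive. Qed.

Lemma pd_eq_open k (O : set 'rV[R]_k) (f g : 'rV[R]_k -> R) i p :
  open O -> O p -> (forall q, O q -> f q = g q) -> pd i f p = pd i g p.
Proof. by move=> oO Op fg; apply: near_eq_derive; apply: nbhs_near_eq oO Op fg. Qed.

Lemma pds_eq_open k (O : set 'rV[R]_k) (f g : 'rV[R]_k -> R) s :
  open O -> (forall q, O q -> f q = g q) ->
  forall p, O p -> pds s f p = pds s g p.
Proof.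
move=> oO fg; elim: s => [|i s IH] p Op /=; first exact: fg.
exact: pd_eq_open IH.
Qed.

(** Serves [differentiable_near_eq]: functions that agree near [p] differ by a function of this
    kind. Its differential is 0 by uniqueness of the first-order expansion. *)
Lemma differentiable_near0 (V : normedModType R) (e : V -> R) p :
  (\forall q \near p, e q = 0) -> differentiable e p.
Proof.
move=> e0.
have E : e \o shift p = cst (e p) + (\0 : V -> R) +o_ (0 : V) id.
  apply/eqaddoP => eps eps0; move: e0; rewrite (near_shift 0) => e0.
  near=> h.
  have -> : (e \o shift p - (cst (e p) + (\0 : V -> R))) h = e (h + p) - (e p + 0) by [].
  have ep : e p = 0 by move: (nbhs_singleton e0) => /=; rewrite subr0 add0r.
  rewrite ep addr0 subr0; have -> : e (h + p) = 0.
    by near: h; apply: filterS e0 => h /=; rewrite subr0.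
  by rewrite normr0 mulr_ge0 // ltW.
have c0 : continuous (\0 : V -> R) by move=> q; exact: cvg_cst.
have D0 : 'd e p = (\0 : V -> R) :> (V -> R) by apply: diff_unique.
by apply/diff_locallyP; rewrite D0.
Unshelve. all: by end_near. Qed.

Lemma differentiable_near_eq (V : normedModType R) (f g : V -> R) p :
  (\forall q \near p, f q = g q) -> differentiable f p -> differentiable g p.
Proof.
move=> fg df.
have -> : g = f + (g - f) by apply/funext => q; rewrite /= addrC subrK.
apply: differentiableD => //; apply: differentiable_near0.
by apply: filterS fg => q fgq; rewrite -[LHS]/(g q - f q) fgq subrr.
Qed.

Lemma pdD k (f g : 'rV[R]_k -> R) i p : differentiable f p -> differentiable g p ->
  pd i (fun q => f q + g q) p = pd i f p + pd i g p.
Proof. by move=> df dg; apply: deriveD; exact: diff_derivable. Qed.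

Lemma pdB k (f g : 'rV[R]_k -> R) i p : differentiable f p -> differentiable g p ->
  pd i (fun q => f q - g q) p = pd i f p - pd i g p.
Proof. by move=> df dg; apply: deriveB; exact: diff_derivable. Qed.

Lemma pdN k (f : 'rV[R]_k -> R) i p : differentiable f p ->
  pd i (fun q => - f q) p = - pd i f p.
Proof. by move=> df; apply: deriveN; exact: diff_derivable. Qed.

Lemma pdM k (f g : 'rV[R]_k -> R) i p : differentiable f p -> differentiable g p ->
  pd i (fun q => f q * g q) p = pd i f p * g p + f p * pd i g p.
Proof.
move=> df dg; rewrite addrC [pd i f p * _]mulrC.
by apply: deriveM; exact: diff_derivable.
Qed.

Lemma pd_cst k (a : R) i (p : 'rV[R]_k) : pd i (fun=> a) p = 0.
Proof. exact: derive_cst. Qed.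

Lemma differentiable_fsum k (I : Type) (r : seq I) (P : pred I)
    (F : I -> 'rV[R]_k -> R) p :
  (forall j, differentiable (F j) p) ->
  differentiable (fun q => \sum_(j <- r | P j) F j q) p.
Proof.
move=> dF; elim: r => [|j r IH].
  under eq_fun do rewrite big_nil; exact: differentiable_cst.
under eq_fun do rewrite big_cons; case: (P j) => //.
exact: differentiableD.
Qed.

Lemma pd_sum k (I : Type) (r : seq I) (P : pred I) (F : I -> 'rV[R]_k -> R) i p :
  (forall j, differentiable (F j) p) ->
  pd i (fun q => \sum_(j <- r | P j) F j q) p = \sum_(j <- r | P j) pd i (F j) p.
Proof.
move=> dF; elim: r => [|j r IH].
  by under eq_fun do rewrite big_nil; rewrite big_nil pd_cst.
under eq_fun do rewrite big_cons; rewrite big_cons; case: (P j) => //.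
by rewrite pdD ?IH //; exact: differentiable_fsum.
Qed.

Lemma pdZ k (a : R) (f : 'rV[R]_k -> R) i p : differentiable f p ->
  pd i (fun q => a * f q) p = a * pd i f p.
Proof.
by move=> df; rewrite pdM ?pd_cst ?mul0r ?add0r //; exact: differentiable_cst.
Qed.

Lemma differentiableMf k (f g : 'rV[R]_k -> R) p :
  differentiable f p -> differentiable g p -> differentiable (fun q => f q * g q) p.
Proof. by move=> df dg; apply: differentiableM. Qed.

Lemma differentiable_prod k (I : Type) (r : seq I) (P : pred I)
    (F : I -> 'rV[R]_k -> R) p :
  (forall j, differentiable (F j) p) ->
  differentiable (fun q => \prod_(j <- r | P j) F j q) p.
Proof.
move=> dF; elim: r => [|j r IH].
  under eq_fun do rewrite big_nil; exact: differentiable_cst.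
under eq_fun do rewrite big_cons; case: (P j) => //.
exact: differentiableMf.
Qed.

Lemma smooth_differentiable k (O : set 'rV[R]_k) (f : 'rV[R]_k -> R) p :
  smooth_open O f -> O p -> differentiable f p.
Proof. by move=> sf Op; apply: (sf [::]). Qed.

Lemma smooth_pd k (O : set 'rV[R]_k) (f : 'rV[R]_k -> R) i :
  smooth_open O f -> smooth_open O (pd i f).
Proof. by move=> sf s p Op; have := sf (rcons s i) p Op; rewrite /pds foldr_rcons. Qed.

Lemma smooth_eq k (O : set 'rV[R]_k) (f g : 'rV[R]_k -> R) :
  open O -> (forall q, O q -> f q = g q) -> smooth_open O f -> smooth_open O g.
Proof.
move=> oO fg sf s p Op; apply: differentiable_near_eq (sf s p Op).
exact: nbhs_near_eq oO Op (pds_eq_open s oO fg).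
Qed.

Lemma smooth_subset k (O O' : set 'rV[R]_k) (f : 'rV[R]_k -> R) :
  O' `<=` O -> smooth_open O f -> smooth_open O' f.
Proof. by move=> sO sf s p Op; apply: sf; apply: sO. Qed.

Lemma pdsB k (O : set 'rV[R]_k) (f g : 'rV[R]_k -> R) s p :
  open O -> smooth_open O f -> smooth_open O g -> O p ->
  pds s (fun q => f q - g q) p = pds s f p - pds s g p.
Proof.
move=> oO sf sg; elim: s p => [|i s IH] p Op //=.
by rewrite (pd_eq_open i oO Op IH) pdB //; [exact: sf|exact: sg].
Qed.

Lemma pdsD k (O : set 'rV[R]_k) (f g : 'rV[R]_k -> R) s p :
  open O -> smooth_open O f -> smooth_open O g -> O p ->
  pds s (fun q => f q + g q) p = pds s f p + pds s g p.
Proof.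
move=> oO sf sg; elim: s p => [|i s IH] p Op //=.
by rewrite (pd_eq_open i oO Op IH) pdD //; [exact: sf|exact: sg].
Qed.

Lemma smoothB k (O : set 'rV[R]_k) (f g : 'rV[R]_k -> R) :
  open O -> smooth_open O f -> smooth_open O g -> smooth_open O (fun q => f q - g q).
Proof.
move=> oO sf sg s p Op.
apply: (@differentiable_near_eq _ (fun q => pds s f q - pds s g q)).
  by apply: (nbhs_near_eq oO Op) => q Oq; rewrite (pdsB _ oO).
by apply: differentiableB; [exact: sf|exact: sg].
Qed.

Lemma smoothD k (O : set 'rV[R]_k) (f g : 'rV[R]_k -> R) :
  open O -> smooth_open O f -> smooth_open O g -> smooth_open O (fun q => f q + g q).
Proof.
move=> oO sf sg s p Op.
apply: (@differentiable_near_eq _ (fun q => pds s f q + pds s g q)).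
  by apply: (nbhs_near_eq oO Op) => q Oq; rewrite (pdsD _ oO).
by apply: differentiableD; [exact: sf|exact: sg].
Qed.

Lemma smooth_cst k (O : set 'rV[R]_k) (a : R) : smooth_open O (fun=> a).
Proof.
move=> s; have [b ->] : exists b, pds s (fun=> a) = (fun=> b) :> ('rV[R]_k -> R).
  elim: s => [|i s [b /= ->]]; first by exists a.
  by exists 0; apply/funext => p; rewrite pd_cst.
by move=> p _; exact: differentiable_cst.
Qed.

Lemma smooth_sum k (O : set 'rV[R]_k) (I : Type) (r : seq I) (F : I -> 'rV[R]_k -> R) :
  open O -> (forall j, smooth_open O (F j)) ->
  smooth_open O (fun q => \sum_(j <- r) F j q).
Proof.
move=> oO sF; elim: r => [|j r IH].
  under eq_fun do rewrite big_nil; exact: smooth_cst.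
by under eq_fun do rewrite big_cons; apply: smoothD.
Qed.

Lemma pds_sum k (O : set 'rV[R]_k) (I : Type) (r : seq I) (F : I -> 'rV[R]_k -> R) s p :
  open O -> (forall j, smooth_open O (F j)) -> O p ->
  pds s (fun q => \sum_(j <- r) F j q) p = \sum_(j <- r) pds s (F j) p.
Proof.
move=> oO sF Op; elim: r => [|j r IH].
  under eq_fun do rewrite big_nil; rewrite big_nil.
  by elim: s p Op => //= i s IH p Op; rewrite (pd_eq_open (g := fun=> 0) i oO Op IH) pd_cst.
under eq_fun do rewrite big_cons; rewrite big_cons (pdsD _ oO) ?IH //.
exact: smooth_sum.
Qed.

(** Induction on the number of derivatives, for all pairs of factors at once: the Leibniz rule
    resolves the innermost derivative, and both resulting products have smooth factors and one
    derivative fewer to bear. *)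
Lemma smoothM k (O : set 'rV[R]_k) (f g : 'rV[R]_k -> R) :
  open O -> smooth_open O f -> smooth_open O g -> smooth_open O (fun q => f q * g q).
Proof.
move=> oO sf sg s; have [N] := ubnP (size s).
elim: N s f g sf sg => // N IH s f g sf sg.
case/lastP: s => [|s i]; first by move=> _ p Op; apply: differentiableMf; [apply: (sf [::])|apply: (sg [::])].
rewrite size_rcons ltnS => sN p Op; rewrite /pds foldr_rcons -/(pds s _).
have sM f' g' : smooth_open O f' -> smooth_open O g' ->
    forall s', (size s' <= size s)%N -> forall q, O q -> differentiable (pds s' (fun q => f' q * g' q)) q.
  by move=> sf' sg' s' ss'; apply: IH => //; apply: leq_ltn_trans sN.
pose F := fun q => pds s (fun q => pd i f q * g q) q + pds s (fun q => f q * pd i g q) q.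
apply: (@differentiable_near_eq _ F); last first.
  by apply: differentiableD; apply: sM => //; exact: smooth_pd.
apply: (nbhs_near_eq oO Op) => q Oq; rewrite /F.
have -> : pds s (pd i (fun q => f q * g q)) q =
          pds s (fun q => pd i f q * g q + f q * pd i g q) q.
  apply: pds_eq_open oO _ _ Oq => q' Oq'.
  by rewrite pdM //; [apply: (sf [::])|apply: (sg [::])].
have H s' q' : (size s' <= size s)%N -> O q' ->
   pds s' (fun q => pd i f q * g q + f q * pd i g q) q' =
   pds s' (fun q => pd i f q * g q) q' + pds s' (fun q => f q * pd i g q) q'.
  elim: s' q' => [|j s' IH'] q' //= ss' Oq'.
  rewrite (pd_eq_open j oO Oq' (fun q0 => IH' q0 (ltnW ss'))) pdD //.
    by apply: sM => //; [exact: smooth_pd|exact: ltnW].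
  by apply: sM => //; [exact: smooth_pd|exact: ltnW].
by rewrite H.
Qed.

End PartialDerivatives.

(** * Symmetry of second partial derivatives *)

Section SecondDerivatives.
Variable R : realType.

Lemma is_derive_line k (f : 'rV[R]_k -> R) i (w : 'rV[R]_k) (s : R) :
  differentiable f (s *: delta_mx 0 i + w) ->
  is_derive s 1 (fun s => f (s *: delta_mx 0 i + w)) (pd i f (s *: delta_mx 0 i + w)).
Proof.
move=> df.
have E : (fun h : R => h^-1 *: (f ((h *: 1 + s) *: delta_mx 0 i + w) - f (s *: delta_mx 0 i + w)))
   = (fun h : R => h^-1 *: (f (h *: delta_mx 0 i + (s *: delta_mx 0 i + w)) - f (s *: delta_mx 0 i + w))).
  by apply/funext => h; rewrite [h *: 1]mulr1 scalerDl addrA.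
apply: DeriveDef; first by rewrite /derivable E; exact: (diff_derivable df).
by rewrite /pd /derive E.
Qed.

Lemma ball_two_dirs k (p : 'rV[R]_k) (i j : 'I_k) (A : set 'rV[R]_k) :
  nbhs p A -> exists2 d : R, 0 < d & forall s t : R, `|s| < d -> `|t| < d ->
    A (s *: delta_mx 0 i + (t *: delta_mx 0 j + p)).
Proof.
(* With this radius the two displacements together have norm below [e]; the summand 1 keeps the
   divisor positive. *)
move=> /nbhs_ballP[e /= e0 H]; exists (e / (2 * (`|delta_mx 0 i : 'rV[R]_k| + `|delta_mx 0 j : 'rV[R]_k| + 1))).
  by rewrite divr_gt0 // mulr_gt0 // ltr_wpDl // addr_ge0.
move=> s t; rewrite !ltr_pdivlMr; last 2 first.
- by rewrite mulr_gt0 // ltr_wpDl // addr_ge0.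
- by rewrite mulr_gt0 // ltr_wpDl // addr_ge0.
move=> hs ht; apply: H; rewrite -ball_normE /= addrA opprD addrCA subrr addr0 normrN.
apply: le_lt_trans (ler_normD _ _) _; rewrite !normrZ.
have := normr_ge0 (delta_mx 0 i : 'rV[R]_k); have := normr_ge0 (delta_mx 0 j : 'rV[R]_k).
have := normr_ge0 s; have := normr_ge0 t.
move: hs ht; move: `|s| `|t| `|delta_mx 0 i| `|delta_mx 0 j| => s' t' a b.
by nra.
Qed.

Section SecondDifference.
Variables (k : nat) (O : set 'rV[R]_k) (f : 'rV[R]_k -> R) (i j : 'I_k) (p : 'rV[R]_k).
Local Notation pt s t := (s *: delta_mx 0 i + (t *: delta_mx 0 j + p)).

(** Two applications of the mean value theorem turn the second difference into [h^2] times a mixed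
    derivative at an intermediate point, and that derivative is continuous at [p]. *)
Lemma second_difference :
  open O -> smooth_open O f -> O p ->
  (fun h : R => (f (pt h h) - f (h *: delta_mx 0 i + p)
     - f (h *: delta_mx 0 j + p) + f p) / h ^+ 2) @ 0^'+ --> pd j (pd i f) p.
Proof.
move=> oO sf Op; apply/cvgrPdist_lt => e e0.
have cf : {for p, continuous (pd j (pd i f))}.
  exact: differentiable_continuous (sf [:: j; i] p Op).
have ce : \forall q \near p, `|pd j (pd i f) p - pd j (pd i f) q| < e.
  by move/cvgrPdist_lt: cf => /(_ e e0).
have /(ball_two_dirs i j) [d d0 H] : nbhs p (O `&` [set q | `|pd j (pd i f) p - pd j (pd i f) q| < e]).
  by apply: filterI; [exact: open_nbhs_nbhs|exact: ce].
near=> h.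
have h0 : 0 < h by near: h; exact: nbhs_right_gt.
have hd : h < d by near: h; exact: nbhs_right_lt.
have HO s t : 0 <= s <= h -> 0 <= t <= h -> O (pt s t).
  move=> /andP[s0 sh] /andP[t0 th].
  by have [] := H s t _ _; rewrite ?ger0_norm // ?(le_lt_trans sh) ?(le_lt_trans th).
have dfO q : O q -> differentiable f q by exact: (sf [::]).
have dfiO q : O q -> differentiable (pd i f) q by exact: (sf [:: i]).
have hh : 0 <= h <= h by rewrite lexx ltW.
have h00 : 0 <= (0 : R) <= h by rewrite lexx ltW.
(* The increment in the direction [j], as a function of the position along [i]; the second
   difference is an increment of [phi]. *)
pose phi s := f (pt s h) - f (s *: delta_mx 0 i + p).
have E1 : f (pt h h) - f (h *: delta_mx 0 i + p)
     - f (h *: delta_mx 0 j + p) + f p = phi h - phi 0.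
  by rewrite /phi !scale0r !add0r; ring.
have in_le (x : R) : x \in `]0, h[ -> 0 <= x <= h.
  by rewrite in_itv /= => /andP[x0 xh]; rewrite !ltW.
have Dphi s : 0 <= s <= h -> is_derive s 1 phi
   (pd i f (pt s h) - pd i f (s *: delta_mx 0 i + p)).
  move=> sh; apply: is_deriveB; apply: is_derive_line; apply: dfO; first exact: HO.
  by have := HO s 0 sh h00; rewrite scale0r add0r.
have [s sh Es] : exists2 s, s \in `]0, h[ & phi h - phi 0 =
   (pd i f (pt s h) - pd i f (s *: delta_mx 0 i + p)) * (h - 0).
  apply: (@MVT _ phi (fun s => pd i f (pt s h) - pd i f (s *: delta_mx 0 i + p)) 0 h h0).
    by move=> x xh; apply: Dphi; exact: in_le.
  apply: derivable_within_continuous => x; rewrite in_itv /= => xh.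
  exact: (@ex_derive _ _ _ _ _ _ _ (Dphi _ xh)).
pose psi t := pd i f (t *: delta_mx 0 j + (s *: delta_mx 0 i + p)).
have sw t : t *: delta_mx 0 j + (s *: delta_mx 0 i + p) = pt s t :> 'rV[R]_k.
  by rewrite addrCA.
have Dpsi t : 0 <= t <= h -> is_derive t 1 psi (pd j (pd i f) (t *: delta_mx 0 j + (s *: delta_mx 0 i + p))).
  by move=> th; apply: is_derive_line; apply: dfiO; rewrite sw; apply: HO => //; exact: in_le.
have [t th Et] : exists2 t, t \in `]0, h[ & psi h - psi 0 =
   pd j (pd i f) (t *: delta_mx 0 j + (s *: delta_mx 0 i + p)) * (h - 0).
  apply: (@MVT _ psi (fun t => pd j (pd i f) (t *: delta_mx 0 j + (s *: delta_mx 0 i + p))) 0 h h0).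
    by move=> x xh; apply: Dpsi; exact: in_le.
  apply: derivable_within_continuous => x; rewrite in_itv /= => xh.
  exact: (@ex_derive _ _ _ _ _ _ _ (Dpsi _ xh)).
rewrite E1 Es.
have -> : pd i f (pt s h) - pd i f (s *: delta_mx 0 i + p) = psi h - psi 0.
  by rewrite /psi !sw scale0r add0r.
rewrite Et !subr0 -[_ * h * h]mulrA -expr2 mulfK ?expf_neq0 ?gt_eqF // sw.
have hs x : x \in `]0, h[ -> `|x| < d.
  by move=> /in_le /andP[? ?]; rewrite ger0_norm //; apply: le_lt_trans hd.
by have [] := H s t (hs _ sh) (hs _ th).
Unshelve. all: by end_near. Qed.

End SecondDifference.

(** The second difference is symmetric in [i] and [j], so both orders of differentiation are limits
    of the same quotient. *)
Lemma pdC k (O : set 'rV[R]_k) (f : 'rV[R]_k -> R) i j p :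
  open O -> smooth_open O f -> O p -> pd i (pd j f) p = pd j (pd i f) p.
Proof.
move=> oO sf Op.
have H1 := @second_difference _ _ _ j i p oO sf Op.
have H2 := @second_difference _ _ _ i j p oO sf Op.
have E : (fun h : R => (f (h *: delta_mx 0 j + (h *: delta_mx 0 i + p)) - f (h *: delta_mx 0 j + p)
     - f (h *: delta_mx 0 i + p) + f p) / h ^+ 2) =
   (fun h : R => (f (h *: delta_mx 0 i + (h *: delta_mx 0 j + p)) - f (h *: delta_mx 0 i + p)
     - f (h *: delta_mx 0 j + p) + f p) / h ^+ 2).
  by apply/funext => h; rewrite addrCA; congr (_ / _); congr (_ + _); rewrite addrAC.
by move: H1; rewrite E => H1; apply: (cvg_unique _ H1 H2).
Qed.

End SecondDerivatives.

(** * Derivatives of determinants and inverse matrices *)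

Section MatrixInverse.
Variable R : realType.

Lemma differentiable_det k d (M : 'rV[R]_k -> 'M[R]_d) p :
  (forall i j, differentiable (fun q => M q i j) p) ->
  differentiable (fun q => \det (M q)) p.
Proof.
move=> dM; apply: differentiable_fsum => s.
by apply: differentiableMf; [exact: differentiable_cst|exact: differentiable_prod].
Qed.

Lemma invmxE d (A : 'M[R]_d) i j : A \in unitmx ->
  invmx A i j = (\det A)^-1 * cofactor A j i.
Proof. by rewrite /invmx => ->; rewrite !mxE. Qed.

Lemma near_unitmx k d (M : 'rV[R]_k -> 'M[R]_d) p :
  (forall i j, differentiable (fun q => M q i j) p) -> M p \in unitmx ->
  \forall q \near p, M q \in unitmx.
Proof.
move=> dM; rewrite unitmxE unitfE => Mp.
have /differentiable_continuous c := differentiable_det dM.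
apply: filterS (cvgr_neq0 _ c Mp) => q /=.
by rewrite unitmxE unitfE.
Qed.

Lemma differentiable_invmx k d (M : 'rV[R]_k -> 'M[R]_d) p i j :
  (forall i j, differentiable (fun q => M q i j) p) -> M p \in unitmx ->
  differentiable (fun q => invmx (M q) i j) p.
Proof.
move=> dM Mp.
apply: (@differentiable_near_eq _ _ (fun q => (\det (M q))^-1 * cofactor (M q) j i)).
  by apply: filterS (near_unitmx dM Mp) => q Mq; rewrite invmxE.
apply: differentiableMf.
  by apply: differentiableV; [exact: differentiable_det|rewrite -unitfE -unitmxE].
apply: differentiableMf; first exact: differentiable_cst.
by apply: differentiable_det => a b; under eq_fun do rewrite !mxE; exact: dM.
Qed.

(** Obtained by differentiating [M * invmx M = 1], which holds on a neighbourhood because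
    invertibility is an open condition. *)
Lemma pd_invmx k d (M : 'rV[R]_k -> 'M[R]_d) p e i j :
  (forall i j, differentiable (fun q => M q i j) p) -> M p \in unitmx ->
  pd e (fun q => invmx (M q) i j) p =
  - \sum_a \sum_b invmx (M p) i a * pd e (fun q => M q a b) p * invmx (M p) b j.
Proof.
move=> dM Mp.
pose dA := \matrix_(a, b) pd e (fun q => M q a b) p.
pose dN := \matrix_(a, b) pd e (fun q => invmx (M q) a b) p.
have E : dA *m invmx (M p) + M p *m dN = 0.
  apply/matrixP => a b; rewrite !mxE.
  transitivity (pd e (fun q => \sum_c M q a c * invmx (M q) c b) p); last first.
    rewrite (@pd_near_eq _ _ _ (fun=> (a == b)%:R)) ?pd_cst //.
    apply: filterS (near_unitmx dM Mp) => q Mq.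
    by have /matrixP /(_ a b) := mulmxV Mq; rewrite !mxE.
  rewrite pd_sum; last by move=> c; apply: differentiableMf => //; exact: differentiable_invmx.
  rewrite -big_split /=; apply: eq_bigr => c _.
  by rewrite pdM ?mxE //; exact: differentiable_invmx.
have EN : dN = - (invmx (M p) *m dA *m invmx (M p)).
  have E' : dA *m invmx (M p) = - (M p *m dN) by apply/eqP; rewrite -addr_eq0 E.
  by rewrite -mulmxA E' mulmxN mulKmx ?opprK.
have := congr1 (fun Z : 'M[R]_d => Z i j) EN; rewrite !mxE => ->; congr (- _).
rewrite exchange_big /=; apply: eq_bigr => b _; rewrite mxE mulr_suml.
by apply: eq_bigr => a _; rewrite mxE.
Qed.

End MatrixInverse.

(** * Second order expansions at 0+ *)

Section Jets.
Variable R : realType.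
Implicit Types (f g : R -> R) (a b c : R).

Lemma cvg_fsum (T I : Type) (F : set_system T) (FF : Filter F) (r : seq I)
    (P : pred I) (f : I -> T -> R) (l : I -> R) :
  (forall j, P j -> f j @ F --> l j) ->
  (fun t => \sum_(j <- r | P j) f j t) @ F --> \sum_(j <- r | P j) l j.
Proof.
move=> fl; elim: r => [|j r IH].
  rewrite big_nil; under eq_fun do rewrite big_nil; exact: cvg_cst.
rewrite big_cons; under eq_fun do rewrite big_cons.
case: ifPn => // Pj; apply: cvgD; [exact: fl|exact: IH].
Qed.

Lemma cvg_eqv (T : Type) (F : set_system T) (f : T -> R) a b :
  f @ F --> a -> a = b -> f @ F --> b.
Proof. by move=> fa <-. Qed.

Lemma cvg_rV (T : Type) (F : set_system T) (FF : Filter F) k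
    (z : T -> 'rV[R]_k) (z0 : 'rV[R]_k) :
  (forall A, (fun t => z t 0 A) @ F --> z0 0 A) -> z @ F --> z0.
Proof.
move=> H; apply/cvgrPdist_le => /= e e0.
have HA : forall A, \forall t \near F, `|z0 0 A - z t 0 A| <= e.
  by move=> A; move/cvgrPdist_le: (H A) => /(_ e e0).
have /filter_forall := HA.
apply: filterS => t Ht.
rewrite [leLHS]/Num.Def.normr /= mx_normrE (bigmax_le _ (ltW e0)) //= => -[i A] _.
by rewrite !mxE /= (ord1 i).
Qed.

Lemma rV_norm_le_sum k (h : 'rV[R]_k) : `|h| <= \sum_A `|h 0 A|.
Proof.
rewrite [leLHS]/Num.Def.normr /= mx_normrE bigmax_le ?sumr_ge0 // => -[i A] _ /=.
by rewrite (ord1 i) (bigD1 A) //= lerDl sumr_ge0.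
Qed.

(* f(t) = a + b t^2 + o(t^2) as t -> 0+. *)
Definition jet f a b := (fun t : R => (f t - a) / t ^+ 2) @ 0^'+ --> b.

Lemma near0_neq0 : \forall t \near (0 : R)^'+, t != 0.
Proof. by near=> t; rewrite gt_eqF //; near: t; exact: nbhs_right_gt. Unshelve. all: by end_near. Qed.

Lemma cvg_near_eq f g a :
  (\forall t \near 0^'+, f t = g t) -> f @ 0^'+ --> a -> g @ 0^'+ --> a.
Proof. by move=> fg; apply: cvg_trans; apply: near_eq_cvg; apply: filterS fg. Qed.

Lemma cvg_t : (fun t : R => t) @ 0^'+ --> 0.
Proof. by apply: cvg_at_right_filter; exact: cvg_id. Qed.

Lemma jet_near_eq f g a b :
  (\forall t \near 0^'+, f t = g t) -> jet f a b -> jet g a b.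
Proof. by move=> fg; apply: cvg_near_eq; apply: filterS fg => t ->. Qed.

Lemma jet_cvg f a b : jet f a b -> f @ 0^'+ --> a.
Proof.
move=> jf; have -> : a = b * (0 * 0) + a by rewrite !mulr0 add0r.
apply: (@cvg_near_eq (fun t => (f t - a) / t ^+ 2 * (t * t) + a)).
  apply: filterS near0_neq0 => t t0; rewrite -expr2 divfK ?subrK //.
  by rewrite expf_neq0.
apply: cvgD; last exact: cvg_cst.
by apply: cvgM => //; apply: cvgM; exact: cvg_t.
Qed.

Lemma jet_cst a : jet (fun=> a) a 0.
Proof.
by rewrite /jet; under eq_fun do rewrite subrr mul0r; exact: cvg_cst.
Qed.

Lemma jetD f g a b a' b' : jet f a b -> jet g a' b' ->
  jet (fun t => f t + g t) (a + a') (b + b').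
Proof.
move=> jf jg; rewrite /jet.
under eq_fun do rewrite opprD addrACA mulrDl.
exact: cvgD.
Qed.

Lemma jetN f a b : jet f a b -> jet (fun t => - f t) (- a) (- b).
Proof. by move=> jf; rewrite /jet; under eq_fun do rewrite -opprD mulNr; exact: cvgN. Qed.

Lemma jetB f g a b a' b' : jet f a b -> jet g a' b' ->
  jet (fun t => f t - g t) (a - a') (b - b').
Proof. by move=> jf jg; apply: jetD => //; exact: jetN. Qed.

Lemma jetM f g a b a' b' : jet f a b -> jet g a' b' ->
  jet (fun t => f t * g t) (a * a') (b * a' + a * b').
Proof.
move=> jf jg; rewrite /jet.
have E t : (f t * g t - a * a') / t ^+ 2 =
   (f t - a) / t ^+ 2 * g t + a * ((g t - a') / t ^+ 2) by ring.
under eq_fun do rewrite E.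
apply: cvgD; apply: cvgM => //; [exact: jet_cvg jg|exact: cvg_cst].
Qed.

(** When one factor is [O(t^2)], a mere limit of the other suffices. This spares the second-order
    expansion of quantities for which only a limit is available. *)
Lemma jet0M f g b c : jet f 0 b -> g @ 0^'+ --> c -> jet (fun t => f t * g t) 0 (b * c).
Proof.
move=> jf cg; rewrite /jet.
have E t : (f t * g t - 0) / t ^+ 2 = (f t - 0) / t ^+ 2 * g t by ring.
by under eq_fun do rewrite E; exact: cvgM.
Qed.

Lemma jet_t2 : jet (fun t => t ^+ 2) 0 1.
Proof.
apply: (@cvg_near_eq (fun=> 1)); last exact: cvg_cst.
by apply: filterS near0_neq0 => t t0; rewrite subr0 divff // expf_neq0.
Qed.

Lemma jet_sum (I : Type) (r : seq I) (f : I -> R -> R) (a b : I -> R) :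
  (forall j, jet (f j) (a j) (b j)) ->
  jet (fun t => \sum_(j <- r) f j t) (\sum_(j <- r) a j) (\sum_(j <- r) b j).
Proof.
move=> jf; elim: r => [|j r IH].
  by rewrite !big_nil; under eq_fun do rewrite big_nil; exact: jet_cst.
by rewrite !big_cons; under eq_fun do rewrite big_cons; apply: jetD.
Qed.

Lemma jet_uniq f a b a' b' : jet f a b -> jet f a' b' -> a = a' /\ b = b'.
Proof.
move=> j1 j2; have E : a = a' by apply: (cvg_unique _ (jet_cvg j1) (jet_cvg j2)).
split=> //; move: j2; rewrite -E => j2; exact: (cvg_unique _ j1 j2).
Qed.

Lemma jet_eq f a b a' b' : jet f a b -> a = a' -> b = b' -> jet f a' b'.
Proof. by move=> jf <- <-. Qed.

Lemma cvg_det d (M : R -> 'M[R]_d) (A : 'M[R]_d) :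
  (forall i j, (fun t => M t i j) @ 0^'+ --> A i j) ->
  (fun t => \det (M t)) @ 0^'+ --> \det A.
Proof.
move=> cM; apply: cvg_fsum => s _; apply: cvgM; first exact: cvg_cst.
elim: (index_enum _) => [|j r IH].
  by rewrite big_nil; under eq_fun do rewrite big_nil; exact: cvg_cst.
by rewrite big_cons; under eq_fun do rewrite big_cons; exact: cvgM.
Qed.

Lemma near_unitmx_cvg d (M : R -> 'M[R]_d) (A : 'M[R]_d) :
  (forall i j, (fun t => M t i j) @ 0^'+ --> A i j) -> A \in unitmx ->
  \forall t \near 0^'+, M t \in unitmx.
Proof.
move=> cM; rewrite unitmxE unitfE => A0.
by apply: filterS (cvgr_neq0 _ (cvg_det cM) A0) => t; rewrite unitmxE unitfE.
Qed.

Lemma cvg_invmx d (M : R -> 'M[R]_d) (A : 'M[R]_d) i j :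
  (forall i j, (fun t => M t i j) @ 0^'+ --> A i j) -> A \in unitmx ->
  (fun t => invmx (M t) i j) @ 0^'+ --> invmx A i j.
Proof.
move=> cM Au; rewrite invmxE //.
apply: (@cvg_near_eq (fun t => (\det (M t))^-1 * cofactor (M t) j i)).
  by apply: filterS (near_unitmx_cvg cM Au) => t Mt; rewrite invmxE.
apply: cvgM; first by apply: cvgV; [rewrite -unitfE -unitmxE|exact: cvg_det].
apply: cvgM; first exact: cvg_cst.
by apply: cvg_det => a b; rewrite !mxE; under eq_fun do rewrite !mxE; exact: cM.
Qed.

(* M^-1 - A^-1 = - M^-1 (M - A) A^-1 *)
Lemma jet_invmx d (M : R -> 'M[R]_d) (A B : 'M[R]_d) i j :
  (forall i j, jet (fun t => M t i j) (A i j) (B i j)) -> A \in unitmx ->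
  jet (fun t => invmx (M t) i j) (invmx A i j) (- (invmx A *m B *m invmx A) i j).
Proof.
move=> jM Au; have cM (k l : 'I_d) := jet_cvg (jM k l).
apply: (@cvg_near_eq (fun t => - \sum_b (\sum_a invmx (M t) i a * ((M t a b - A a b) / t ^+ 2)) * invmx A b j)).
  apply: filterS (near_unitmx_cvg cM Au) => t Mt.
  have -> : invmx (M t) i j - invmx A i j = - (invmx (M t) *m (M t - A) *m invmx A) i j.
    by rewrite mulmxBr mulmxBl mulVmx // mul1mx mulmxK // !mxE opprB.
  rewrite mulNr mxE mulr_suml; congr (- _); apply: eq_bigr => b _.
  by rewrite [RHS]mulrAC; congr (_ * _); rewrite mxE mulr_suml; apply: eq_bigr => a _; rewrite !mxE mulrA.
rewrite mxE; apply: cvgN; apply: cvg_fsum => b _; rewrite mxE.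
apply: cvgM; last exact: cvg_cst.
by apply: cvg_fsum => a _; apply: cvgM; [exact: cvg_invmx|exact: jM].
Qed.

(** The curve moves by [O(t^2)], so differentiability at the single point [z0] suffices: the error
    is [o(|z t - z0|)], hence [o(t^2)]. *)
Lemma jet_path k (f : 'rV[R]_k -> R) (z : R -> 'rV[R]_k) (z0 : 'rV[R]_k) (zeta : 'I_k -> R) :
  differentiable f z0 -> (forall A, jet (fun t => z t 0 A) (z0 0 A) (zeta A)) ->
  jet (fun t => f (z t)) (f z0) (\sum_A zeta A * pd A f z0).
Proof.
move=> df jz.
have dfE h : 'd f z0 h = \sum_A h 0 A * pd A f z0.
  rewrite {1}[h]row_sum_delta linear_sum; apply: eq_bigr => A _.
  by rewrite linearZ /= /pd deriveE.
have cz : z @ 0^'+ --> z0 by apply: cvg_rV => A; exact: jet_cvg (jz A).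
have ch : (fun t => z t - z0) @ 0^'+ --> (0 : 'rV[R]_k).
  have -> : (0 : 'rV[R]_k) = z0 - z0 by rewrite subrr.
  by apply: cvgB cz _; exact: cvg_cst.
pose rm (h : 'rV[R]_k) : R := f (h + z0) - (f z0 + 'd f z0 h).
have rmE e : 0 < e -> \forall h \near (0 : 'rV[R]_k), `|rm h| <= e * `|h|.
  move=> e0; have /diff_locallyP [_ /eqaddoP /(_ e e0)] := df.
  by apply: filterS => h.
rewrite /jet.
have E t : (f (z t) - f z0) / t ^+ 2 =
    \sum_A (z t 0 A - z0 0 A) / t ^+ 2 * pd A f z0 + rm (z t - z0) / t ^+ 2.
  rewrite /rm subrK dfE.
  have -> : \sum_A (z t - z0) 0 A * pd A f z0 = \sum_A (z t 0 A - z0 0 A) * pd A f z0.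
    by apply: eq_bigr => A _; rewrite !mxE.
  have -> : \sum_A (z t 0 A - z0 0 A) / t ^+ 2 * pd A f z0 =
            (\sum_A (z t 0 A - z0 0 A) * pd A f z0) / t ^+ 2.
    by rewrite mulr_suml; apply: eq_bigr => A _; rewrite mulrAC.
  by ring.
under eq_fun do rewrite E.
have -> : \sum_A zeta A * pd A f z0 = \sum_A zeta A * pd A f z0 + 0 by rewrite addr0.
apply: cvgD.
  by apply: cvg_fsum => A _; apply: cvgM; [exact: jz|exact: cvg_cst].
pose q t := \sum_A `|(z t 0 A - z0 0 A) / t ^+ 2|.
have cq : q @ 0^'+ --> \sum_A `|zeta A|.
  by apply: cvg_fsum => A _; apply: cvg_norm; exact: jz.
set Q := \sum_A _ in cq.
have Q0 : 0 <= Q by rewrite sumr_ge0.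
apply/cvgr0Pnorm_le => e e0.
(* Near 0 the quotient [|z t - z0| / t^2] stays below [Q + 1], so a remainder of at most
   [e / (Q + 1)] times [|z t - z0|] is at most [e t^2]. *)
have e1 : 0 < e / (Q + 1) by rewrite divr_gt0 // ltr_wpDl.
near=> t.
have t0 : 0 < t by near: t; exact: nbhs_right_gt.
have qQ : q t <= Q + 1.
  by near: t; apply: (cvgr_le _ cq); rewrite ltrDl.
have Hr : `|rm (z t - z0)| <= e / (Q + 1) * `|z t - z0|.
  by near: t; apply: (ch _ (rmE _ e1)).
rewrite normrM normfV [`|t ^+ 2|]ger0_norm ?sqr_ge0 // ler_pdivrMr ?exprn_gt0 //.
apply: le_trans Hr _.
have hq : `|z t - z0| <= q t * t ^+ 2.
  apply: le_trans (rV_norm_le_sum _) _; rewrite mulr_suml ler_sum // => A _.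
  rewrite !mxE normrM normfV [`|t ^+ 2|]ger0_norm ?sqr_ge0 // divfK //.
  by rewrite expf_neq0 // gt_eqF.
rewrite mulrAC ler_pdivrMr ?ltr_wpDl // -mulrA ler_pM2l //.
apply: le_trans hq _; rewrite [leRHS]mulrC.
by apply: ler_wpM2r => //; exact: sqr_ge0.
Unshelve. all: by end_near. Qed.

End Jets.

(** * Expansions in powers of r *)

Section Slices.
Variable R : realType.

Lemma pd_slice_l k l (F : 'rV[R]_(k + l) -> R) i v :
  pd (lshift l i) F v = pd i (fun z => F (row_mx z (rsubmx v))) (lsubmx v).
Proof.
rewrite /pd /derive; set A := fun h => _; set B := fun h => _; suff -> : A = B by [].
apply/funext => h; rewrite {}/A {}/B /=; rewrite hsubmxK.
congr (_ *: (F _ - _)); apply/rowP => j; rewrite !mxE.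
by case: split_ordP => j' ->; rewrite !mxE ?eq_lshift // eq_rlshift mulr0 add0r.
Qed.

Lemma pd_slice_r k l (F : 'rV[R]_(k + l) -> R) i v :
  pd (rshift k i) F v = pd i (fun z => F (row_mx (lsubmx v) z)) (rsubmx v).
Proof.
rewrite /pd /derive; set A := fun h => _; set B := fun h => _; suff -> : A = B by [].
apply/funext => h; rewrite {}/A {}/B /=; rewrite hsubmxK.
congr (_ *: (F _ - _)); apply/rowP => j; rewrite !mxE.
by case: split_ordP => j' ->; rewrite !mxE ?eq_rshift // eq_lrshift mulr0 add0r.
Qed.

Lemma pd_1dim (f : R -> R) (w : 'rV[R]_1) :
  pd ord0 (fun w : 'rV[R]_1 => f (w 0 0)) w = 'D_1 f (w 0 0).
Proof.
rewrite /pd /derive; set A := fun h => _; set B := fun h => _; suff -> : A = B by [].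
apply/funext => h; rewrite {}/A {}/B /=.
by congr (_ *: (f _ - _)); rewrite !mxE !eqxx.
Qed.

Lemma pd_rlast k (F : 'rV[R]_(k + 1) -> R) v :
  pd (rlast k) F v = 'D_1 (fun t => F (row_mx (lsubmx v) (const_mx t))) (rcoord v).
Proof.
rewrite /rlast pd_slice_r.
have -> : (fun w => F (row_mx (lsubmx v) w)) =
    (fun w : 'rV[R]_1 => F (row_mx (lsubmx v) (const_mx (w 0 0)))).
  apply/funext => w; congr (F (row_mx _ _)).
  by apply/matrixP => a b; rewrite (ord1 a) (ord1 b) !mxE.
have -> := pd_1dim (fun t => F (row_mx (lsubmx v) (const_mx t))) (rsubmx v).
by rewrite mxE.
Qed.

Lemma pd_on_Sigma n m (F : 'rV[R]_(n + m) -> R) i x :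
  pd i (fun x => F (on_Sigma m x)) x = pd (tdir m i) F (on_Sigma m x).
Proof.
have := @pd_slice_l n m F i (row_mx x 0).
by rewrite row_mxKl row_mxKr => ->.
Qed.

Lemma lsubmx_continuous k l : continuous (lsubmx : 'rV[R]_(k + l) -> 'rV[R]_k).
Proof. by move=> v; apply: differentiable_continuous; exact: differentiable_lsubmx. Qed.

Lemma rcoord_differentiable k v : differentiable (@rcoord R k) v.
Proof. exact: differentiable_coord. Qed.

Lemma rcoord_continuous k : continuous (@rcoord R k).
Proof. by move=> v; apply: differentiable_continuous; exact: rcoord_differentiable. Qed.

Lemma open_slab k (O : set 'rV[R]_k) : open O ->
  open [set v : 'rV[R]_(k + 1) | O (lsubmx v) /\ 0 < rcoord v].
Proof.
move=> oO.
have -> : [set v : 'rV[R]_(k + 1) | O (lsubmx v) /\ 0 < rcoord v] =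
   (lsubmx @^-1` O) `&` (@rcoord R k @^-1` [set x | 0 < x]) by [].
apply: openI; apply: open_comp => //.
- by move=> v _; exact: lsubmx_continuous.
- by move=> v _; exact: rcoord_continuous.
Qed.

Lemma open_slab_lt k (O : set 'rV[R]_k) (eps : R) : open O ->
  open [set v : 'rV[R]_(k + 1) | O (lsubmx v) /\ 0 < rcoord v < eps].
Proof.
move=> oO.
have -> : [set v : 'rV[R]_(k + 1) | O (lsubmx v) /\ 0 < rcoord v < eps] =
   [set v : 'rV[R]_(k + 1) | O (lsubmx v) /\ 0 < rcoord v] `&`
   (@rcoord R k @^-1` [set x | x < eps]).
  apply/seteqP; split => v /=; first by move=> [? /andP[? ?]].
  by move=> [[? ->] ->].
apply: openI; first exact: open_slab.
by apply: open_comp => [v _|]; [exact: rcoord_continuous|exact: open_lt].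
Qed.

End Slices.

(** Keeps the [z]-directions of a list of derivatives in [(z, r)]. The radial ones are recorded by
    their number [count_mem (rlast k) s]; on products [a(z) phi(r)] nothing else matters. *)
Definition zpart k (s : seq 'I_(k + 1)) : seq 'I_k :=
  pmap (fun i : 'I_(k + 1) =>
    if fintype.split i is inl j then Some j else None) s.

Arguments zpart : simpl never.

(** * Termwise differentiation of expansions *)

Section Expansions.
Variable R : realType.

Lemma is_derive_exp (N : nat) (x : R) : is_derive x 1 (fun r : R => r ^+ N) (N%:R * x ^+ N.-1).
Proof.
apply: DeriveDef; first exact: exprn_derivable.
by rewrite exp_derive [_ *: 1]mulr1.
Qed.

Lemma is_derive_inv (x : R) : x != 0 -> is_derive x 1 (fun r : R => r^-1) (- x ^- 2).
Proof.
move=> x0; have di : derivable (id : R -> R) x 1 by exact: derivable_id.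
apply: DeriveDef; first exact: (derivableV x0 di).
by have := deriveV x0 di; rewrite derive_id [_ *: 1]mulr1.
Qed.

(* (d/dr)^j (r^N (A ln r + B)) = r^(N-j) (A_j ln r + B_j), where
   (A_j, B_j) = prof_coef N (A, B) j. *)
Fixpoint prof_coef (N : nat) (c : R * R) (j : nat) : R * R :=
  if j is j'.+1 then
    let c' := prof_coef N c j' in
    ((N%:R - j'%:R) * c'.1, (N%:R - j'%:R) * c'.2 + c'.1)
  else c.

Lemma prof_coef_log N b c : (prof_coef N (0, b) c).1 = 0.
Proof. by elim: c => //= c ->; rewrite mulr0. Qed.

Lemma prof_coef0 b c : (0 < c)%N -> (prof_coef 0 (0, b) c).2 = 0.
Proof.
case: c => // c _; elim: c => [|c IH]; first by rewrite /= subrr mul0r addr0.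
by move: IH => /= ->; rewrite prof_coef_log !mulr0 addr0.
Qed.

(** The power is written [r ^+ N * r^-1 ^+ j] because [j] may exceed [N], where the natural number
    [N - j] would be truncated to 0. *)
Definition prof (N : nat) (c : R * R) (j : nat) (r : R) : R :=
  r ^+ N * r^-1 ^+ j * ((prof_coef N c j).1 * ln r + (prof_coef N c j).2).

Lemma is_derive_prof N c j (r : R) : 0 < r ->
  is_derive r 1 (prof N c j) (prof N c j.+1 r).
Proof.
move=> r0; have rn0 : r != 0 by rewrite gt_eqF.
have D3 : is_derive r 1 (fun r : R => r^-1 ^+ j) (- (j%:R * r^-1 ^+ j.+1)).
  have -> : - (j%:R * r^-1 ^+ j.+1) = (j%:R * r^-1 ^+ j.-1) * (- r ^- 2).
    case: (j) => [|j'] /=; first by rewrite !mul0r oppr0.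
    by rewrite mulrN -mulrA -exprVn -exprD addn2.
  exact: is_derive1_comp (is_derive_exp j r^-1) (is_derive_inv rn0).
have D4 : is_derive r 1 (@ln R) r^-1 by exact: is_derive1_ln.
pose A := (prof_coef N c j).1; pose B := (prof_coef N c j).2.
have D5 : is_derive r 1 (fun r : R => A * ln r + B) (A * r^-1).
  apply: is_derive_eq (is_deriveD (is_deriveZ A D4) (is_derive_cst B r 1)) _.
  by rewrite addr0.
apply: is_derive_eq (is_deriveM (is_deriveM (is_derive_exp N r) D3) D5) _.
have EN : N%:R * r ^+ N.-1 = N%:R * r ^+ N * r^-1.
  case: (N) => [|M]; first by rewrite !mul0r.
  by rewrite exprSr mulrA mulfK.
rewrite /prof /= -/A -/B EN /GRing.scale /= exprS.
rewrite -[X in X * (A / r)]/(r ^+ N * r^-1 ^+ j).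
by ring.
Qed.

Lemma prof_scaled N c j (r : R) : 0 < r ->
  r ^+ j * prof N c j r = r ^+ N * ((prof_coef N c j).1 * ln r + (prof_coef N c j).2).
Proof.
move=> r0; rewrite /prof !mulrA [r ^+ j * _]mulrC -[r ^+ N * _ * _]mulrA -exprMn.
by rewrite divff ?gt_eqF // expr1n mulr1.
Qed.

Lemma zpart_cons_l k j (s : seq 'I_(k + 1)) : zpart (lshift 1 j :: s) = j :: zpart s.
Proof. by rewrite /zpart /= (unsplitK (inl j)). Qed.

Lemma zpart_cons_r k (s : seq 'I_(k + 1)) : zpart (rlast k :: s) = zpart s.
Proof. by rewrite /zpart /= (unsplitK (inr ord0)). Qed.

Lemma zpart_lshift k (s : seq 'I_k) : zpart (map (lshift 1) s) = s.
Proof. by elim: s => //= i s IH; rewrite zpart_cons_l IH. Qed.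

Lemma count_rlast_lshift k (s : seq 'I_k) :
  count_mem (rlast k) (map (lshift 1) s) = 0%N.
Proof. by elim: s => //= i s ->; rewrite /rlast eq_lrshift. Qed.

Definition tensor k (a : 'rV[R]_k -> R) (phi : R -> R) (v : 'rV[R]_(k + 1)) : R :=
  a (lsubmx v) * phi (rcoord v).

Lemma rcoord_row k (z : 'rV[R]_k) (w : 'rV[R]_1) : rcoord (row_mx z w) = w 0 0.
Proof. by rewrite /rcoord /rlast row_mxEr. Qed.

Lemma pd_tensor_l k (a : 'rV[R]_k -> R) phi i v : differentiable a (lsubmx v) ->
  pd (lshift 1 i) (tensor a phi) v = tensor (pd i a) phi v.
Proof.
move=> da; rewrite pd_slice_l /tensor.
under eq_fun do rewrite row_mxKl rcoord_row mxE.
rewrite pdM ?pd_cst ?mulr0 ?addr0 //; exact: differentiable_cst.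
Qed.

Lemma pd_tensor_r k (a : 'rV[R]_k -> R) phi dphi v :
  is_derive (rcoord v) 1 phi dphi ->
  pd (rlast k) (tensor a phi) v = a (lsubmx v) * dphi.
Proof.
move=> dphi'; rewrite pd_rlast /tensor.
under eq_fun do rewrite row_mxKl rcoord_row mxE.
have := is_deriveZ (a (lsubmx v)) dphi'.
by move=> /(@derive_val _ _ _ _ _ _ _).
Qed.

Lemma pds_tensor k (O : set 'rV[R]_k) (a : 'rV[R]_k -> R) N c s v :
  open O -> smooth_open O a -> O (lsubmx v) -> 0 < rcoord v ->
  pds s (tensor a (prof N c 0)) v =
  tensor (pds (zpart s) a) (prof N c (count_mem (rlast k) s)) v.
Proof.
move=> oO sa; elim: s v => [|i s IH] v Ov rv //=.
have oS := open_slab oO.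
rewrite (pd_eq_open (O := [set v | O (lsubmx v) /\ 0 < rcoord v])
  (g := tensor (pds (zpart s) a) (prof N c (count_mem (rlast k) s))) i oS) //; last first.
  by move=> q [? ?]; exact: IH.
case: (split_ordP i) => j ->.
  rewrite pd_tensor_l; last exact: sa.
  by rewrite /rlast eq_lrshift add0n zpart_cons_l.
have -> : rshift k j = rlast k by rewrite (ord1 j).
by rewrite (pd_tensor_r _ (is_derive_prof _ _ _ rv)) eqxx add1n zpart_cons_r.
Qed.

Lemma smooth_tensor k (O : set 'rV[R]_k) (a : 'rV[R]_k -> R) N c :
  open O -> smooth_open O a ->
  smooth_open [set v | O (lsubmx v) /\ 0 < rcoord v] (tensor a (prof N c 0)).
Proof.
move=> oO sa s v [Ov rv].
apply: (@differentiable_near_eq _ _ (tensor (pds (zpart s) a) (prof N c (count_mem (rlast k) s)))).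
  apply: (nbhs_near_eq (open_slab oO)) => // q [? ?].
  by rewrite (pds_tensor _ _ _ oO).
apply: differentiableMf.
  apply: differentiable_comp; first exact: differentiable_lsubmx.
  exact: sa.
apply: differentiable_comp; first exact: rcoord_differentiable.
apply/derivable1_diffP.
exact: (@ex_derive _ _ _ _ _ _ _ (is_derive_prof _ _ _ rv)).
Qed.

Lemma cvg_tX (j : nat) : (0 < j)%N -> (fun t : R => t ^+ j) @ 0^'+ --> 0.
Proof.
case: j => // j _; elim: j => [|j IH]; first exact: cvg_t.
under eq_fun do rewrite exprS.
apply: (@cvg_eqv _ _ _ _ (0 * 0)); last by rewrite mulr0.
by apply: cvgM IH; exact: cvg_t.
Qed.

(** The bound [ln s <= s] at [s = 1 / sqrt t] gives [|t ln t| <= 2 sqrt t]. *)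
Lemma cvg_tlnt : (fun t : R => t * ln t) @ 0^'+ --> 0.
Proof.
apply/cvgr0Pnorm_le => e e0.
near=> t.
have t0 : 0 < t by near: t; exact: nbhs_right_gt.
have t1 : t < 1 by near: t; exact: nbhs_right_lt.
have te : t < (e / 2) ^+ 2 by near: t; apply: nbhs_right_lt; rewrite exprn_gt0 ?divr_gt0.
have s0 : 0 < Num.sqrt t by rewrite sqrtr_gt0.
have ht : t = Num.sqrt t ^+ 2 by rewrite sqr_sqrtr // ltW.
have hl : - ln t = 2 * ln (Num.sqrt t)^-1.
  by rewrite lnV ?posrE // {1}ht lnXn // mulrN mulr_natl.
have hle := ln_sublinear (_ : 0 < (Num.sqrt t)^-1).
have l0 : 0 <= - ln t by rewrite oppr_ge0 ln_le0 // ltW.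
have se : Num.sqrt t <= e / 2.
  by rewrite -(@ler_pXn2r _ 2) ?nnegrE ?ltW ?divr_gt0 // -ht.
rewrite /= normrM gtr0_norm // ler0_norm -?oppr_ge0 // hl.
apply: (@le_trans _ _ (t * (2 * (Num.sqrt t)^-1))).
  by rewrite ler_pM2l // ler_pM2l // ltW // hle // invr_gt0.
have -> : t * (2 * (Num.sqrt t)^-1) = Num.sqrt t * 2 by rewrite {1}ht; field; rewrite gt_eqF.
by move: se; rewrite ler_pdivlMr.
Unshelve. all: by end_near. Qed.

Definition bpt k (z : 'rV[R]_k) (t : R) : 'rV[R]_(k + 1) := row_mx z (const_mx t).

Lemma cvg_bpt k (z : R -> 'rV[R]_k) (z0 : 'rV[R]_k) :
  z @ 0^'+ --> z0 -> (fun t => bpt (z t) t) @ 0^'+ --> at_boundary z0.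
Proof.
move=> cz; apply: cvg_rV => A; rewrite /bpt /at_boundary.
case: (split_ordP A) => j ->.
  under eq_fun do rewrite row_mxEl; rewrite row_mxEl.
  by apply: (@cvg_comp _ _ _ z (fun M : 'rV[R]_k => M 0 j) _ _ _ cz); exact: coord_continuous.
under eq_fun do rewrite row_mxEr mxE; rewrite row_mxEr mxE.
exact: cvg_t.
Qed.

(** The factor [t ^+ count] restores the powers of [t] lost by the radial derivatives, which is the
    form in which the remainder is controlled. [(prof_coef j (0, 1) c).2] is the falling factorial
    [j (j - 1) ... (j - c + 1)]. The base point may move with [t], so the coefficients are evaluated
    at [z t]. *)
Lemma expansion_asymp k (O : set 'rV[R]_k) (eps : R) N (f : 'rV[R]_(k + 1) -> R) a
    (z : R -> 'rV[R]_k) (z0 : 'rV[R]_k) s p :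
  open O -> 0 < eps ->
  smooth_open [set v | O (lsubmx v) /\ 0 < rcoord v < eps] f ->
  even_expansion O N f a -> O z0 -> z @ 0^'+ --> z0 -> (p < N)%N ->
  (fun t => (t ^+ count_mem (rlast k) s * pds s f (bpt (z t) t)
     - \sum_(j < p.+1) pds (zpart s) (a j) (z t) *
          (prof_coef j (0, 1) (count_mem (rlast k) s)).2 * t ^+ j) / t ^+ p) @ 0^'+ --> 0.
Proof.
move=> oO eps0 sf [w [[sa sw] aodd w0 Hrem]] Oz cz pN.
set cnt := count_mem _ s.
pose cf j t := pds (zpart s) (a j) (z t) * (prof_coef j (0, 1) cnt).2.
set D := [set v : 'rV[R]_(k + 1) | O (lsubmx v) /\ 0 < rcoord v < eps] in sf.
have oD : open D by exact: open_slab_lt.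
have DS : D `<=` [set v | O (lsubmx v) /\ 0 < rcoord v] by move=> v [? /andP[? ?]].
(* Powers and logarithm are both values of [prof], with initial pairs [(0, 1)] and [(1, 0)], so
   [pds_tensor] differentiates either of them. *)
pose rem := fun v => f v - \sum_(j < N.+1) tensor (a j) (prof j (0, 1) 0) v
   - tensor w (prof N (1, 0) 0) v.
have remE : rem = (fun v => f v
      - \sum_(j < N.+1) a j (lsubmx v) * rcoord v ^+ j
      - w (lsubmx v) * rcoord v ^+ N * ln (rcoord v)).
  apply/funext => v; rewrite /rem /tensor /prof /= expr0; congr (_ - _ - _).
    by apply: eq_bigr => j _; rewrite mul0r add0r !mulr1.
  by rewrite mulr1 mul1r addr0 mulrA.
have sTa (j : 'I_N.+1) : smooth_open D (tensor (a j) (prof j (0, 1) 0)).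
  by apply: smooth_subset DS _; apply: smooth_tensor => //; apply: sa; rewrite -ltnS.
have sTw : smooth_open D (tensor w (prof N (1, 0) 0)).
  by apply: smooth_subset DS _; apply: smooth_tensor.
have Hz : \forall t \near 0^'+, O (z t) by apply: cz; exact: open_nbhs_nbhs.
have HD : \forall t \near 0^'+, D (bpt (z t) t).
  near=> t; rewrite /D /= /bpt row_mxKl rcoord_row mxE; split.
    by near: t.
  by apply/andP; split; near: t; [exact: nbhs_right_gt|exact: nbhs_right_lt].
have pdsf t : D (bpt (z t) t) -> t ^+ cnt * pds s f (bpt (z t) t) =
   t ^+ cnt * pds s rem (bpt (z t) t)
   + \sum_(0 <= j < N.+1) cf j t * t ^+ j
   + pds (zpart s) w (z t) * (t ^+ N * ((prof_coef N (1, 0) cnt).1 * ln t + (prof_coef N (1, 0) cnt).2)).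
  move=> Dv; have := Dv; rewrite /D /= /bpt row_mxKl rcoord_row mxE => -[Ozt /andP[t0 _]].
  rewrite /rem (pdsB _ oD) //; last by apply: smoothB => //; exact: smooth_sum.
  rewrite (pdsB _ oD) //; last exact: smooth_sum.
  rewrite (pds_sum _ _ oD) //.
  rewrite (pds_tensor _ _ _ oO) ?rcoord_row ?mxE ?row_mxKl //.
  rewrite (eq_bigr (fun j : 'I_N.+1 =>
     tensor (pds (zpart s) (a j)) (prof j (0, 1) cnt) (bpt (z t) t))); last first.
    move=> j _; apply: (pds_tensor _ _ _ oO); rewrite /bpt ?rcoord_row ?mxE ?row_mxKl //.
    by apply: sa; rewrite -ltnS.
  rewrite /tensor /bpt row_mxKl rcoord_row mxE -/cnt -/(bpt _ _).
  rewrite -prof_scaled //.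
  have -> : \sum_(0 <= j < N.+1) cf j t * t ^+ j =
     t ^+ cnt * \sum_(j < N.+1) pds (zpart s) (a j) (z t) * prof j (0, 1) cnt t.
    rewrite big_mkord mulr_sumr; apply: eq_bigr => j _.
    rewrite [RHS]mulrCA prof_scaled // -mulrA; congr (_ * _).
    by rewrite prof_coef_log mul0r add0r mulrC.
  by ring.
(* The remainder, the powers above [p], and the logarithmic term, each divided by [t ^+ p]; each
   tends to 0 because [p < N]. *)
pose T1 t := t ^+ cnt * pds s rem (bpt (z t) t) / t ^+ p.
pose T2 t := \sum_(p.+1 <= j < N.+1) cf j t * t ^+ (j - p).
pose T3 t := pds (zpart s) w (z t) * ((prof_coef N (1, 0) cnt).1 * (t ^+ (N - p) * ln t)
   + (prof_coef N (1, 0) cnt).2 * t ^+ (N - p)).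
apply: (@cvg_near_eq _ (fun t => T1 t + T2 t + T3 t)).
  near=> t.
  have t0 : 0 < t by near: t; exact: nbhs_right_gt.
  have tn0 : t ^+ p != 0 by rewrite expf_neq0 // gt_eqF.
  rewrite pdsf; last by near: t.
  rewrite -(big_mkord xpredT (fun j => cf j t * t ^+ j)).
  rewrite (@big_cat_nat _ _ _ p.+1 0 N.+1) //=; last by rewrite ltnS ltnW.
  have EN : t ^+ N = t ^+ (N - p) * t ^+ p by rewrite -exprD subnK // ltnW.
  have -> : T2 t = (\sum_(p.+1 <= j < N.+1) cf j t * t ^+ j) / t ^+ p.
    rewrite /T2 mulr_suml; apply: eq_big_nat => j /andP[pj _].
    have -> : t ^+ j = t ^+ (j - p) * t ^+ p by rewrite -exprD subnK // ltnW.
    by rewrite -!mulrA divff // mulr1.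
  rewrite /T1 /T3 EN; field; exact: tn0.
have cont g : smooth_open O g -> (fun t => pds (zpart s) g (z t)) @ 0^'+ --> pds (zpart s) g z0.
  move=> sg; apply: (@cvg_comp _ _ _ z (pds (zpart s) g) _ _ _ cz).
  by apply: differentiable_continuous; exact: sg.
apply: (@cvg_eqv _ _ _ _ (0 + 0 + 0)); last by rewrite !addr0.
apply: cvgD; first apply: cvgD.
- apply/cvgr0Pnorm_le => e e0.
  have := Hrem s z0 Oz e e0; rewrite near_withinE -remE => /(cvg_bpt cz) Hr.
  near=> t.
  have t0 : 0 < t by near: t; exact: nbhs_right_gt.
  have t1 : t <= 1 by near: t; apply: nbhs_right_ltW.
  have : `|t ^+ cnt * pds s rem (bpt (z t) t)| <= e * t ^+ N.
    have : (0 < rcoord (bpt (z t) t) ->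
       `|rcoord (bpt (z t) t) ^+ count_mem (rlast k) s * pds s rem (bpt (z t) t)| <= e * rcoord (bpt (z t) t) ^+ N).
      by near: t; apply: Hr.
    by rewrite /bpt rcoord_row mxE; apply.
  have -> : T1 t = (t ^+ cnt * pds s rem (bpt (z t) t)) * (t ^+ p)^-1 by [].
  rewrite [`|_ / t ^+ p|]normrM normfV [`|t ^+ p|]gtr0_norm ?exprn_gt0 // ler_pdivrMr ?exprn_gt0 // => h.
  apply: le_trans h _; rewrite ler_pM2l //.
  by apply: ler_wiXn2l; rewrite ?(ltW t0) ?(ltnW pN).
- have -> : T2 = fun t => \sum_(i <- index_iota p.+1 N.+1 | (p < i < N.+1)%N && true)
      cf i t * t ^+ (i - p).
    by apply/funext => t; rewrite /T2 big_nat_cond.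
  apply: (@cvg_eqv _ _ _ _ (\sum_(i <- index_iota p.+1 N.+1 | (p < i < N.+1)%N && true) (0 : R))); last by rewrite big1.
  apply: cvg_fsum => i /andP[/andP[pi iN] _].
  apply: (@cvg_eqv _ _ _ _ (pds (zpart s) (a i) z0 * (prof_coef i (0, 1) cnt).2 * 0)); last by rewrite mulr0.
  apply: cvgM; last by apply: cvg_tX; rewrite subn_gt0.
  by apply: cvgM; [apply: cont; exact: sa|exact: cvg_cst].
- apply: (@cvg_eqv _ _ _ _ (pds (zpart s) w z0 * ((prof_coef N (1, 0) cnt).1 * 0
   + (prof_coef N (1, 0) cnt).2 * 0))); last by rewrite !mulr0 addr0 mulr0.
  have Np : (0 < N - p)%N by rewrite subn_gt0.
  apply: cvgM; first exact: cont.
  apply: cvgD; apply: cvgM; try exact: cvg_cst; last exact: cvg_tX.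
  case: (N - p)%N Np => // M _.
  case: M => [|M]; first by under eq_fun do rewrite expr1; exact: cvg_tlnt.
  under eq_fun do rewrite exprS mulrAC mulrC.
  apply: (@cvg_eqv _ _ _ _ (0 * 0)); last by rewrite mulr0.
  by apply: cvgM; [exact: cvg_tX|exact: cvg_tlnt].
Unshelve. all: by end_near. Qed.

End Expansions.

Lemma pds_cst0 (R : realType) k s : pds s (fun=> 0 : R) = (fun=> 0) :> ('rV[R]_k -> R).
Proof. by elim: s => //= i s ->; apply/funext => p; rewrite pd_cst. Qed.

(** * Limits and jets of expansions along curves *)

Section ExpansionJets.
Variable R : realType.
Variables (k : nat) (O : set 'rV[R]_k) (eps : R) (N : nat).
Variables (f : 'rV[R]_(k + 1) -> R) (a : nat -> 'rV[R]_k -> R).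
Hypotheses (oO : open O) (eps0 : 0 < eps).
Hypothesis sf : smooth_open [set v | O (lsubmx v) /\ 0 < rcoord v < eps] f.
Hypothesis ef : even_expansion O N f a.
Variables (z : R -> 'rV[R]_k) (z0 : 'rV[R]_k).
Hypotheses (Oz : O z0) (cz : z @ 0^'+ --> z0).

Local Notation zt t := (bpt (z t) t).

Lemma expansion_smooth j : (j <= N)%N -> smooth_open O (a j).
Proof. by case: ef => w [[sa _] _ _ _]; exact: sa. Qed.

Lemma expansion_odd s j y : odd j -> (j < N)%N -> O y -> pds s (a j) y = 0.
Proof.
move=> oj jN Oy; case: ef => w [_ aodd _ _].
rewrite (@pds_eq_open _ _ O _ (fun=> 0) s oO _ y Oy) ?pds_cst0 //.
by move=> q; exact: aodd.
Qed.

Lemma expansion_cvg s j : (j <= N)%N ->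
  (fun t => pds s (a j) (z t)) @ 0^'+ --> pds s (a j) z0.
Proof.
move=> jN; apply: (@cvg_comp _ _ _ z (pds s (a j)) _ _ _ cz).
by apply: differentiable_continuous; exact: (expansion_smooth jN).
Qed.

Lemma near_path_in : \forall t \near 0^'+, O (z t).
Proof. by apply: cz; exact: open_nbhs_nbhs. Qed.

(** There are two sources of order [t^2]: the coefficient of [r^2] at the endpoint, and the change
    of the leading coefficient along the curve. The coefficient of [r] is absent by parity. *)
Lemma jet_expansion s zeta : (2 < N)%N ->
  (forall A, jet (fun t => z t 0 A) (z0 0 A) (zeta A)) ->
  jet (fun t => pds (map (lshift 1) s) f (zt t)) (pds s (a 0%N) z0)
    (pds s (a 2%N) z0 + \sum_A zeta A * pd A (pds s (a 0%N)) z0).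
Proof.
move=> N2 jz.
have := expansion_asymp (map (lshift 1) s) oO eps0 sf ef Oz cz N2.
rewrite zpart_lshift count_rlast_lshift => H0.
have H1 := jet_path (expansion_smooth (leq0n N) s Oz) jz.
have H2 := @expansion_cvg s _ (ltnW N2).
rewrite /jet; apply: (@cvg_near_eq _ (fun t => (t ^+ 0 * pds (map (lshift 1) s) f (zt t)
     - \sum_(j < 3) pds s (a j) (z t) * (prof_coef j (0, 1) 0).2 * t ^+ j) / t ^+ 2
     + (pds s (a 2%N) (z t) + (pds s (a 0%N) (z t) - pds s (a 0%N) z0) / t ^+ 2))); last first.
  apply: (cvg_eqv (a := 0 + (pds s (a 2%N) z0 + \sum_A zeta A * pd A (pds s (a 0%N)) z0))).
    by apply: cvgD; [exact: H0|apply: cvgD; [exact: H2|exact: H1]].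
  by rewrite add0r.
near=> t.
have t0 : t != 0 by near: t; exact: near0_neq0.
rewrite !big_ord_recl big_ord0 /= (@expansion_odd s 1%N) ?(ltn_trans _ N2) //; last by near: t; exact: near_path_in.
by rewrite !expr0; field.
Unshelve. all: by end_near. Qed.

Lemma zpart_nseq_r c : zpart (nseq c (rlast k)) = [::].
Proof. by elim: c => //= c; rewrite zpart_cons_r. Qed.

(** A radial derivative removes [a 0] and parity removes [a 1], so [a 2] is the leading coefficient
    even after division by [t^2]. *)
Lemma cvg_radial c : (0 < c)%N -> (2 < N)%N ->
  (fun t => t ^+ c * pds (nseq c (rlast k)) f (zt t) / t ^+ 2) @ 0^'+ -->
  a 2%N z0 * (prof_coef 2 (0, 1 : R) c).2.
Proof.
move=> c0 N2.
have := expansion_asymp (nseq c (rlast k)) oO eps0 sf ef Oz cz N2.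
rewrite count_nseq /= eqxx mul1n zpart_nseq_r => H0.
have H2 := @expansion_cvg [::] _ (ltnW N2).
apply: (@cvg_near_eq _ (fun t => (t ^+ c * pds (nseq c (rlast k)) f (zt t)
     - \sum_(j < 3) a j (z t) * (prof_coef j (0, 1) c).2 * t ^+ j) / t ^+ 2
     + a 2%N (z t) * (prof_coef 2 (0, 1) c).2)); last first.
  apply: (cvg_eqv (a := 0 + a 2%N z0 * (prof_coef 2 (0, 1) c).2)); last by rewrite add0r.
  by apply: cvgD; [exact: H0|apply: cvgM; [exact: H2|exact: cvg_cst]].
near=> t.
have t0 : t != 0 by near: t; exact: near0_neq0.
have Ot : O (z t) by near: t; exact: near_path_in.
have a1 : a 1%N (z t) = 0 by apply: (@expansion_odd [::]) => //; apply: ltn_trans N2.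
rewrite !big_ord_recl big_ord0 /= /bump !leq0n !add1n a1 prof_coef0 //.
by field.
Unshelve. all: by end_near. Qed.

Lemma cvg_dr_over_r : (2 < N)%N ->
  (fun t => pd (rlast k) f (zt t) / t) @ 0^'+ --> 2 * a 2%N z0.
Proof.
move=> N2; apply: cvg_near_eq (cvg_eqv (@cvg_radial 1 _ N2) _) => //=; last by ring.
by apply: filterS (@near0_neq0 R) => t t0; field.
Qed.

Lemma cvg_dr : (2 < N)%N -> (fun t => pd (rlast k) f (zt t)) @ 0^'+ --> 0.
Proof.
move=> N2; apply: (@cvg_near_eq _ (fun t => pd (rlast k) f (zt t) / t * t)).
  by apply: filterS (@near0_neq0 R) => t t0; rewrite divfK.
apply: (cvg_eqv (a := 2 * a 2%N z0 * 0)); last by rewrite mulr0.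
by apply: cvgM; [exact: cvg_dr_over_r|exact: cvg_t].
Qed.

Lemma cvg_drr : (2 < N)%N ->
  (fun t => pd (rlast k) (pd (rlast k) f) (zt t)) @ 0^'+ --> 2 * a 2%N z0.
Proof.
move=> N2; apply: cvg_near_eq (cvg_eqv (@cvg_radial 2 _ N2) _) => //=; last by ring.
by apply: filterS (@near0_neq0 R) => t t0; field.
Qed.

(** One radial and one tangential derivative, in either order: [t] times the derivative is
    [2 t^2 d_i (a 2) + o(t^2)], so the derivative itself is [O(t)]. *)
Lemma cvg_mixed s i : (2 < N)%N -> zpart s = [:: i] -> count_mem (rlast k) s = 1%N ->
  (fun t => pds s f (zt t)) @ 0^'+ --> 0.
Proof.
move=> N2 zs cs.
have := expansion_asymp s oO eps0 sf ef Oz cz N2; rewrite zs cs => H0.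
have H2 := @expansion_cvg [:: i] _ (ltnW N2).
apply: (@cvg_near_eq _ (fun t => ((t ^+ 1 * pds s f (zt t)
     - \sum_(j < 3) pds [:: i] (a j) (z t) * (prof_coef j (0, 1) 1).2 * t ^+ j) / t ^+ 2
     + 2 * pds [:: i] (a 2%N) (z t)) * t)); last first.
  apply: (cvg_eqv (a := (0 + 2 * pds [:: i] (a 2%N) z0) * 0)); last by rewrite mulr0.
  apply: cvgM; last exact: cvg_t.
  apply: cvgD; last by apply: cvgM; [exact: cvg_cst|exact: H2].
  exact: H0.
near=> t.
have t0 : t != 0 by near: t; exact: near0_neq0.
have Ot : O (z t) by near: t; exact: near_path_in.
have a1 : pds [:: i] (a 1%N) (z t) = 0 by apply: expansion_odd => //; apply: ltn_trans N2.
rewrite !big_ord_recl big_ord0 /= /bump !leq0n !add1n.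
move: a1 => /= ->.
by field.
Unshelve. all: by end_near. Qed.

End ExpansionJets.

(** * Radial derivatives to fourth order over a fixed base point *)

Section ConstantPath.
Variable R : realType.
Variables (k : nat) (O : set 'rV[R]_k) (eps : R) (N : nat).
Variables (f : 'rV[R]_(k + 1) -> R) (a : nat -> 'rV[R]_k -> R).
Hypotheses (oO : open O) (eps0 : 0 < eps).
Hypothesis sf : smooth_open [set v | O (lsubmx v) /\ 0 < rcoord v < eps] f.
Hypothesis ef : even_expansion O N f a.
Variables (z0 : 'rV[R]_k).
Hypotheses (Oz : O z0) (N4 : (4 < N)%N).

Lemma cvg_const_path : (fun=> z0) @ (0 : R)^'+ --> z0.
Proof. exact: cvg_cst. Qed.

(** The terms up to [t^4] enter here. The base point is fixed, so that [a 2] contributes only its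
    value; [a 1] and [a 3] vanish by parity, and the radial derivative removes [a 0]. *)
Lemma jet_radial c : (0 < c)%N ->
  jet (fun t => t ^+ c * pds (nseq c (rlast k)) f (bpt z0 t) / t ^+ 2)
    (a 2%N z0 * (prof_coef 2 (0, 1 : R) c).2) (a 4%N z0 * (prof_coef 4 (0, 1 : R) c).2).
Proof.
move=> c0.
have := expansion_asymp (nseq c (rlast k)) oO eps0 sf ef Oz cvg_const_path N4.
rewrite count_nseq /= eqxx mul1n zpart_nseq_r => H0.
apply: (@cvg_near_eq _ (fun t => (t ^+ c * pds (nseq c (rlast k)) f (bpt z0 t)
     - \sum_(j < 5) a j z0 * (prof_coef j (0, 1) c).2 * t ^+ j) / t ^+ 4
     + a 4%N z0 * (prof_coef 4 (0, 1) c).2)); last first.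
  apply: (cvg_eqv (a := 0 + a 4%N z0 * (prof_coef 4 (0, 1) c).2)); last by rewrite add0r.
  by apply: cvgD; [exact: H0|exact: cvg_cst].
apply: filterS (@near0_neq0 R) => t t0.
have odd0 j : odd j -> (j < 4)%N -> a j z0 = 0.
  by move=> oj j4; apply: (expansion_odd oO ef [::]) => //; apply: ltn_trans N4.
rewrite !big_ord_recl big_ord0 /= /bump !leq0n !add1n (odd0 1%N) // (odd0 3%N) // prof_coef0 //.
by field.
Qed.

Lemma jet_dr_over_r :
  jet (fun t => pd (rlast k) f (bpt z0 t) / t) (2 * a 2%N z0) (4 * a 4%N z0).
Proof.
apply: jet_near_eq (jet_eq (@jet_radial 1 _) _ _) => //=; try by ring.
by apply: filterS (@near0_neq0 R) => t t0; field.
Qed.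

Lemma jet_drr :
  jet (fun t => pd (rlast k) (pd (rlast k) f) (bpt z0 t)) (2 * a 2%N z0) (12 * a 4%N z0).
Proof.
apply: jet_near_eq (jet_eq (@jet_radial 2 _) _ _) => //=; try by ring.
by apply: filterS (@near0_neq0 R) => t t0; field.
Qed.

End ConstantPath.

(** * Curvature *)

Section ChristoffelFormula.
Variables (R : realType) (d : nat).
Implicit Types (Gi : 'I_d -> 'I_d -> R) (D : 'I_d -> 'I_d -> 'I_d -> R).

(* D A E B stands for d_A G_(EB). *)
Definition chr Gi D C A B : R :=
  2^-1 * \sum_E Gi C E * (D A E B + D B E A - D E A B).

(* The variation of chr when the metric varies by m and D by dD. *)
Definition dchr Gi (m : 'I_d -> 'I_d -> R) D (dD : 'I_d -> 'I_d -> 'I_d -> R) C A B : R :=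
  2^-1 * \sum_E (- (\sum_F \sum_H Gi C F * m F H * Gi H E) *
                   (D A E B + D B E A - D E A B)
                 + Gi C E * (dD A E B + dD B E A - dD E A B)).

(* DD e A E B stands for d_e d_A G_(EB). *)
Definition ric Gi D (DD : 'I_d -> 'I_d -> 'I_d -> 'I_d -> R) B C : R :=
  \sum_A (dchr Gi (D A) D (DD A) A B C - dchr Gi (D B) D (DD B) A A C
    + \sum_F (chr Gi D A A F * chr Gi D F B C - chr Gi D A B F * chr Gi D F A C)).

Lemma cvg_chr (Gi : R -> 'I_d -> 'I_d -> R) Gi0 (D : R -> 'I_d -> 'I_d -> 'I_d -> R) D0 :
  (forall A B, (fun t => Gi t A B) @ 0^'+ --> Gi0 A B) ->
  (forall A B C, (fun t => D t A B C) @ 0^'+ --> D0 A B C) ->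
  forall C A B, (fun t => chr (Gi t) (D t) C A B) @ 0^'+ --> chr Gi0 D0 C A B.
Proof.
move=> cG cD C A B; apply: cvgM; first exact: cvg_cst.
apply: cvg_fsum => E _; apply: cvgM => //.
by apply: cvgB => //; apply: cvgD.
Qed.

Lemma cvg_dchr (Gi : R -> 'I_d -> 'I_d -> R) Gi0 (m : R -> 'I_d -> 'I_d -> R) m0
   (D dD : R -> 'I_d -> 'I_d -> 'I_d -> R) D0 dD0 :
  (forall A B, (fun t => Gi t A B) @ 0^'+ --> Gi0 A B) ->
  (forall A B, (fun t => m t A B) @ 0^'+ --> m0 A B) ->
  (forall A B C, (fun t => D t A B C) @ 0^'+ --> D0 A B C) ->
  (forall A B C, (fun t => dD t A B C) @ 0^'+ --> dD0 A B C) ->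
  forall C A B, (fun t => dchr (Gi t) (m t) (D t) (dD t) C A B) @ 0^'+ -->
    dchr Gi0 m0 D0 dD0 C A B.
Proof.
move=> cG cm cD cdD C A B; apply: cvgM; first exact: cvg_cst.
apply: cvg_fsum => E _; apply: cvgD; apply: cvgM => //.
- apply: cvgN; apply: cvg_fsum => F _; apply: cvg_fsum => H _.
  by apply: cvgM => //; apply: cvgM.
- by apply: cvgB => //; apply: cvgD.
- by apply: cvgB => //; apply: cvgD.
Qed.

Lemma cvg_ric (Gi : R -> 'I_d -> 'I_d -> R) Gi0
   (D : R -> 'I_d -> 'I_d -> 'I_d -> R) D0
   (DD : R -> 'I_d -> 'I_d -> 'I_d -> 'I_d -> R) DD0 :
  (forall A B, (fun t => Gi t A B) @ 0^'+ --> Gi0 A B) ->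
  (forall A B C, (fun t => D t A B C) @ 0^'+ --> D0 A B C) ->
  (forall A B C E, (fun t => DD t A B C E) @ 0^'+ --> DD0 A B C E) ->
  forall B C, (fun t => ric (Gi t) (D t) (DD t) B C) @ 0^'+ --> ric Gi0 D0 DD0 B C.
Proof.
move=> cG cD cDD B C; apply: cvg_fsum => A _; apply: cvgD.
  by apply: cvgB; apply: cvg_dchr.
apply: cvg_fsum => F _.
by apply: cvgB; apply: cvgM; apply: cvg_chr.
Qed.

(** Both the inverse metric and the metric derivatives vary; the product rule for jets yields
    exactly [dchr], the formula that [pd_chr] finds for ordinary derivatives. This common form lets
    the variation along the graph be compared with derivatives of [christoffel]. *)
Lemma jet_chr (M : R -> 'M[R]_d) (M0 M2 : 'M[R]_d)
   (D : R -> 'I_d -> 'I_d -> 'I_d -> R) D0 D2 :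
  M0 \in unitmx ->
  (forall A B, jet (fun t => M t A B) (M0 A B) (M2 A B)) ->
  (forall A B C, jet (fun t => D t A B C) (D0 A B C) (D2 A B C)) ->
  forall C A B, jet (fun t => chr (invmx (M t)) (D t) C A B)
    (chr (invmx M0) D0 C A B) (dchr (invmx M0) M2 D0 D2 C A B).
Proof.
move=> uM jM jD C A B.
have jI F E : jet (fun t => invmx (M t) F E) (invmx M0 F E)
    (- (\sum_K \sum_H invmx M0 F K * M2 K H * invmx M0 H E)).
  apply: (jet_eq (@jet_invmx _ _ _ _ _ F E jM uM)) => //; rewrite mxE; congr (- _).
  rewrite exchange_big /=; apply: eq_bigr => H _.
  by rewrite mxE mulr_suml.
rewrite /chr /dchr; apply: jet_eq.
- apply: jetM; first exact: jet_cst.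
  apply: jet_sum => E; apply: jetM; first exact: jI.
  by apply: jetB; [apply: jetD; exact: jD|exact: jD].
- by [].
- by rewrite mul0r add0r.
Qed.

Lemma differentiable_chr k (M : 'rV[R]_k -> 'M[R]_d)
    (D : 'I_d -> 'I_d -> 'I_d -> 'rV[R]_k -> R) p C A B :
  (forall i j, differentiable (fun q => M q i j) p) -> M p \in unitmx ->
  (forall i j l, differentiable (D i j l) p) ->
  differentiable (fun q => chr (invmx (M q)) (fun i j l => D i j l q) C A B) p.
Proof.
move=> dM uM dD; apply: differentiableMf; first exact: differentiable_cst.
apply: differentiable_fsum => E; apply: differentiableMf; first exact: differentiable_invmx.
by apply: differentiableB => //; apply: differentiableD.
Qed.

Lemma pd_chr k (M : 'rV[R]_k -> 'M[R]_d)
    (D : 'I_d -> 'I_d -> 'I_d -> 'rV[R]_k -> R) p e C A B :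
  (forall i j, differentiable (fun q => M q i j) p) -> M p \in unitmx ->
  (forall i j l, differentiable (D i j l) p) ->
  pd e (fun q => chr (invmx (M q)) (fun i j l => D i j l q) C A B) p =
  dchr (invmx (M p)) (fun i j => pd e (fun q => M q i j) p)
    (fun i j l => D i j l p) (fun i j l => pd e (D i j l) p) C A B.
Proof.
move=> dM uM dD.
have dE E : differentiable (fun q => D A E B q + D B E A q - D E A B q) p.
  by apply: differentiableB => //; apply: differentiableD.
have dI E : differentiable (fun q => invmx (M q) C E) p by exact: differentiable_invmx.
rewrite pdZ; last by apply: differentiable_fsum => E; exact: differentiableMf.
rewrite pd_sum; last by move=> E; exact: differentiableMf.
congr (_ * _); apply: eq_bigr => E _.
rewrite pdM // pd_invmx // pdB ?pdD //.
exact: differentiableD.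
Qed.

End ChristoffelFormula.

(** * Positive definite matrices *)

Lemma sympos_ulsubmx (R : realType) k l (M : 'M[R]_(k + l)) : sympos M -> sympos (ulsubmx M).
Proof.
move=> [sM pM]; split=> [|w w0]; first by rewrite trmx_ulsub sM.
have : row_mx w 0 != 0 :> 'rV[R]_(k + l).
  by apply: contra w0 => /eqP E; apply/eqP; rewrite -(row_mxKl w (0 : 'rV_l)) E linear0.
move=> /pM; rewrite -[X in _ *m X *m _]submxK mul_row_block !mul0mx !addr0 tr_row_mx.
by rewrite mul_row_col trmx0 mulmx0 addr0.
Qed.

Section MetricAlgebra.
Variables (R : realType) (k : nat).

(** A nonzero row of the kernel would be a vector of square length 0. *)
Lemma sympos_unitmx (M : 'M[R]_k) : sympos M -> M \in unitmx.
Proof.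
move=> [_ pM]; rewrite -row_free_unit -kermx_eq0; apply/eqP/row_matrixP => i.
rewrite row0; apply/eqP; apply: contraT => /pM.
by rewrite -row_mul mulmx_ker row0 mul0mx mxE ltxx.
Qed.

Lemma sympos_sym (M : 'M[R]_k) A B : sympos M -> M A B = M B A.
Proof. by move=> [sM _]; rewrite -{1}sM mxE. Qed.

Lemma invmx_sym (M : 'M[R]_k) A B : sympos M -> invmx M A B = invmx M B A.
Proof. by move=> [sM _]; rewrite -{1}sM -trmx_inv mxE. Qed.

Lemma sum_invmxl (M : 'M[R]_k) A B : M \in unitmx ->
  \sum_C invmx M A C * M C B = (A == B)%:R.
Proof. by move=> /mulVmx /matrixP /(_ A B); rewrite !mxE. Qed.

Lemma sum_invmxr (M : 'M[R]_k) A B : M \in unitmx ->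
  \sum_C M A C * invmx M C B = (A == B)%:R.
Proof. by move=> /mulmxV /matrixP /(_ A B); rewrite !mxE. Qed.

Lemma sum_delta_l (I : finType) (F : I -> R) A :
  \sum_C (A == C)%:R * F C = F A.
Proof.
rewrite (bigD1 A) //= eqxx mul1r big1 ?addr0 // => C CA.
by rewrite eq_sym (negPf CA) mul0r.
Qed.

Lemma sum_delta_r (I : finType) (F : I -> R) A :
  \sum_C F C * (C == A)%:R = F A.
Proof. by rewrite -[RHS]sum_delta_l; apply: eq_bigr => C _; rewrite eq_sym mulrC. Qed.

End MetricAlgebra.

(** Pointwise algebra for [riemann_lower]: [dA] and [dB] are metric derivatives, each split into two
    lowered Christoffel symbols [l] and [m]. The products [q] in the curvature cancel the [m] halves
    and leave the [l] halves. *)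
Lemma lower_curvature_sum (R : realType) (I : finType)
    (G a b q g1 g2 l1 l2 m1 m2 dA dB : I -> R) :
  (forall E, dA E = l1 E + m1 E) -> (forall E, dB E = l2 E + m2 E) ->
  \sum_E G E * q E = \sum_E (m1 E * g1 E - m2 E * g2 E) ->
  \sum_E G E * (a E - b E + q E) =
  \sum_E (dA E * g1 E + G E * a E) - \sum_E (dB E * g2 E + G E * b E)
  - \sum_E l1 E * g1 E + \sum_E l2 E * g2 E.
Proof.
move=> hA hB hq; under eq_bigr do rewrite mulrDr.
rewrite big_split /= hq -!sumrB -!big_split /=; apply: eq_bigr => E _.
by rewrite hA hB; ring.
Qed.

(** [T e f i j] stands for [d_e d_f G_(ij)]; [X] and [Y] are the two quadratic terms of the lowered
    curvature, which trade places when [C] and [D] do. *)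
Lemma second_derivatives_antisym (R : realType) (I : Type) (T : I -> I -> I -> I -> R)
    A B C D (X Y : R) :
  (forall e f i j, T e f i j = T e f j i) -> (forall e f i j, T e f i j = T f e i j) ->
  2^-1 * (T A B C D + T A D C B - T A C B D)
    - 2^-1 * (T B A C D + T B D C A - T B C A D) - X + Y =
  - (2^-1 * (T A B D C + T A C D B - T A D B C)
     - 2^-1 * (T B A D C + T B C D A - T B D A C) - Y + X).
Proof.
move=> ss sc; rewrite (ss A B D C) (ss A C D B) (ss A D B C) (ss B A D C) (ss B C D A)
  (ss B D A C) (sc B A).
by ring.
Qed.

(** * Symmetries of the Riemann tensor *)

Section RiemannSymmetries.
Variables (R : realType) (k : nat) (G : 'rV[R]_k -> 'M[R]_k) (O : set 'rV[R]_k).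
Hypotheses (oO : open O) (sG : forall A B, smooth_open O (fun q => G q A B)).
Hypothesis pG : forall q, O q -> sympos (G q).

(** Christoffel symbols of the first kind. *)
Definition chr_low C A B p : R :=
  2^-1 * (pd A (fun q => G q C B) p + pd B (fun q => G q C A) p - pd C (fun q => G q A B) p).

Lemma pd_metric_sym e A B p : O p -> pd e (fun q => G q A B) p = pd e (fun q => G q B A) p.
Proof. by move=> Op; apply: (pd_eq_open e oO Op) => q Oq; rewrite (sympos_sym _ _ (pG Oq)). Qed.

Lemma christoffel_lower C A B p : O p ->
  \sum_E G p E C * christoffel G p E A B = chr_low C A B p.
Proof.
move=> Op; have uG := sympos_unitmx (pG Op).
rewrite /christoffel /chr_low.
under eq_bigr do rewrite mulrCA mulr_sumr.
rewrite -mulr_sumr exchange_big /=; congr (_ * _).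
pose T E := pd A (fun q => G q E B) p + pd B (fun q => G q E A) p - pd E (fun q => G q A B) p.
transitivity (\sum_E (C == E)%:R * T E); last by rewrite sum_delta_l.
apply: eq_bigr => E _; rewrite -(sum_invmxr C E uG) mulr_suml.
by apply: eq_bigr => F _; rewrite mulrA (sympos_sym F C (pG Op)).
Qed.

Lemma christoffel_sym C A B p : O p -> christoffel G p C A B = christoffel G p C B A.
Proof.
move=> Op; rewrite /christoffel; congr (_ * _); apply: eq_bigr => E _; congr (_ * _).
by rewrite (pd_metric_sym E A B Op) [X in X - _]addrC.
Qed.

Lemma differentiable_christoffel C A B p : O p ->
  differentiable (fun q => christoffel G q C A B) p.
Proof.
move=> Op.
apply: (differentiable_chr (M := G) (D := fun i j l q => pd i (fun q => G q j l) q)).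
- by move=> i j; apply: (smooth_differentiable (sG _ _)).
- exact: sympos_unitmx (pG Op).
- by move=> i j l; apply: (smooth_differentiable (smooth_pd _ (sG _ _)) Op).
Qed.

Lemma pd_christoffel e C A B p : O p ->
  pd e (fun q => christoffel G q C A B) p =
  dchr (invmx (G p)) (fun i j => pd e (fun q => G q i j) p)
    (fun i j l => pd i (fun q => G q j l) p)
    (fun i j l => pd e (pd i (fun q => G q j l)) p) C A B.
Proof.
move=> Op.
apply: (pd_chr (M := G) (D := fun i j l q => pd i (fun q => G q j l) q)).
- by move=> i j; apply: (smooth_differentiable (sG _ _)).
- exact: sympos_unitmx (pG Op).
- by move=> i j l; apply: (smooth_differentiable (smooth_pd _ (sG _ _)) Op).
Qed.

Lemma ricci_trace B D p : O p -> ricci G p B D = \sum_A curv G p A B D A.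
Proof.
move=> Op; have uG := sympos_unitmx (pG Op).
rewrite /ricci; apply: eq_bigr => A _; rewrite /riemann.
under eq_bigr do rewrite mulr_sumr.
rewrite exchange_big /= -[RHS](sum_delta_l (fun E => curv G p A B D E)).
apply: eq_bigr => E _; rewrite -(sum_invmxl A E uG) mulr_suml.
by apply: eq_bigr => C _; rewrite mulrA (sympos_sym E C (pG Op)).
Qed.

(** The Ricci tensor as a function of the inverse metric and the first two derivatives of the
    metric, the form to which [cvg_ric] applies. *)
Lemma ricciE B D p : O p -> ricci G p B D =
  ric (ginv G p) (fun i j l => pd i (fun q => G q j l) p)
    (fun e i j l => pd e (pd i (fun q => G q j l)) p) B D.
Proof.
move=> Op; rewrite ricci_trace //; apply: eq_bigr => A _.
by rewrite /curv !pd_christoffel.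
Qed.

Lemma pd_chr_low e C A B p : O p -> pd e (chr_low C A B) p =
  2^-1 * (pd e (pd A (fun q => G q C B)) p + pd e (pd B (fun q => G q C A)) p
          - pd e (pd C (fun q => G q A B)) p).
Proof.
move=> Op.
have dd i j l : differentiable (pd i (fun q => G q j l)) p.
  exact: (smooth_differentiable (smooth_pd _ (sG _ _)) Op).
by rewrite /chr_low pdZ ?pdB ?pdD //; repeat (apply: differentiableB || apply: differentiableD).
Qed.

Lemma metric_compat A E C p : O p ->
  pd A (fun q => G q E C) p = chr_low E A C p + chr_low C A E p.
Proof.
move=> Op; rewrite /chr_low (pd_metric_sym A C E) // (pd_metric_sym E C A) //
  (pd_metric_sym C E A) //.
by field.
Qed.

(** The index is lowered inside the derivatives; the resulting derivatives of the metric are split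
    by [metric_compat]. *)
Lemma riemann_lower A B C D p : O p -> riemann G p A B C D =
  pd A (chr_low C B D) p - pd B (chr_low C A D) p
  - \sum_E chr_low E A C p * christoffel G p E B D
  + \sum_E chr_low E B C p * christoffel G p E A D.
Proof.
move=> Op.
have dG i j : differentiable (fun q => G q i j) p by apply: (smooth_differentiable (sG _ _)).
have H e F H' : pd e (chr_low C F H') p = \sum_E (pd e (fun q => G q E C) p * christoffel G p E F H'
     + G p E C * pd e (fun q => christoffel G q E F H') p).
  rewrite -(pd_eq_open (f := fun q => \sum_E G q E C * christoffel G q E F H') e oO Op); last first.
    by move=> q Oq; rewrite christoffel_lower.
  rewrite pd_sum; last by move=> E; apply: differentiableMf => //; exact: differentiable_christoffel.
  by apply: eq_bigr => E _; rewrite pdM //; exact: differentiable_christoffel.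
have H2 F H1 H' : \sum_E G p E C * (christoffel G p E F H1 * H') = chr_low C F H1 p * H'.
  by rewrite -christoffel_lower // mulr_suml; apply: eq_bigr => E _; rewrite mulrA.
rewrite !H /riemann /curv.
apply: lower_curvature_sum => [E|E|]; first exact: metric_compat.
  exact: metric_compat.
under eq_bigr do rewrite mulr_sumr.
rewrite exchange_big /=; apply: eq_bigr => E _.
under eq_bigr do rewrite mulrBr.
by rewrite sumrB !H2.
Qed.

(** After [riemann_lower] each quadratic term contracts two lowered symbols with the inverse metric
    and is symmetric in them, so exchanging [C] and [D] exchanges the two terms. The second
    derivatives need [pdC]. *)
Lemma riemann_antisym34 A B C D p : O p -> riemann G p A B C D = - riemann G p A B D C.
Proof.
move=> Op; rewrite !riemann_lower // !pd_chr_low //.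
have S A1 A2 B1 B2 : \sum_E chr_low E A1 A2 p * christoffel G p E B1 B2 =
     \sum_E chr_low E B1 B2 p * christoffel G p E A1 A2.
  under eq_bigr do rewrite -christoffel_lower // mulr_suml.
  rewrite exchange_big /=; apply: eq_bigr => E _.
  rewrite -christoffel_lower // mulr_suml; apply: eq_bigr => F _.
  by rewrite (sympos_sym E F (pG Op)) mulrAC.
rewrite (S A C B D) (S B C A D).
apply: (@second_derivatives_antisym _ _ (fun e f i j => pd e (pd f (fun q => G q i j)) p)).
  by move=> e f i j; apply: (pd_eq_open e oO Op) => q Oq; exact: pd_metric_sym.
by move=> e f i j; exact: (pdC e f oO (sG i j) Op).
Qed.

Lemma riemann_antisym12 A B C D p : riemann G p A B C D = - riemann G p B A C D.
Proof.
rewrite /riemann -sumrN; apply: eq_bigr => E _; rewrite -mulrN; congr (_ * _).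
rewrite /curv opprD opprB; congr (_ + _); rewrite -sumrN; apply: eq_bigr => F _.
by rewrite opprB.
Qed.

End RiemannSymmetries.

(** * The metric (dr^2 + T) / r^2 *)

Lemma sum_ord_last (R : realType) d (F : 'I_(d + 1) -> R) :
  \sum_E F E = \sum_i F (lshift 1 i) + F (rlast d).
Proof. by rewrite big_split_ord big_ord1. Qed.

Section RadialFunctions.
Variables (R : realType) (d : nat).

Lemma pd_radial_l (phi : R -> R) i (v : 'rV[R]_(d + 1)) :
  pd (lshift 1 i) (fun v => phi (rcoord v)) v = 0.
Proof.
rewrite pd_slice_l; under eq_fun do rewrite rcoord_row mxE.
exact: pd_cst.
Qed.

Lemma pd_radial_r (phi : R -> R) dphi (v : 'rV[R]_(d + 1)) :
  is_derive (rcoord v) 1 phi dphi -> pd (rlast d) (fun v => phi (rcoord v)) v = dphi.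
Proof.
move=> h; rewrite pd_rlast; under eq_fun do rewrite rcoord_row mxE.
exact: (@derive_val _ _ _ _ _ _ _ h).
Qed.

Lemma differentiable_radial (phi : R -> R) dphi (v : 'rV[R]_(d + 1)) :
  is_derive (rcoord v) 1 phi dphi -> differentiable (fun v : 'rV[R]_(d + 1) => phi (rcoord v)) v.
Proof.
move=> h; apply: differentiable_comp; first exact: rcoord_differentiable.
by apply/derivable1_diffP; exact: (@ex_derive _ _ _ _ _ _ _ h).
Qed.

Lemma is_derive_inv2 (x : R) : x != 0 ->
  is_derive x 1 (fun r : R => (r ^+ 2)^-1) (- (2 / x ^+ 3)).
Proof.
move=> x0; have x20 : x ^+ 2 != 0 by rewrite expf_neq0.
have D := @is_derive1_comp R (fun r => r^-1) (fun r => r ^+ 2) x _ _ (is_derive_inv x20) (is_derive_exp 2 x).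
apply: is_derive_eq D _.
by rewrite /=; field.
Qed.

End RadialFunctions.

(** * Christoffel symbols and Ricci tensor of the block metric *)

Section BlockMetric.
Variables (R : realType) (d : nat) (S : set 'rV[R]_(d + 1)).
Variables (Gp : 'rV[R]_(d + 1) -> 'M[R]_(d + 1)) (T : 'rV[R]_(d + 1) -> 'M[R]_d).
Hypotheses (oS : open S) (S0 : forall v, S v -> 0 < rcoord v).
Hypothesis pGp : forall v, S v -> sympos (Gp v).
Hypothesis sT : forall i j, smooth_open S (fun v => T v i j).
Hypothesis pT : forall v, S v -> sympos (T v).
Hypothesis GpE : forall v, S v -> Gp v = (rcoord v ^+ 2)^-1 *: block_mx (T v) 0 0 1%:M.

Local Notation L := (@lshift d 1).
Local Notation r0 := (rlast d).

Definition dT v (i j l : 'I_d) : R := pd (L i) (fun q => T q j l) v.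
Definition ddT v (e i j l : 'I_d) : R := pd (L e) (pd (L i) (fun q => T q j l)) v.
Definition rT v (i j : 'I_d) : R := pd r0 (fun q => T q i j) v.

Lemma Gp_LL v i j : S v -> Gp v (L i) (L j) = (rcoord v ^+ 2)^-1 * T v i j.
Proof. by move=> Sv; rewrite GpE // mxE block_mxEul. Qed.

Lemma Gp_Lr v i : S v -> Gp v (L i) r0 = 0.
Proof. by move=> Sv; rewrite GpE // mxE block_mxEur mxE mulr0. Qed.

Lemma Gp_rL v i : S v -> Gp v r0 (L i) = 0.
Proof. by move=> Sv; rewrite GpE // mxE block_mxEdl mxE mulr0. Qed.

Lemma Gp_rr v : S v -> Gp v r0 r0 = (rcoord v ^+ 2)^-1.
Proof. by move=> Sv; rewrite GpE // mxE block_mxEdr mxE mulr1. Qed.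

Lemma r_neq0 v : S v -> rcoord v != 0.
Proof. by move=> Sv; rewrite gt_eqF // S0. Qed.

Lemma invmx_Gp v : S v ->
  invmx (Gp v) = rcoord v ^+ 2 *: block_mx (invmx (T v)) 0 0 1%:M.
Proof.
move=> Sv; have uG := sympos_unitmx (pGp Sv); have uT := sympos_unitmx (pT Sv).
set N := _ *: _.
suff E : Gp v *m N = 1%:M by rewrite -[LHS]mulmx1 -E mulKmx.
rewrite GpE // -scalemxAl -scalemxAr scalerA mulVf ?expf_neq0 ?r_neq0 // scale1r.
rewrite mulmx_block !mulmx0 !mul0mx !addr0 !add0r mulmxV // mulmx1.
by rewrite -scalar_mx_block.
Qed.

Lemma ginv_LL v i j : S v -> ginv Gp v (L i) (L j) = rcoord v ^+ 2 * invmx (T v) i j.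
Proof. by move=> Sv; rewrite /ginv invmx_Gp // mxE block_mxEul. Qed.

Lemma ginv_Lr v i : S v -> ginv Gp v (L i) r0 = 0.
Proof. by move=> Sv; rewrite /ginv invmx_Gp // mxE block_mxEur mxE mulr0. Qed.

Lemma ginv_rL v i : S v -> ginv Gp v r0 (L i) = 0.
Proof. by move=> Sv; rewrite /ginv invmx_Gp // mxE block_mxEdl mxE mulr0. Qed.

Lemma ginv_rr v : S v -> ginv Gp v r0 r0 = rcoord v ^+ 2.
Proof. by move=> Sv; rewrite /ginv invmx_Gp // mxE block_mxEdr mxE mulr1. Qed.

Lemma pd_Gp_L e v i j : S v ->
  pd (L e) (fun q => Gp q (L i) (L j)) v = (rcoord v ^+ 2)^-1 * dT v e i j.
Proof.
move=> Sv; have rv := r_neq0 Sv.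
rewrite (pd_eq_open (L e) oS Sv (fun q Sq => Gp_LL i j Sq)).
have dr := differentiable_radial (is_derive_inv2 rv).
by rewrite pdM // ?(pd_radial_l (fun r => (r ^+ 2)^-1)) ?mul0r ?add0r //; exact: (smooth_differentiable (sT i j)).
Qed.

Lemma pd_Gp_r v i j : S v -> pd r0 (fun q => Gp q (L i) (L j)) v =
  (rcoord v ^+ 2)^-1 * rT v i j - 2 / rcoord v ^+ 3 * T v i j.
Proof.
move=> Sv; have rv := r_neq0 Sv.
rewrite (pd_eq_open r0 oS Sv (fun q Sq => Gp_LL i j Sq)).
have dr := differentiable_radial (is_derive_inv2 rv).
rewrite pdM //; last exact: (smooth_differentiable (sT i j)).
by rewrite (pd_radial_r (is_derive_inv2 rv)) mulNr addrC.
Qed.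

Lemma pd_Gp_Lr e v i : S v -> pd e (fun q => Gp q (L i) r0) v = 0.
Proof.
by move=> Sv; rewrite (pd_eq_open (g := fun=> 0) e oS Sv (fun q Sq => Gp_Lr i Sq)) pd_cst.
Qed.

Lemma pd_Gp_rL e v i : S v -> pd e (fun q => Gp q r0 (L i)) v = 0.
Proof.
by move=> Sv; rewrite (pd_eq_open (g := fun=> 0) e oS Sv (fun q Sq => Gp_rL i Sq)) pd_cst.
Qed.

Lemma pd_Gp_rrL e v : S v -> pd (L e) (fun q => Gp q r0 r0) v = 0.
Proof.
move=> Sv; rewrite (pd_eq_open (g := fun q => (rcoord q ^+ 2)^-1) (L e) oS Sv Gp_rr).
exact: (pd_radial_l (fun r => (r ^+ 2)^-1)).
Qed.

Lemma pd_Gp_rrr v : S v -> pd r0 (fun q => Gp q r0 r0) v = - (2 / rcoord v ^+ 3).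
Proof.
move=> Sv; rewrite (pd_eq_open (g := fun q => (rcoord q ^+ 2)^-1) r0 oS Sv Gp_rr).
exact: (pd_radial_r (is_derive_inv2 (r_neq0 Sv))).
Qed.

(** The Christoffel symbols of the metric [T] on a level set of [r]. They coincide with the purely
    tangential symbols of [Gp], since the conformal factor is constant on the level set. *)
Definition gam v k i j : R := chr (invmx (T v)) (dT v) k i j.

(** The endomorphism [T^-1 T_r]: up to sign and a factor 2, the shape operator of the level sets of
    [r] for [dr^2 + T]. *)
Definition shape v k i : R := \sum_l invmx (T v) k l * rT v l i.

Lemma christoffel_LLL v k i j : S v -> christoffel Gp v (L k) (L i) (L j) = gam v k i j.
Proof.
move=> Sv; have rv := r_neq0 Sv; rewrite /christoffel /gam /chr; congr (_ * _).
rewrite sum_ord_last ginv_Lr // mul0r addr0; apply: eq_bigr => l _.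
rewrite ginv_LL // !pd_Gp_L //.
by field.
Qed.

Lemma christoffel_rLL v i j : S v ->
  christoffel Gp v r0 (L i) (L j) = T v i j / rcoord v - 2^-1 * rT v i j.
Proof.
move=> Sv; have rv := r_neq0 Sv; rewrite /christoffel.
rewrite sum_ord_last ginv_rr // big1 => [|l _]; last by rewrite ginv_rL // mul0r.
rewrite !pd_Gp_rL // pd_Gp_r //.
by field.
Qed.

Lemma christoffel_LLr v k i : S v ->
  christoffel Gp v (L k) (L i) r0 = - (k == i)%:R / rcoord v + 2^-1 * shape v k i.
Proof.
move=> Sv; have rv := r_neq0 Sv; rewrite /christoffel.
rewrite sum_ord_last ginv_Lr // mul0r addr0 /shape.
rewrite -(sum_invmxl k i (sympos_unitmx (pT Sv))).
rewrite mulr_sumr mulNr mulr_suml mulr_sumr -sumrN -big_split /=; apply: eq_bigr => l _.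
rewrite ginv_LL // !pd_Gp_Lr // pd_Gp_r //.
by field.
Qed.

Lemma christoffel_LrL v k i : S v ->
  christoffel Gp v (L k) r0 (L i) = - (k == i)%:R / rcoord v + 2^-1 * shape v k i.
Proof. by move=> Sv; rewrite (christoffel_sym oS pGp) // christoffel_LLr. Qed.

Lemma christoffel_rLr v i : S v -> christoffel Gp v r0 (L i) r0 = 0.
Proof.
move=> Sv; rewrite /christoffel.
rewrite sum_ord_last ginv_rr // big1 => [|l _]; last by rewrite ginv_rL // mul0r.
by rewrite pd_Gp_rrL // pd_Gp_rL // pd_Gp_Lr // subr0 addr0 mulr0 addr0 mulr0.
Qed.

Lemma christoffel_rrL v i : S v -> christoffel Gp v r0 r0 (L i) = 0.
Proof. by move=> Sv; rewrite (christoffel_sym oS pGp) // christoffel_rLr. Qed.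

Lemma christoffel_Lrr v k : S v -> christoffel Gp v (L k) r0 r0 = 0.
Proof.
move=> Sv; rewrite /christoffel.
rewrite sum_ord_last ginv_Lr // mul0r addr0 big1 ?mulr0 // => l _.
by rewrite pd_Gp_rrL // !pd_Gp_Lr // subr0 addr0 mulr0.
Qed.

Lemma christoffel_rrr v : S v -> christoffel Gp v r0 r0 r0 = - (rcoord v)^-1.
Proof.
move=> Sv; have rv := r_neq0 Sv; rewrite /christoffel.
rewrite sum_ord_last ginv_rr // big1 => [|l _]; last by rewrite ginv_rL // mul0r.
rewrite pd_Gp_rrr //.
by field.
Qed.

Lemma pd_christoffel_rLL v i j : S v ->
  pd r0 (fun q => christoffel Gp q r0 (L i) (L j)) v =
  rT v i j / rcoord v - T v i j / rcoord v ^+ 2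
  - 2^-1 * pd r0 (pd r0 (fun q => T q i j)) v.
Proof.
move=> Sv; have rv := r_neq0 Sv.
rewrite (pd_eq_open r0 oS Sv (fun q Sq => christoffel_rLL i j Sq)).
have dTv : differentiable (fun q => T q i j) v by exact: (smooth_differentiable (sT i j)).
have drT : differentiable (fun q => rT q i j) v.
  exact: (smooth_differentiable (smooth_pd r0 (sT i j)) Sv).
have dr := differentiable_radial (is_derive_inv rv).
rewrite pdB; last 2 first.
- exact: differentiableMf.
- by apply: differentiableMf => //; exact: differentiable_cst.
rewrite pdM // pdZ // (pd_radial_r (is_derive_inv rv)) mulrN.
by [].
Qed.

Lemma pd_gam e v k i j : S v -> pd (L e) (fun q => gam q k i j) v =
  dchr (invmx (T v)) (dT v e) (dT v) (ddT v e) k i j.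
Proof.
move=> Sv; apply: (pd_chr (M := T) (D := fun i j l q => dT q i j l)).
- by move=> a b; exact: (smooth_differentiable (sT a b)).
- exact: sympos_unitmx (pT Sv).
- by move=> a b l; exact: (smooth_differentiable (smooth_pd (L a) (sT b l)) Sv).
Qed.

(** The trace of the curvature is split into its tangential summands, which contain the Ricci tensor
    of [T] at fixed [r], and the single radial one. The Kronecker deltas come from the conformal
    factor in [christoffel_LLr]. *)
Lemma ricci_tangential v i j : S v -> ricci Gp v (L i) (L j) =
  ric (invmx (T v)) (dT v) (ddT v) i j
  + (rT v i j / rcoord v - T v i j / rcoord v ^+ 2
     - 2^-1 * pd r0 (pd r0 (fun q => T q i j)) v)
  + (\sum_k (- (k == k)%:R / rcoord v + 2^-1 * shape v k k) - (rcoord v)^-1)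
    * (T v i j / rcoord v - 2^-1 * rT v i j)
  - \sum_k (- (k == i)%:R / rcoord v + 2^-1 * shape v k i)
      * (T v k j / rcoord v - 2^-1 * rT v k j)
  - \sum_k (T v i k / rcoord v - 2^-1 * rT v i k)
      * (- (k == j)%:R / rcoord v + 2^-1 * shape v k j).
Proof.
move=> Sv; rewrite (ricci_trace pGp) // sum_ord_last.
have E1 k : curv Gp v (L k) (L i) (L j) (L k) =
   (dchr (invmx (T v)) (dT v k) (dT v) (ddT v k) k i j
    - dchr (invmx (T v)) (dT v i) (dT v) (ddT v i) k k j
    + \sum_l (gam v k k l * gam v l i j - gam v k i l * gam v l k j))
   + (- (k == k)%:R / rcoord v + 2^-1 * shape v k k) * (T v i j / rcoord v - 2^-1 * rT v i j)
   - (- (k == i)%:R / rcoord v + 2^-1 * shape v k i) * (T v k j / rcoord v - 2^-1 * rT v k j).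
  rewrite /curv.
  rewrite (pd_eq_open (L k) oS Sv (fun q Sq => christoffel_LLL k i j Sq)).
  rewrite (pd_eq_open (L i) oS Sv (fun q Sq => christoffel_LLL k k j Sq)).
  rewrite !pd_gam // sum_ord_last !christoffel_LLr // !christoffel_rLL // !addrA.
  congr (_ + _ - _); congr (_ + _ + _).
  by apply: eq_bigr => l _; rewrite !christoffel_LLL.
have E2 : curv Gp v r0 (L i) (L j) r0 =
   (rT v i j / rcoord v - T v i j / rcoord v ^+ 2
     - 2^-1 * pd r0 (pd r0 (fun q => T q i j)) v)
   - (rcoord v)^-1 * (T v i j / rcoord v - 2^-1 * rT v i j)
   - \sum_k (T v i k / rcoord v - 2^-1 * rT v i k)
      * (- (k == j)%:R / rcoord v + 2^-1 * shape v k j).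
  rewrite /curv pd_christoffel_rLL //.
  rewrite (pd_eq_open (g := fun=> 0) (L i) oS Sv (fun q Sq => christoffel_rrL j Sq)) pd_cst subr0.
  rewrite sum_ord_last christoffel_rrr // christoffel_rLL // christoffel_rLr // mul0r subr0.
  rewrite -[RHS]addrA; congr (_ + _); rewrite addrC mulNr; congr (_ + _).
  rewrite -sumrN; apply: eq_bigr => l _.
  by rewrite christoffel_rrL // mul0r add0r christoffel_rLL // christoffel_LrL.
rewrite E2 (eq_bigr _ (fun k _ => E1 k)) sumrB big_split /= -mulr_suml.
rewrite /ric; set a := \sum_A _; set b := \sum_(i0 < d) _; set c := \sum_(i0 < d) _ * _.
set e := \sum_(k < d) (_ * (_ + _)).
set x := (X in X + (_ - _ * _ - _)).
by rewrite /x; ring.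
Qed.

End BlockMetric.

(** * The second coefficient of the metric from the Einstein equation *)

Section EinsteinExpansion.
Variables (R : realType) (d : nat) (U : set 'rV[R]_d) (eps : R).
Variables (Gp : 'rV[R]_(d + 1) -> 'M[R]_(d + 1)) (T : 'rV[R]_(d + 1) -> 'M[R]_d).
Variables (gb : 'rV[R]_d -> 'M[R]_d) (gt : nat -> 'rV[R]_d -> 'M[R]_d) (N : nat).
Let S := [set v : 'rV[R]_(d + 1) | U (lsubmx v) /\ 0 < rcoord v < eps].
Hypotheses (oU : open U) (eps0 : 0 < eps) (N2 : (2 < N)%N).
Hypothesis pGp : forall v, S v -> sympos (Gp v).
Hypothesis sT : forall i j, smooth_open S (fun v => T v i j).
Hypothesis pT : forall v, S v -> sympos (T v).
Hypothesis GpE : forall v, S v -> Gp v = (rcoord v ^+ 2)^-1 *: block_mx (T v) 0 0 1%:M.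
Hypothesis eT : forall i j, even_expansion U N (fun v => T v i j) (fun l z => gt l z i j).
Hypothesis gt0E : forall z, U z -> gt 0%N z = gb z.
Hypothesis pgb : forall z, U z -> sympos (gb z).

Lemma S_pos v : S v -> 0 < rcoord v.
Proof. by move=> [_ /andP[]]. Qed.

Lemma near_S (z : R -> 'rV[R]_d) z0 : U z0 -> z @ 0^'+ --> z0 ->
  \forall t \near 0^'+, S (bpt (z t) t).
Proof.
move=> Uz cz; near=> t; rewrite /S /= /bpt row_mxKl rcoord_row mxE; split.
  by near: t; apply: cz; exact: open_nbhs_nbhs.
by apply/andP; split; near: t; [exact: nbhs_right_gt|exact: nbhs_right_lt].
Unshelve. all: by end_near. Qed.

Lemma rcoord_bpt (z : 'rV[R]_d) t : rcoord (bpt z t) = t.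
Proof. by rewrite /bpt rcoord_row mxE. Qed.

Lemma sgb i j : smooth_open U (fun z => gb z i j).
Proof.
apply: (smooth_eq (f := fun z => gt 0%N z i j) oU) => [z Uz|]; first by rewrite gt0E.
exact: expansion_smooth (eT i j) _ (leq0n _).
Qed.

Lemma gt0_pds s i j z : U z -> pds s (fun z => gt 0%N z i j) z = pds s (fun z => gb z i j) z.
Proof. by apply: pds_eq_open oU _ _ => q Uq; rewrite gt0E. Qed.

Lemma jet_T_pds (z : R -> 'rV[R]_d) z0 s zeta i j : U z0 ->
  (forall A, jet (fun t => z t 0 A) (z0 0 A) (zeta A)) ->
  jet (fun t => pds (map (lshift 1) s) (fun v => T v i j) (bpt (z t) t))
    (pds s (fun z => gb z i j) z0)
    (pds s (fun z => gt 2%N z i j) z0 + \sum_A zeta A * pd A (pds s (fun z => gb z i j)) z0).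
Proof.
move=> Uz jz.
have cz : z @ 0^'+ --> z0 by apply: cvg_rV => A; exact: jet_cvg (jz A).
apply: (jet_eq (jet_expansion oU eps0 (sT i j) (eT i j) Uz cz N2 jz)); first exact: gt0_pds.
by congr (_ + _); apply: eq_bigr => A _; congr (_ * _); exact: (gt0_pds (A :: s)).
Qed.

Lemma jet_T_const s i j z0 : U z0 ->
  jet (fun t => pds (map (lshift 1) s) (fun v => T v i j) (bpt z0 t))
    (pds s (fun z => gb z i j) z0) (pds s (fun z => gt 2%N z i j) z0).
Proof.
move=> Uz; apply: (jet_eq (@jet_T_pds (fun=> z0) z0 s (fun=> 0) i j Uz (fun A => jet_cst _))) => //.
by rewrite big1 ?addr0 // => A _; rewrite mul0r.
Qed.

(** [T] is symmetric and jets are unique. *)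
Lemma gt2_sym z i j : U z -> gt 2%N z i j = gt 2%N z j i.
Proof.
move=> Uz.
have J : jet (fun t => T (bpt z t) i j) (gb z j i) (gt 2%N z j i).
  apply: jet_near_eq (@jet_T_const [::] j i z Uz).
  apply: filterS (near_S Uz (@cvg_const_path R d z)) => t St.
  by rewrite /= (sympos_sym _ _ (pT St)).
by have [_] := jet_uniq (@jet_T_const [::] i j z Uz) J.
Qed.

Let V z k i : R := \sum_l invmx (gb z) k l * gt 2%N z l i.

(* The limit as r -> 0 of the tangential components of Ric(g_+) = - d g_+. *)
Lemma einstein_second_order z i j :
  (forall v A B, S v -> ricci Gp v A B = - d%:R * Gp v A B) -> U z ->
  ricci gb z i j + (d%:R - 2) * gt 2%N z i j + (\sum_k V z k k) * gb z i j = 0.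
Proof.
move=> ein Uz; have ug := sympos_unitmx (pgb Uz).
have cz := @cvg_const_path R d z.
pose b t := bpt z t.
have nS := near_S Uz cz.
have cT k l : (fun t => T (b t) k l) @ 0^'+ --> gb z k l.
  exact: jet_cvg (@jet_T_const [::] k l z Uz).
have cdT k l p : (fun t => dT T (b t) k l p) @ 0^'+ --> pd k (fun z => gb z l p) z.
  exact: jet_cvg (@jet_T_const [:: k] l p z Uz).
have cddT e k l p : (fun t => ddT T (b t) e k l p) @ 0^'+ --> pd e (pd k (fun z => gb z l p)) z.
  exact: jet_cvg (@jet_T_const [:: e; k] l p z Uz).
have cI k l : (fun t => invmx (T (b t)) k l) @ 0^'+ --> invmx (gb z) k l.
  apply: jet_cvg (@jet_invmx _ _ _ _ (gt 2%N z) k l _ ug) => p q.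
  exact: (@jet_T_const [::] p q z Uz).
have cK k l : (fun t => rT T (b t) k l / t) @ 0^'+ --> 2 * gt 2%N z k l.
  exact: (cvg_dr_over_r oU eps0 (sT k l) (eT k l) Uz cz N2).
have cK0 k l : (fun t => t * rT T (b t) k l) @ 0^'+ --> 0.
  apply: (cvg_eqv (a := 0 * 0)); last by rewrite mulr0.
  by apply: cvgM; [exact: cvg_t|exact: (cvg_dr oU eps0 (sT k l) (eT k l) Uz cz N2)].
have cL k l : (fun t => pd (rlast d) (pd (rlast d) (fun q => T q k l)) (b t)) @ 0^'+ --> 2 * gt 2%N z k l.
  exact: (cvg_drr oU eps0 (sT k l) (eT k l) Uz cz N2).
pose sg t k l := \sum_p invmx (T (b t)) k p * (rT T (b t) p l / t).
have csg k l : (fun t => sg t k l) @ 0^'+ --> 2 * V z k l.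
  apply: (cvg_eqv (a := \sum_p invmx (gb z) k p * (2 * gt 2%N z p l))); last first.
    by rewrite /V mulr_sumr; apply: eq_bigr => p _; rewrite mulrCA.
  by apply: cvg_fsum => p _; apply: cvgM.
have cX k l : (fun t => T (b t) k l - 2^-1 * (t * rT T (b t) k l)) @ 0^'+ --> gb z k l.
  apply: (cvg_eqv (a := gb z k l - 2^-1 * 0)); last by rewrite mulr0 subr0.
  by apply: cvgB => //; apply: cvgM => //; exact: cvg_cst.
(* The tangential Einstein equation without its poles: the terms [T / t^2] have coefficient
   [- 1 - (d + 1) + 2 = - d], which is that of the right-hand side, and everything left
   converges. *)
pose Fn t := ric (invmx (T (b t))) (dT T (b t)) (ddT T (b t)) i j
  + (d%:R + 1) / 2 * (rT T (b t) i j / t)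
  - 2^-1 * pd (rlast d) (pd (rlast d) (fun q => T q i j)) (b t)
  + 2^-1 * (\sum_k sg t k k) * (T (b t) i j - 2^-1 * (t * rT T (b t) i j))
  - 2^-1 * (\sum_k sg t k i * (T (b t) k j - 2^-1 * (t * rT T (b t) k j)))
  - 2^-1 * (\sum_k sg t k j * (T (b t) i k - 2^-1 * (t * rT T (b t) i k))).
have cF : Fn @ 0^'+ --> ricci gb z i j + (d%:R + 1) / 2 * (2 * gt 2%N z i j)
  - 2^-1 * (2 * gt 2%N z i j) + 2^-1 * (\sum_k 2 * V z k k) * gb z i j
  - 2^-1 * (\sum_k (2 * V z k i) * gb z k j)
  - 2^-1 * (\sum_k (2 * V z k j) * gb z i k).
  rewrite (ricciE sgb pgb) //.
  have c2 (a : R) : (fun=> a) @ (0 : R)^'+ --> a by exact: cvg_cst.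
  apply: cvgB; last by apply: cvgM => //; apply: cvg_fsum => k _; apply: cvgM.
  apply: cvgB; last by apply: cvgM => //; apply: cvg_fsum => k _; apply: cvgM.
  apply: cvgD; last by apply: cvgM => //; apply: cvgM => //; apply: cvg_fsum => k _.
  apply: cvgB; last by apply: cvgM.
  apply: cvgD; last by apply: cvgM.
  exact: cvg_ric.
have F0 : \forall t \near 0^'+, Fn t = 0.
  near=> t.
  have t0 : t != 0 by near: t; exact: near0_neq0.
  have St : S (b t) by near: t; exact: nS.
  have := ein _ (lshift 1 i) (lshift 1 j) St.
  rewrite (ricci_tangential (open_slab_lt oU) S_pos pGp sT pT GpE) // (Gp_LL GpE) //.
  rewrite rcoord_bpt.
  have shE k l : shape T (b t) k l = t * sg t k l.
    rewrite /shape /sg mulr_sumr; apply: eq_bigr => p _.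
    by rewrite mulrCA [t * _]mulrC divfK.
  have -> : \sum_k (- (k == k)%:R / t + 2^-1 * shape T (b t) k k) =
     - (d%:R / t) + 2^-1 * (t * \sum_k sg t k k).
    rewrite big_split /=; congr (_ + _).
      under eq_bigr do rewrite eqxx.
      by rewrite sumr_const card_ord -mulr_natl /= mulr1n; field.
    by rewrite !mulr_sumr; apply: eq_bigr => k _; rewrite shE.
  have ES (X Y h : 'I_d -> R) l : (forall k, t * X k = Y k) ->
      \sum_k (- (k == l)%:R / t + 2^-1 * (t * h k)) * X k = - X l / t + 2^-1 * \sum_k h k * Y k.
    move=> XY; rewrite -(sum_delta_r X l) mulNr mulr_suml mulr_sumr -sumrN -big_split /=.
    by apply: eq_bigr => k _; rewrite -XY; move: (X k) (h k) ((k == l)%:R) => p q e; ring.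
  have EX k l : t * (T (b t) k l / t - 2^-1 * rT T (b t) k l) =
      T (b t) k l - 2^-1 * (t * rT T (b t) k l) by field.
  under [X in _ + _ - X - _]eq_bigr do rewrite shE.
  under [X in _ - X]eq_bigr do rewrite mulrC shE.
  rewrite (ES _ _ _ _ (fun k => EX k j)) (ES _ _ _ _ (EX i)).
  rewrite /Fn.
  move: (ric _ _ _ _ _) (\sum_k sg t k k) (\sum_k sg t k i * _) (\sum_k sg t k j * _).
  move: (pd _ _ _) (T _ i j) (rT _ _ i j) => q1 q2 q3 q4 q5 q6 q7 E.
  apply: (mulIf (x := t ^+ 2)); first by rewrite expf_neq0.
  have {}E := congr1 (fun x => x * t ^+ 2) E.
  rewrite mul0r; rewrite -(subrr (- d%:R * (t ^- 2 * q2) * t ^+ 2)) -{1}E.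
  by field.
have c0 : Fn @ 0^'+ --> 0.
  by apply: (@cvg_near_eq _ (fun=> 0)); [apply: filterS F0 => t ->|exact: cvg_cst].
have := cvg_unique _ cF c0.
have EV k l : \sum_p gb z k p * V z p l = gt 2%N z k l.
  rewrite /V; under eq_bigr do rewrite mulr_sumr.
  rewrite exchange_big /= -[RHS](sum_delta_l (fun p => gt 2%N z p l)).
  apply: eq_bigr => p _; rewrite -(sum_invmxr k p ug) mulr_suml.
  by apply: eq_bigr => q _; rewrite mulrA.
(* Both contractions give back twice the second coefficient. Together with the second radial
   derivative they lower the factor [d + 1] of that coefficient to [d - 2]. *)
have -> : \sum_k (2 * V z k i) * gb z k j = 2 * gt 2%N z i j.
  rewrite (gt2_sym i j Uz) -EV mulr_sumr; apply: eq_bigr => k _.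
  by rewrite -mulrA [V z k i * _]mulrC (sympos_sym _ _ (pgb Uz)).
have -> : \sum_k (2 * V z k j) * gb z i k = 2 * gt 2%N z i j.
  by rewrite -EV mulr_sumr; apply: eq_bigr => k _; rewrite mulrC mulrCA.
rewrite -mulr_sumr => E; rewrite -[RHS]E.
by move: (ricci _ _ _ _) (gt _ _ _ _) (\sum_k _) (gb z i j) => x1 x2 x3 x4; field.
Unshelve. all: by end_near. Qed.

(** The trace of the limit equation reads [R + (2 d - 2) tau = 0], where [tau] is the trace of the
    second coefficient. This eliminates [tau], and [d - 2] is invertible. *)
Lemma gt2_schouten z i j :
  (forall v A B, S v -> ricci Gp v A B = - d%:R * Gp v A B) -> (2 < d)%N -> U z ->
  gt 2%N z i j = - schouten gb z i j.
Proof.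
move=> ein d2 Uz; have ug := sympos_unitmx (pgb Uz).
have dn2 : (d%:R - 2 : R) != 0 by rewrite subr_eq0 (eqr_nat R d 2) gtn_eqF.
have dn1 : (d%:R - 1 : R) != 0 by rewrite subr_eq0 (eqr_nat R d 1) gtn_eqF // ltnW.
have E k l := einstein_second_order k l ein Uz.
pose tau := \sum_k V z k k.
have Etr : scalar_curvature gb z = - (2 * (d%:R - 1) * tau).
  have : \sum_k \sum_l ginv gb z k l * (ricci gb z k l + (d%:R - 2) * gt 2%N z k l + tau * gb z k l) = 0.
    by rewrite big1 // => k _; rewrite big1 // => l _; rewrite /tau E mulr0.
  under eq_bigr do under eq_bigr do rewrite !mulrDr.
  under eq_bigr do rewrite !big_split /=.
  rewrite !big_split /= -/(scalar_curvature gb z).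
  have -> : \sum_k \sum_l ginv gb z k l * ((d%:R - 2) * gt 2%N z k l) = (d%:R - 2) * tau.
    rewrite /tau /V mulr_sumr; apply: eq_bigr => k _; rewrite mulr_sumr.
    by apply: eq_bigr => l _; rewrite mulrCA (gt2_sym k l Uz).
  have -> : \sum_k \sum_l ginv gb z k l * (tau * gb z k l) = d%:R * tau.
    transitivity (\sum_(k < d) tau); last by rewrite sumr_const card_ord mulr_natl.
    apply: eq_bigr => k _; transitivity (tau * (k == k)%:R); last by rewrite eqxx mulr1.
    rewrite -(sum_invmxl k k ug) mulr_sumr; apply: eq_bigr => l _.
    by rewrite mulrCA (sympos_sym k l (pgb Uz)).
  move=> H; apply/eqP; rewrite -subr_eq0 opprK -[X in _ == X]H; apply/eqP; ring.
rewrite /schouten Etr {Etr}.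
have := E i j; rewrite -/tau; clearbody tau.
move: (ricci _ _ _ _) (gt _ _ _ _) tau (gb z i j) => a b c e H.
have -> : a = - (d%:R - 2) * b - c * e by rewrite -[LHS]subr0 -H; ring.
by field; rewrite dn2 dn1.
Qed.

End EinsteinExpansion.

(** * Minimal graphs *)

Lemma exchange_big3 (R : realType) (I J K : finType) (Y : I -> J -> K -> R) :
  \sum_a \sum_b \sum_c Y a b c = \sum_c \sum_a \sum_b Y a b c.
Proof.
rewrite [RHS]exchange_big /=; apply: eq_bigr => a _.
by rewrite exchange_big.
Qed.

Section GraphMap.
Variables (R : realType) (n m : nat) (u : 'rV[R]_(n + 1) -> 'rV[R]_m).
Local Notation F := (graph_map u).
Local Notation rF := (rlast (n + m)).
Local Notation Lt k := (lshift 1 (tdir m k)).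
Local Notation Ln al := (lshift 1 (ndir n al)).
Local Notation uq a := (fun q => u q 0 a).

Lemma graph_map_t q k : F q 0 (Lt k) = q 0 (lshift 1 k).
Proof. by rewrite /graph_map /tdir row_mxEl row_mxEl mxE. Qed.

Lemma graph_map_n q a : F q 0 (Ln a) = u q 0 a.
Proof. by rewrite /graph_map /ndir row_mxEl row_mxEr. Qed.

Lemma graph_map_r q : F q 0 rF = q 0 (rlast n).
Proof. by rewrite /graph_map /rlast row_mxEr mxE. Qed.

Lemma rcoord_graph_map q : rcoord (F q) = rcoord q.
Proof. exact: graph_map_r. Qed.

Lemma pd_coord k (i j : 'I_k) (q : 'rV[R]_k) : pd i (fun q => q 0 j) q = (i == j)%:R.
Proof.
apply: lim_near_cst => //; near=> h.
have h0 : h != 0 by near: h; exact: nbhs_dnbhs_neq.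
rewrite /= !mxE eqxx /= eq_sym addrK.
by rewrite /GRing.scale /= mulKf.
Unshelve. all: by end_near. Qed.

Lemma smooth_coord k (O : set 'rV[R]_k) j : smooth_open O (fun q => q 0 j).
Proof.
move=> s p Op; case/lastP: s => [|s i]; first exact: differentiable_coord.
rewrite /pds foldr_rcons -/(pds s _).
have -> : pd i (fun q : 'rV[R]_k => q 0 j) = (fun=> (i == j)%:R).
  by apply/funext => q; rewrite pd_coord.
exact: smooth_cst Op.
Qed.

Lemma tangent_t q a k : tangent F q a (Lt k) = (a == lshift 1 k)%:R.
Proof.
by rewrite /tangent; under eq_fun do rewrite graph_map_t; rewrite pd_coord.
Qed.

Lemma tangent_n q a al : tangent F q a (Ln al) = pd a (uq al) q.
Proof. by rewrite /tangent; under eq_fun do rewrite graph_map_n. Qed.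

Lemma tangent_r q a : tangent F q a rF = (a == rlast n)%:R.
Proof.
by rewrite /tangent; under eq_fun do rewrite graph_map_r; rewrite pd_coord.
Qed.

Lemma pd_tangent_t q a b k : pd a (fun q => tangent F q b (Lt k)) q = 0.
Proof. by under eq_fun do rewrite tangent_t; rewrite pd_cst. Qed.

Lemma pd_tangent_r q a b : pd a (fun q => tangent F q b rF) q = 0.
Proof. by under eq_fun do rewrite tangent_r; rewrite pd_cst. Qed.

Lemma pd_tangent_n q a b al : pd a (fun q => tangent F q b (Ln al)) q =
  pd a (pd b (uq al)) q.
Proof. by under eq_fun do rewrite tangent_n. Qed.

(** The covector [dy^al - u_k dx^k - u_r dr] annihilates the tangent vectors of the graph. *)
Lemma tangent_chain q a al : tangent F q a (Ln al) =
  \sum_k pd (lshift 1 k) (uq al) q * tangent F q a (Lt k)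
  + pd (rlast n) (uq al) q * tangent F q a rF.
Proof.
rewrite tangent_n tangent_r.
under eq_bigr do rewrite tangent_t.
have := sum_delta_r (fun c => pd c (uq al) q) a.
rewrite sum_ord_last => <-.
by rewrite (eq_sym (rlast n)); congr (_ + _); apply: eq_bigr => k _; rewrite eq_sym.
Qed.

Section FirstForm.
Variables (Gp : 'rV[R]_(n + m + 1) -> 'M[R]_(n + m + 1)) (q : 'rV[R]_(n + 1)).
Hypothesis pG : sympos (Gp (F q)).
Local Notation tg := (tangent F q).
Local Notation ffi := (invmx (first_form Gp F q)).

(** The first form is [J G J^T], where [J] has trivial left kernel because the parameters [x] and
    [r] are themselves coordinates of the graph. *)
Lemma first_form_sympos : sympos (first_form Gp F q).
Proof.
pose J : 'M[R]_(n + 1, n + m + 1) := \matrix_(a, A) tg a A.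
have E : first_form Gp F q = J *m Gp (F q) *m J^T.
  apply/matrixP => a b; rewrite !mxE exchange_big /=; apply: eq_bigr => B _.
  rewrite !mxE mulr_suml; apply: eq_bigr => A _.
  by rewrite !mxE [in RHS]mulrAC [in LHS]mulrAC mulrC mulrA mulrAC.
case: pG => sG posG; split; first by rewrite E !trmx_mul trmxK sG mulmxA.
move=> v v0; rewrite E !mulmxA -mulmxA -trmx_mul; apply: posG.
apply: contra v0 => /eqP vJ; apply/eqP/rowP => a; rewrite mxE.
have H A : \sum_b v 0 b * tg b A = 0.
  have /rowP /(_ A) := vJ; rewrite !mxE => h; rewrite -[RHS]h.
  by apply: eq_bigr => b _; rewrite mxE.
rewrite -(sum_delta_r (fun b => v 0 b) a).
case: (split_ordP a) => j ->.
  by rewrite -[RHS](H (Lt j)); apply: eq_bigr => b _; rewrite tangent_t.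
rewrite -[RHS](H rF); apply: eq_bigr => b _; rewrite tangent_r.
by rewrite (ord1 j).
Qed.

Lemma mean_curvature_tangent :
  (forall A, mean_curvature Gp F q A = 0) ->
  exists lam : 'I_(n + 1) -> R, forall A,
  \sum_a \sum_b ffi a b * accel Gp F q a b A =
  \sum_c lam c * tg c A.
Proof.
(* [W a b c] is the coefficient of the tangent vector [tg c] in the tangential part of the
   acceleration. *)
move=> H; pose W a b c := \sum_e ffi e c *
    (\sum_B \sum_C Gp (F q) B C * accel Gp F q a b B * tg e C).
exists (fun c => \sum_a \sum_b ffi a b * W a b c) => A.
apply/eqP; rewrite -subr_eq0; apply/eqP; rewrite -[RHS](H A).
rewrite /mean_curvature /normal_part.
under [X in _ = X]eq_bigr do under eq_bigr do rewrite mulrBr.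
under [X in _ = X]eq_bigr do rewrite sumrB.
rewrite sumrB; congr (_ - _).
transitivity (\sum_c \sum_a \sum_b ffi a b * W a b c * tg c A).
  apply: eq_bigr => c _; rewrite mulr_suml; apply: eq_bigr => a _.
  by rewrite mulr_suml.
rewrite -exchange_big3; apply: eq_bigr => a _; apply: eq_bigr => b _.
rewrite [in RHS]exchange_big /= mulr_sumr; apply: eq_bigr => c _.
by rewrite -mulrA /W mulr_suml.
Qed.

(** Since the trace of the acceleration is tangential, it is enough to pair it with the covectors of
    [tangent_chain]; the normal projection never has to be computed. *)
Lemma minimal_graph al :
  (forall A, mean_curvature Gp F q A = 0) ->
  \sum_a \sum_b ffi a b *
    (accel Gp F q a b (Ln al)
     - \sum_k pd (lshift 1 k) (uq al) q * accel Gp F q a b (Lt k)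
     - pd (rlast n) (uq al) q * accel Gp F q a b rF) = 0.
Proof.
move=> /mean_curvature_tangent [lam Hl].
pose K A := \sum_a \sum_b ffi a b * accel Gp F q a b A.
transitivity (K (Ln al)
  - \sum_k pd (lshift 1 k) (uq al) q * K (Lt k)
  - pd (rlast n) (uq al) q * K rF).
  have ES c A : c * K A = \sum_a \sum_b ffi a b * (c * accel Gp F q a b A).
    rewrite /K mulr_sumr; apply: eq_bigr => a _; rewrite mulr_sumr.
    by apply: eq_bigr => b _; rewrite mulrCA.
  rewrite ES (eq_bigr _ (fun k _ => ES (pd (lshift 1 k) (uq al) q) (Lt k))).
  rewrite -exchange_big3 /K -!sumrB; apply: eq_bigr => a _.
  rewrite -!sumrB; apply: eq_bigr => b _.
  by rewrite !mulrBr mulr_sumr.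
have HK A : K A = \sum_c lam c * tg c A by exact: Hl.
have -> : K (Ln al) =
   \sum_k pd (lshift 1 k) (uq al) q * K (Lt k)
   + pd (rlast n) (uq al) q * K rF.
  rewrite HK (eq_bigr _ (fun c _ => congr1 (fun x => lam c * x) (tangent_chain q c al))).
  rewrite (eq_bigr _ (fun c _ => mulrDr _ _ _)) big_split /=; congr (_ + _).
    rewrite (eq_bigr _ (fun c _ => mulr_sumr _ _ _ _)) exchange_big /=.
    by apply: eq_bigr => k _; rewrite HK mulr_sumr; apply: eq_bigr => c _; rewrite mulrCA.
  by rewrite HK mulr_sumr; apply: eq_bigr => c _; rewrite mulrCA.
by rewrite addrAC addrK subrr.
Qed.

End FirstForm.
End GraphMap.

(** * Christoffel symbols contracted with tangent vectors *)

Section Contractions.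
Variables (R : realType) (d : nat) (S : set 'rV[R]_(d + 1)).
Variables (Gp : 'rV[R]_(d + 1) -> 'M[R]_(d + 1)) (T : 'rV[R]_(d + 1) -> 'M[R]_d).
Hypotheses (oS : open S) (S0 : forall v, S v -> 0 < rcoord v).
Hypothesis pGp : forall v, S v -> sympos (Gp v).
Hypothesis sT : forall i j, smooth_open S (fun v => T v i j).
Hypothesis pT : forall v, S v -> sympos (T v).
Hypothesis GpE : forall v, S v -> Gp v = (rcoord v ^+ 2)^-1 *: block_mx (T v) 0 0 1%:M.
Local Notation L := (@lshift d 1).
Local Notation r0 := (rlast d).
Implicit Types X Y : 'I_(d + 1) -> R.

Definition quad (M : 'I_d -> 'I_d -> R) X Y : R := \sum_I \sum_J M I J * X (L I) * Y (L J).

(* The Christoffel symbols of dr^2 + T contracted with X and Y. *)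
Definition qchr v K X Y : R := quad (gam T v K) X Y
  + 2^-1 * \sum_I shape T v K I * (X (L I) * Y r0 + X r0 * Y (L I)).

Definition cmetric v X Y : R := quad (T v) X Y + X r0 * Y r0.

Lemma sum2_ord_last (M : 'I_(d + 1) -> 'I_(d + 1) -> R) X Y :
  \sum_B \sum_C M B C * X B * Y C =
  quad (fun I J => M (L I) (L J)) X Y
  + \sum_I (M (L I) r0 * X (L I) * Y r0 + M r0 (L I) * X r0 * Y (L I))
  + M r0 r0 * X r0 * Y r0.
Proof.
rewrite sum_ord_last sum_ord_last addrA; congr (_ + _).
rewrite big_split /= addrA; congr (_ + _).
by rewrite /quad -big_split /=; apply: eq_bigr => I _; rewrite sum_ord_last.
Qed.

Lemma quadE (M M' : 'I_d -> 'I_d -> R) X Y :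
  (forall I J, M I J = M' I J) -> quad M X Y = quad M' X Y.
Proof. by move=> MM; apply: eq_bigr => I _; apply: eq_bigr => J _; rewrite MM. Qed.

Lemma contract_christoffel_L v K X Y : S v ->
  \sum_B \sum_C christoffel Gp v (L K) B C * X B * Y C =
  qchr v K X Y - (X (L K) * Y r0 + X r0 * Y (L K)) / rcoord v.
Proof.
move=> Sv; rewrite sum2_ord_last (christoffel_Lrr oS S0 pGp pT GpE) // !mul0r addr0 /qchr -addrA.
congr (_ + _); first by apply: quadE => I J; rewrite (christoffel_LLL oS S0 pGp sT pT GpE).
rewrite -(sum_delta_l (fun I => (X (L I) * Y r0 + X r0 * Y (L I)))) mulr_sumr mulr_suml.
rewrite -sumrN -big_split /=; apply: eq_bigr => I _.
rewrite (christoffel_LLr oS S0 pGp sT pT GpE) // (christoffel_LrL oS S0 pGp sT pT GpE) //.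
move: (X _) (Y _) (X _) (Y _) (shape _ _ _ _) ((K == I)%:R) (rcoord v) => x y z w s e rr.
by ring.
Qed.

Lemma contract_christoffel_r v X Y : S v ->
  \sum_B \sum_C christoffel Gp v r0 B C * X B * Y C =
  (cmetric v X Y - 2 * (X r0 * Y r0)) / rcoord v - 2^-1 * quad (rT T v) X Y.
Proof.
move=> Sv; rewrite sum2_ord_last (christoffel_rrr oS S0 pGp pT GpE) //.
rewrite big1 => [|I _]; last first.
  by rewrite (christoffel_rLr oS S0 pGp pT GpE) // (christoffel_rrL oS S0 pGp pT GpE) // !mul0r addr0.
rewrite addr0 (@quadE _ (fun I J => T v I J / rcoord v - 2^-1 * rT T v I J)); last first.
  by move=> I J; rewrite (christoffel_rLL oS S0 pGp sT pT GpE).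
have -> : quad (fun I J => T v I J / rcoord v - 2^-1 * rT T v I J) X Y =
   quad (T v) X Y / rcoord v - 2^-1 * quad (rT T v) X Y.
  rewrite /quad mulr_suml mulr_sumr -sumrB; apply: eq_bigr => I _.
  rewrite mulr_suml mulr_sumr -sumrB; apply: eq_bigr => J _.
  move: (T _ _ _) (rT _ _ _ _) (X _) (Y _) (rcoord v) => a b x y s; by ring.
rewrite /cmetric.
move: (quad _ _ _) (quad _ _ _) (X _) (Y _) (rcoord v) => a b x y s; by ring.
Qed.

Lemma cmetricC v X Y : S v -> cmetric v X Y = cmetric v Y X.
Proof.
move=> Sv; rewrite /cmetric [X r0 * _]mulrC; congr (_ + _).
rewrite /quad exchange_big /=; apply: eq_bigr => J _; apply: eq_bigr => I _.
by rewrite (sympos_sym _ _ (pT Sv)) mulrAC.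
Qed.

Lemma contract_metric v X Y : S v ->
  \sum_B \sum_C Gp v B C * X B * Y C = (rcoord v ^+ 2)^-1 * cmetric v X Y.
Proof.
move=> Sv; rewrite sum2_ord_last (Gp_rr GpE) //.
rewrite big1 => [|I _]; last by rewrite (Gp_Lr GpE) // (Gp_rL GpE) // !mul0r addr0.
rewrite addr0 /cmetric mulrDr !mulrA; congr (_ + _).
rewrite /quad mulr_sumr; apply: eq_bigr => I _; rewrite mulr_sumr; apply: eq_bigr => J _.
by rewrite (Gp_LL GpE) // !mulrA.
Qed.

End Contractions.

(* The singular terms of the Christoffel symbols of r^-2 (dr^2 + T) contribute
   -(du/dr) / r times the induced metric. *)
Lemma graph_residual (R : realType) (I : finType) (p f g Q : I -> R)
    (pr w Qn r1 r2 rr c h tn1 tn2 : R) :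
  tn1 = \sum_k p k * f k + pr * r1 -> tn2 = \sum_k p k * g k + pr * r2 ->
  w + (Qn - (tn1 * r2 + r1 * tn2) / rr)
  - \sum_k p k * (0 + (Q k - (f k * r2 + r1 * g k) / rr))
  - pr * (0 + ((c - 2 * (r1 * r2)) / rr - h)) =
  w + Qn - \sum_k p k * Q k + pr * h - pr / rr * c.
Proof.
move=> -> ->.
have -> : \sum_k p k * (0 + (Q k - (f k * r2 + r1 * g k) / rr)) =
   \sum_k p k * Q k - ((\sum_k p k * f k) * r2 + r1 * (\sum_k p k * g k)) / rr.
  rewrite mulr_suml mulr_sumr -big_split mulr_suml -sumrB; apply: eq_bigr => k _ /=.
  by ring.
by move: (\sum_k _) (\sum_k _) (\sum_k _) => x y z; ring.
Qed.

(** * The minimal surface equation of a graph *)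

Section MinimalGraph.
Variables (R : realType) (n m : nat) (S : set 'rV[R]_(n + m + 1)).
Variables (Gp : 'rV[R]_(n + m + 1) -> 'M[R]_(n + m + 1)).
Variables (T : 'rV[R]_(n + m + 1) -> 'M[R]_(n + m)).
Hypotheses (oS : open S) (S0 : forall v, S v -> 0 < rcoord v).
Hypothesis pGp : forall v, S v -> sympos (Gp v).
Hypothesis sT : forall i j, smooth_open S (fun v => T v i j).
Hypothesis pT : forall v, S v -> sympos (T v).
Hypothesis GpE : forall v, S v -> Gp v = (rcoord v ^+ 2)^-1 *: block_mx (T v) 0 0 1%:M.
Variables (u : 'rV[R]_(n + 1) -> 'rV[R]_m) (q : 'rV[R]_(n + 1)).
Local Notation F := (graph_map u).
Local Notation rF := (rlast (n + m)).
Local Notation Lt k := (lshift 1 (tdir m k)).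
Local Notation Ln al := (lshift 1 (ndir n al)).
Local Notation uq a := (fun q => u q 0 a).
Hypothesis SF : S (F q).
Hypothesis minF : forall A, mean_curvature Gp F q A = 0.

Definition graph_metric (q : 'rV[R]_(n + 1)) : 'M[R]_(n + 1) :=
  \matrix_(a, b) cmetric T (F q) (tangent F q a) (tangent F q b).

Lemma first_formE : first_form Gp F q = (rcoord q ^+ 2)^-1 *: graph_metric q.
Proof.
apply/matrixP => a b; rewrite !mxE (contract_metric GpE) //.
by rewrite rcoord_graph_map.
Qed.

Lemma rq_gt0 : 0 < rcoord q.
Proof. by rewrite -(rcoord_graph_map u) S0. Qed.

Lemma graph_metric_unit : graph_metric q \in unitmx.
Proof.
have := sympos_unitmx (first_form_sympos (pGp SF)).
have r2 : (rcoord q ^+ 2)^-1 != 0 by rewrite invr_eq0 expf_neq0 // gt_eqF // rq_gt0.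
by rewrite first_formE unitmxZ // unitfE.
Qed.

(** The acceleration with respect to [dr^2 + T], paired with [dy^al - u_k dx^k - u_r dr]. The last
    summand has a plus sign because the radial Christoffel symbol of [dr^2 + T] is [- T_r / 2]. *)
Definition graph_accel al q a b : R :=
  pd a (pd b (uq al)) q
  + qchr T (F q) (ndir n al) (tangent F q a) (tangent F q b)
  - \sum_k pd (lshift 1 k) (uq al) q
      * qchr T (F q) (tdir m k) (tangent F q a) (tangent F q b)
  + pd (rlast n) (uq al) q
      * (2^-1 * quad (rT T (F q)) (tangent F q a) (tangent F q b)).

(** The singular terms are [- u_r / r] times [graph_metric], whose trace with its own inverse is the
    dimension [n + 1]; the common factor [r^2] of the inverse first form drops out. *)
Lemma minimal_graph_equation al :
  \sum_a \sum_b invmx (graph_metric q) a b * graph_accel al q a b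
  = (n%:R + 1) * (pd (rlast n) (uq al) q / rcoord q).
Proof.
pose du c := pd c (uq al) q; rewrite -/(du (rlast n)).
have uff : first_form Gp F q \in unitmx := sympos_unitmx (first_form_sympos (pGp SF)).
have r2 : rcoord q ^+ 2 != 0 by rewrite expf_neq0 // gt_eqF // rq_gt0.
have Einv a b : invmx (first_form Gp F q) a b = rcoord q ^+ 2 * invmx (graph_metric q) a b.
  have : invmx (first_form Gp F q) = rcoord q ^+ 2 *: invmx (graph_metric q).
    by move: uff; rewrite first_formE => /invmxZ ->; rewrite invrK.
  by move=> ->; rewrite mxE.
have tr : \sum_a \sum_b invmx (graph_metric q) a b * graph_metric q a b = n%:R + 1.
  transitivity (\sum_(a < n + 1) (1 : R)); last first.
    by rewrite sumr_const card_ord -[1 *+ (n + 1)]/((n + 1)%:R) natrD.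
  apply: eq_bigr => a _; transitivity ((a == a)%:R : R); last by rewrite eqxx.
  rewrite -(sum_invmxl a a graph_metric_unit); apply: eq_bigr => b _.
  by rewrite [graph_metric q a b]mxE [graph_metric q b a]mxE (cmetricC pT).
have := minimal_graph al minF.
have accE a b : accel Gp F q a b (Ln al)
     - \sum_k du (lshift 1 k) * accel Gp F q a b (Lt k)
     - du (rlast n) * accel Gp F q a b rF =
   graph_accel al q a b - du (rlast n) / rcoord q * graph_metric q a b.
  rewrite /accel pd_tangent_n (contract_christoffel_L oS S0 pGp sT pT GpE) //.
  rewrite (eq_bigr (fun k => du (lshift 1 k) * (0 +
     (qchr T (F q) (tdir m k) (tangent F q a) (tangent F q b) -
      (tangent F q a (Lt k) * tangent F q b rF
       + tangent F q a rF * tangent F q b (Lt k)) / rcoord (F q))))); last first.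
    by move=> k _; rewrite pd_tangent_t (contract_christoffel_L oS S0 pGp sT pT GpE).
  rewrite pd_tangent_r (contract_christoffel_r oS S0 pGp sT pT GpE) //.
  rewrite [graph_metric q a b]mxE -(rcoord_graph_map u q).
  by apply: graph_residual; exact: tangent_chain.
rewrite (eq_bigr (fun a => rcoord q ^+ 2 * (\sum_b invmx (graph_metric q) a b * graph_accel al q a b
   - du (rlast n) / rcoord q * \sum_b invmx (graph_metric q) a b * graph_metric q a b))); last first.
  move=> a _; rewrite mulrBr !mulr_sumr -sumrB; apply: eq_bigr => b _.
  rewrite Einv accE.
  by move: (invmx _ _ _) (graph_accel _ _ _ _) (graph_metric _ _ _) (du _ / _) (rcoord q ^+ 2) => x1 x2 x3 x4 x5; ring.
rewrite -mulr_sumr sumrB -mulr_sumr tr => /eqP; rewrite mulf_eq0 (negPf r2) /= subr_eq0 => /eqP.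
by rewrite mulrC.
Qed.

End MinimalGraph.

(** * Quadratic forms on tangential, normal and radial components *)

Section TangentNormalVectors.
Variables (R : realType) (n m : nat).
Local Notation bform := ('I_(n + m) -> 'I_(n + m) -> R).
Implicit Types (a : 'I_n -> R) (b : 'I_m -> R) (c : R).
Local Notation L := (@lshift (n + m) 1).
Local Notation td := (@tdir n m).
Local Notation nd := (@ndir n m).

(* t, n, r: tangential, normal, radial *)
Definition tnr_vec a b c (A : 'I_(n + m + 1)) : R :=
  match fintype.split A with
  | inl K => match fintype.split K with inl k => a k | inr be => b be end
  | inr _ => c
  end.

Lemma tnr_vec_t a b c k : tnr_vec a b c (L (td k)) = a k.
Proof. by rewrite /tnr_vec (unsplitK (inl (td k))) (unsplitK (inl k)). Qed.

Lemma tnr_vec_n a b c be : tnr_vec a b c (L (nd be)) = b be.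
Proof. by rewrite /tnr_vec (unsplitK (inl (nd be))) (unsplitK (inr be)). Qed.

Lemma tnr_vec_r a b c : tnr_vec a b c (rlast (n + m)) = c.
Proof. by rewrite /tnr_vec (unsplitK (inr ord0)). Qed.

Variant tnr_spec : 'I_(n + m + 1) -> Type :=
| TnrT k : tnr_spec (L (td k))
| TnrN be : tnr_spec (L (nd be))
| TnrR : tnr_spec (rlast (n + m)).

Lemma tnrP A : tnr_spec A.
Proof.
case: (split_ordP A) => I ->; last by rewrite (ord1 I); exact: TnrR.
by case: (split_ordP I) => J ->; [exact: TnrT|exact: TnrN].
Qed.

Lemma sum_tn (f : 'I_(n + m) -> R) :
  \sum_I f I = \sum_k f (td k) + \sum_be f (nd be).
Proof. by rewrite big_split_ord. Qed.

Lemma quad_vec (M : bform) a b c a' b' c' :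
  quad M (tnr_vec a b c) (tnr_vec a' b' c') =
  \sum_k \sum_l M (td k) (td l) * a k * a' l
  + \sum_k \sum_be M (td k) (nd be) * a k * b' be
  + (\sum_be \sum_l M (nd be) (td l) * b be * a' l
  + \sum_be \sum_ga M (nd be) (nd ga) * b be * b' ga).
Proof.
rewrite /quad sum_tn -!big_split /=; congr (_ + _).
  apply: eq_bigr => k _; rewrite sum_tn.
  by congr (_ + _); apply: eq_bigr => l _; rewrite ?tnr_vec_t ?tnr_vec_n.
apply: eq_bigr => k _; rewrite sum_tn.
by congr (_ + _); apply: eq_bigr => l _; rewrite ?tnr_vec_t ?tnr_vec_n.
Qed.

Definition unit_t i : 'I_(n + m + 1) -> R := tnr_vec (fun k => (i == k)%:R) (fun=> 0) 0.
Definition nvec b : 'I_(n + m + 1) -> R := tnr_vec (fun=> 0) b 0.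

Lemma sum2_delta (I J : finType) (f : I -> J -> R) i j :
  \sum_k \sum_l f k l * (i == k)%:R * (j == l)%:R = f i j.
Proof.
rewrite -(sum_delta_l (fun k => f k j) i); apply: eq_bigr => k _.
rewrite -(sum_delta_l (fun l => f k l) j) mulr_sumr; apply: eq_bigr => l _.
by move: (f k l) ((i == k)%:R) ((j == l)%:R) => x y z; ring.
Qed.

Lemma sum2_0l (I J : finType) (f : I -> J -> R) (h : J -> R) :
  \sum_k \sum_l f k l * 0 * h l = 0.
Proof. by rewrite big1 // => k _; rewrite big1 // => l _; rewrite mulr0 mul0r. Qed.

Lemma sum2_0r (I J : finType) (f : I -> J -> R) :
  \sum_k \sum_l f k l * 0 = 0.
Proof. by rewrite big1 // => k _; rewrite big1 // => l _; rewrite mulr0. Qed.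

Lemma quad_tt M i j : quad M (unit_t i) (unit_t j) = M (td i) (td j).
Proof.
rewrite quad_vec sum2_0r (sum2_0l _ (fun l => (j == l)%:R)) sum2_0r !addr0.
exact: (sum2_delta (fun k l => M (td k) (td l))).
Qed.

Lemma quad_nt M b j : quad M (nvec b) (unit_t j) = \sum_be b be * M (nd be) (td j).
Proof.
rewrite quad_vec sum2_0r (sum2_0l _ (fun l => (j == l)%:R)) sum2_0r !add0r addr0.
apply: eq_bigr => be _; rewrite -(sum_delta_l (fun l => M (nd be) (td l)) j) mulr_sumr.
by apply: eq_bigr => l _; move: (M _ _) (_%:R) (b be) => x y z; ring.
Qed.

Lemma quad_tn M b i : quad M (unit_t i) (nvec b) = \sum_be b be * M (td i) (nd be).
Proof.
rewrite quad_vec sum2_0r (sum2_0l _ b) sum2_0r !add0r addr0 exchange_big /=.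
apply: eq_bigr => be _; rewrite -(sum_delta_l (fun l => M (td l) (nd be)) i) mulr_sumr.
by apply: eq_bigr => l _; move: (M _ _) (_%:R) (b be) => x y z; ring.
Qed.

Lemma quad_nn M b b' : quad M (nvec b) (nvec b') =
  \sum_be \sum_ga M (nd be) (nd ga) * b be * b' ga.
Proof.
by rewrite quad_vec sum2_0r (sum2_0l _ b') sum2_0r !add0r.
Qed.

Lemma jet_quad (M : R -> bform) M0 M2 (X Y : R -> 'I_(n + m + 1) -> R)
    X0 X2 Y0 Y2 :
  (forall I J, jet (fun t => M t I J) (M0 I J) (M2 I J)) ->
  (forall A, jet (fun t => X t A) (X0 A) (X2 A)) ->
  (forall A, jet (fun t => Y t A) (Y0 A) (Y2 A)) ->
  jet (fun t => quad (M t) (X t) (Y t)) (quad M0 X0 Y0)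
    (quad M2 X0 Y0 + quad M0 X2 Y0 + quad M0 X0 Y2).
Proof.
move=> jM jX jY; apply: jet_eq.
- by apply: jet_sum => I; apply: jet_sum => J; apply: jetM; [apply: jetM; [exact: jM|exact: jX]|exact: jY].
- by [].
- rewrite /quad -!big_split /=; apply: eq_bigr => I _; rewrite -!big_split /=.
  apply: eq_bigr => J _.
  by move: (M0 I J) (M2 I J) (X0 _) (X2 _) (Y0 _) (Y2 _) => x1 x2 x3 x4 x5 x6; ring.
Qed.

Lemma cvg_quad (M : R -> bform) M0 (X Y : R -> 'I_(n + m + 1) -> R)
    X0 Y0 :
  (forall I J, (fun t => M t I J) @ 0^'+ --> M0 I J) ->
  (forall A, (fun t => X t A) @ 0^'+ --> X0 A) ->
  (forall A, (fun t => Y t A) @ 0^'+ --> Y0 A) ->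
  (fun t => quad (M t) (X t) (Y t)) @ 0^'+ --> quad M0 X0 Y0.
Proof.
move=> cM cX cY; apply: cvg_fsum => I _; apply: cvg_fsum => J _.
by apply: cvgM => //; apply: cvgM.
Qed.

Lemma quad_divr (M : bform) X Y (s : R) : quad M X Y / s = quad (fun I J => M I J / s) X Y.
Proof.
rewrite /quad mulr_suml; apply: eq_bigr => I _; rewrite mulr_suml; apply: eq_bigr => J _.
by move: (M _ _) (X _) (Y _) => x y z; ring.
Qed.

End TangentNormalVectors.

Unset Implicit Arguments.

(** * Second-order expansion of the minimal surface equation *)

Section MinimalJets.
Variables (R : realType) (n m : nat) (U : set 'rV[R]_(n + m)) (eps : R).
Variables (Gp : 'rV[R]_(n + m + 1) -> 'M[R]_(n + m + 1)).
Variables (T : 'rV[R]_(n + m + 1) -> 'M[R]_(n + m)).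
Variables (gb : 'rV[R]_(n + m) -> 'M[R]_(n + m)).
Variables (gt : nat -> 'rV[R]_(n + m) -> 'M[R]_(n + m)) (N : nat).
Local Notation bform := ('I_(n + m) -> 'I_(n + m) -> R).
Let S := [set v : 'rV[R]_(n + m + 1) | U (lsubmx v) /\ 0 < rcoord v < eps].
Hypotheses (oU : open U) (eps0 : 0 < eps) (N2 : (2 < N)%N).
Hypothesis pGp : forall v, S v -> sympos (Gp v).
Hypothesis sT : forall i j, smooth_open S (fun v => T v i j).
Hypothesis pT : forall v, S v -> sympos (T v).
Hypothesis GpE : forall v, S v -> Gp v = (rcoord v ^+ 2)^-1 *: block_mx (T v) 0 0 1%:M.
Hypothesis eT : forall i j, even_expansion U N (fun v => T v i j) (fun l z => gt l z i j).
Hypothesis gt0E : forall z, U z -> gt 0%N z = gb z.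
Hypothesis pgb : forall z, U z -> sympos (gb z).
Variables (V : set 'rV[R]_n) (delta : R) (N' : nat).
Variables (u : 'rV[R]_(n + 1) -> 'rV[R]_m) (uc : nat -> 'rV[R]_n -> 'rV[R]_m).
Let Q := [set q : 'rV[R]_(n + 1) | V (lsubmx q) /\ 0 < rcoord q < delta].
Hypotheses (oV : open V) (delta0 : 0 < delta) (N4 : (4 < N')%N).
Hypothesis su : forall a, smooth_open Q (fun q => u q 0 a).
Hypothesis eu : forall a, even_expansion V N' (fun q => u q 0 a) (fun j x => uc j x 0 a).
Hypothesis uc0 : forall x, V x -> uc 0%N x = 0.
Hypothesis QS : forall q, Q q -> S (graph_map u q).
Hypothesis minF : forall q A, Q q -> mean_curvature Gp (graph_map u) q A = 0.
Variable x : 'rV[R]_n.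
Hypotheses (Vx : V x) (Ux : U (on_Sigma m x)).
Hypothesis orth : forall i be, gb (on_Sigma m x) (tdir m i) (ndir n be) = 0.

Local Notation F := (graph_map u).
Local Notation L := (@lshift (n + m) 1).
Local Notation L' := (@lshift n 1).
Local Notation td := (@tdir n m).
Local Notation nd := (@ndir n m).
Local Notation uq a := (fun q => u q 0 a).
Local Notation ur be t := (pd (rlast n) (uq be) (bpt x t)).
Local Notation gm t := (graph_metric T u (bpt x t)).
Local Notation Fq t := (F (bpt x t)).
Local Notation Tq t := (T (Fq t)).
Let zS := on_Sigma m x.
Let q t := bpt x t.
(** While [q t] runs down the vertical line over [x], the point of the graph lies over [zp t], which
    leaves Sigma by [t^2 U2 + o(t^2)] in the normal directions. *)
Let zp t := row_mx x (u (q t)).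
Let U2 be := uc 2%N x 0 be.
Let U4 be := uc 4%N x 0 be.
Let dU2 i be := pd i (fun x => uc 2%N x 0 be) x.
Let cx := @cvg_const_path R n x.
Let ddU2 i j be := pd i (pd j (fun x => uc 2%N x 0 be)) x.

Lemma graph_bpt t : F (q t) = bpt (zp t) t.
Proof. by rewrite /graph_map /q /zp /bpt row_mxKl row_mxKr. Qed.

Let N4' : (2 < N')%N. Proof. by apply: leq_trans N4. Qed.

Lemma jet_u_pds s be :
  jet (fun t => pds (map L' s) (uq be) (q t)) 0 (pds s (fun x => uc 2%N x 0 be) x).
Proof.
have H := @jet_expansion _ _ _ _ _ _ _ oV delta0 (su be) (eu be) (fun=> x) x Vx
  (cx) s (fun=> 0) N4' (fun A => jet_cst _).
apply: jet_eq H _ _.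
  rewrite (pds_eq_open (g := fun=> 0) _ oV _ Vx) ?pds_cst0 // => y Vy.
  by rewrite uc0 // mxE.
by rewrite big1 ?addr0 // => A _; rewrite mul0r.
Qed.

Lemma jet_zp A : jet (fun t => zp t 0 A) (zS 0 A) (nvec U2 (L A)).
Proof.
rewrite /zp /zS /on_Sigma; case: (split_ordP A) => j ->.
  under eq_fun do rewrite row_mxEl; rewrite row_mxEl /nvec tnr_vec_t.
  exact: jet_cst.
under eq_fun do rewrite row_mxEr; rewrite row_mxEr mxE /nvec tnr_vec_n.
exact: (@jet_u_pds [::] j).
Qed.

Lemma cvg_zp : zp @ 0^'+ --> zS.
Proof. by apply: cvg_rV => A; exact: jet_cvg (jet_zp A). Qed.

Lemma near_Q : \forall t \near 0^'+, Q (q t).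
Proof. exact: (near_S oV delta0 Vx (cx)). Qed.

Lemma sum_zeta (f : 'I_(n + m) -> R) :
  \sum_A nvec U2 (L A) * f A = \sum_be U2 be * f (nd be).
Proof.
rewrite sum_tn big1 ?add0r => [|k _]; last by rewrite /nvec tnr_vec_t mul0r.
by apply: eq_bigr => be _; rewrite /nvec tnr_vec_n.
Qed.

Let G0 := gb zS.
(** The [t^2] coefficient of [T] along the graph: the second coefficient of the metric, plus the
    change of [gb] when the base point moves by [t^2 U2]. [D2] is the analogue for the
    derivatives. *)
Definition G2 : 'M[R]_(n + m) := \matrix_(I, J)
  (gt 2%N zS I J + \sum_be U2 be * pd (nd be) (fun z => gb z I J) zS).
Definition D0 K I J := pd K (fun z => gb z I J) zS.
Definition D2 K I J := pd K (fun z => gt 2%N z I J) zS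
  + \sum_be U2 be * pd (nd be) (pd K (fun z => gb z I J)) zS.
Let Gam0 K I J := christoffel gb zS K I J.
Let Gam2 K I J := dchr (invmx G0) G2 D0 D2 K I J.
Let uG0 : G0 \in unitmx := sympos_unitmx (pgb _ Ux).

Lemma jet_T I J : jet (fun t => (Tq t) I J) (G0 I J) (G2 I J).
Proof.
have H := @jet_T_pds _ _ _ _ _ _ _ _ oU eps0 N2 sT eT gt0E zp zS [::] _ I J Ux jet_zp.
under eq_fun do rewrite graph_bpt.
by apply: jet_eq H _ _ => //; rewrite sum_zeta mxE.
Qed.

Lemma jet_dT K I J : jet (fun t => dT T (Fq t) K I J) (D0 K I J) (D2 K I J).
Proof.
have H := @jet_T_pds _ _ _ _ _ _ _ _ oU eps0 N2 sT eT gt0E zp zS [:: K] _ I J Ux jet_zp.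
under eq_fun do rewrite graph_bpt.
by apply: jet_eq H _ _ => //; rewrite sum_zeta.
Qed.

Lemma jet_gam K I J : jet (fun t => gam T (Fq t) K I J) (Gam0 K I J) (Gam2 K I J).
Proof. exact: (jet_chr uG0 jet_T jet_dT). Qed.

Lemma cvg_rT_over I J : (fun t => rT T (Fq t) I J / t) @ 0^'+ --> 2 * gt 2%N zS I J.
Proof.
under eq_fun do rewrite graph_bpt.
exact: (cvg_dr_over_r oU eps0 (sT I J) (eT I J) Ux cvg_zp N2).
Qed.

Definition Sh K I := \sum_J invmx G0 K J * gt 2%N zS J I.

Lemma cvg_invT I J : (fun t => invmx (Tq t) I J) @ 0^'+ --> invmx G0 I J.
Proof. exact: jet_cvg (@jet_invmx _ _ _ _ _ I J jet_T uG0). Qed.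

Lemma cvg_shape_over K I : (fun t => shape T (Fq t) K I / t) @ 0^'+ --> 2 * Sh K I.
Proof.
apply: (cvg_eqv (a := \sum_J invmx G0 K J * (2 * gt 2%N zS J I))); last first.
  by rewrite /Sh mulr_sumr; apply: eq_bigr => J _; rewrite mulrCA.
have E t : shape T (Fq t) K I / t = \sum_J invmx (Tq t) K J * (rT T (Fq t) J I / t).
  by rewrite /shape mulr_suml; apply: eq_bigr => J _; rewrite mulrA.
under eq_fun do rewrite E.
apply: cvg_fsum => J _; apply: cvgM; [exact: cvg_invT|exact: cvg_rT_over].
Qed.

Lemma cvg_shape K I : (fun t => shape T (Fq t) K I) @ 0^'+ --> 0.
Proof.
apply: (@cvg_near_eq _ (fun t => shape T (Fq t) K I / t * t)).
  by apply: filterS (@near0_neq0 R) => t t0; rewrite divfK.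
apply: (cvg_eqv (a := 2 * Sh K I * 0)); last by rewrite mulr0.
by apply: cvgM; [exact: cvg_shape_over|exact: cvg_t].
Qed.

Lemma jet_ur be : jet (fun t => ur be t / t) (2 * U2 be) (4 * U4 be).
Proof. exact: (jet_dr_over_r oV delta0 (su be) (eu be) Vx N4). Qed.

Lemma cvg_ur be : (fun t => ur be t) @ 0^'+ --> 0.
Proof. exact: (cvg_dr oV delta0 (su be) (eu be) Vx (cx) N4'). Qed.

Lemma jet_urr be :
  jet (fun t => pd (rlast n) (pd (rlast n) (uq be)) (q t)) (2 * U2 be) (12 * U4 be).
Proof. exact: (jet_drr oV delta0 (su be) (eu be) Vx N4). Qed.

Lemma cvg_uri i be :
  (fun t => pd (rlast n) (pd (L' i) (uq be)) (q t)) @ 0^'+ --> 0.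
Proof.
apply: (cvg_mixed oV delta0 (su be) (eu be) Vx (cx) (s := [:: rlast n; L' i]) (i := i) N4').
  by rewrite zpart_cons_r zpart_cons_l.
by rewrite /= eqxx /rlast eq_lrshift.
Qed.

Lemma cvg_uir i be :
  (fun t => pd (L' i) (pd (rlast n) (uq be)) (q t)) @ 0^'+ --> 0.
Proof.
apply: (cvg_mixed oV delta0 (su be) (eu be) Vx (cx) (s := [:: L' i; rlast n]) (i := i) N4').
  by rewrite zpart_cons_l zpart_cons_r.
by rewrite /= eqxx /rlast eq_lrshift.
Qed.

Let X i t := tangent F (q t) (L' i).
Let Xr t := tangent F (q t) (rlast n).

Lemma XE i t : X i t =1 tnr_vec (fun k => (i == k)%:R)
  (fun be => pd (L' i) (uq be) (q t)) 0.
Proof.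
move=> A; rewrite /X; destruct (tnrP A) as [k|be|].
- by rewrite tangent_t tnr_vec_t eq_lshift.
- by rewrite tangent_n tnr_vec_n.
- by rewrite tangent_r tnr_vec_r /rlast eq_lrshift.
Qed.

Lemma XrE t : Xr t =1 tnr_vec (fun=> 0) (fun be => ur be t) 1.
Proof.
move=> A; rewrite /Xr; destruct (tnrP A) as [k|be|].
- by rewrite tangent_t tnr_vec_t /rlast eq_rlshift.
- by rewrite tangent_n tnr_vec_n.
- by rewrite tangent_r tnr_vec_r eqxx.
Qed.

Lemma jet_X i A : jet (fun t => X i t A) (unit_t R i A) (nvec (dU2 i) A).
Proof.
rewrite /unit_t /nvec; destruct (tnrP A) as [k|be|].
- by rewrite !tnr_vec_t; under eq_fun do rewrite XE tnr_vec_t; exact: jet_cst.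
- by rewrite !tnr_vec_n; under eq_fun do rewrite XE tnr_vec_n; exact: (@jet_u_pds [:: i] be).
- by rewrite !tnr_vec_r; under eq_fun do rewrite XE tnr_vec_r; exact: jet_cst.
Qed.

Let rvec : 'I_(n + m + 1) -> R := tnr_vec (fun=> 0) (fun=> 0) 1.

Lemma cvg_Xr A : (fun t => Xr t A) @ 0^'+ --> rvec A.
Proof.
rewrite /rvec; destruct (tnrP A) as [k|be|].
- by rewrite tnr_vec_t; under eq_fun do rewrite XrE tnr_vec_t; exact: cvg_cst.
- by rewrite tnr_vec_n; under eq_fun do rewrite XrE tnr_vec_n; exact: cvg_ur.
- by rewrite tnr_vec_r; under eq_fun do rewrite XrE tnr_vec_r; exact: cvg_cst.
Qed.

Lemma cvg_X i A : (fun t => X i t A) @ 0^'+ --> unit_t R i A.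
Proof. exact: jet_cvg (jet_X i A). Qed.

Lemma X_r i t : X i t (rlast (n + m)) = 0.
Proof. by rewrite XE tnr_vec_r. Qed.

Lemma Xr_r t : Xr t (rlast (n + m)) = 1.
Proof. by rewrite XrE tnr_vec_r. Qed.

Lemma Xr_t t k : Xr t (L (td k)) = 0.
Proof. by rewrite XrE tnr_vec_t. Qed.

Lemma Xr_n t be : Xr t (L (nd be)) = ur be t.
Proof. by rewrite XrE tnr_vec_n. Qed.

(** As [u_r] is of order [t], the vector [Xr t] is the radial unit vector plus [t] times the
    convergent [Xi t]. A quadratic form without radial entries is thus [O(t^2)] on [Xr t]. *)
Let Xi t : 'I_(n + m + 1) -> R := nvec (fun be => ur be t / t).

Lemma cvg_Xi A : (fun t => Xi t A) @ 0^'+ --> nvec (fun be => 2 * U2 be) A.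
Proof.
rewrite /Xi /nvec; destruct (tnrP A) as [k|be|].
- by rewrite tnr_vec_t; under eq_fun do rewrite tnr_vec_t; exact: cvg_cst.
- by rewrite tnr_vec_n; under eq_fun do rewrite tnr_vec_n; exact: jet_cvg (jet_ur be).
- by rewrite tnr_vec_r; under eq_fun do rewrite tnr_vec_r; exact: cvg_cst.
Qed.

Lemma quad_Xr (M : bform) t : t != 0 ->
  quad M (Xr t) (Xr t) = t ^+ 2 * quad M (Xi t) (Xi t).
Proof.
move=> t0.
have E (K : 'I_(n + m)) : Xr t (L K) = t * Xi t (L K).
  case: (split_ordP K) => j ->; first by rewrite Xr_t /Xi /nvec tnr_vec_t mulr0.
  by rewrite Xr_n /Xi /nvec tnr_vec_n mulrC divfK.
rewrite /quad mulr_sumr; apply: eq_bigr => I _; rewrite mulr_sumr; apply: eq_bigr => J _.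
by rewrite !E; move: (M _ _) (Xi _ _) (Xi _ _) => a b c; ring.
Qed.

Lemma jet_quad_Xr (M : R -> bform) (M0 : bform) :
  (forall I J, (fun t => M t I J) @ 0^'+ --> M0 I J) ->
  jet (fun t => quad (M t) (Xr t) (Xr t)) 0
    (4 * \sum_be \sum_ga M0 (nd be) (nd ga) * U2 be * U2 ga).
Proof.
move=> cM.
apply: (@jet_near_eq _ (fun t => t ^+ 2 * quad (M t) (Xi t) (Xi t))).
  by apply: filterS (@near0_neq0 R) => t t0; rewrite quad_Xr.
apply: (jet_eq (jet0M (@jet_t2 R) (cvg_quad cM cvg_Xi cvg_Xi))) => //.
rewrite mul1r quad_nn mulr_sumr; apply: eq_bigr => be _; rewrite mulr_sumr; apply: eq_bigr => ga _.
by move: (M0 _ _) (U2 be) (U2 ga) => a b c; ring.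
Qed.

(** The tilt [dU2] of the tangent vectors is normal; by orthogonality on Sigma it does not
    contribute at order [t^2]. *)
Lemma jet_metric_tt i j :
  jet (fun t => gm t (L' i) (L' j)) (G0 (td i) (td j)) (G2 (td i) (td j)).
Proof.
under eq_fun do rewrite mxE /cmetric -/(X i _) -/(X j _) X_r mul0r addr0.
apply: (jet_eq (jet_quad jet_T (jet_X i) (jet_X j))); first by rewrite quad_tt.
rewrite quad_tt quad_nt quad_tn big1 => [|be _]; last by rewrite (sympos_sym _ _ (pgb _ Ux)) orth mulr0.
by rewrite big1 ?addr0 // => be _; rewrite orth mulr0.
Qed.

Lemma jet_metric_rr :
  jet (fun t => gm t (rlast n) (rlast n)) 1
    (4 * \sum_be \sum_ga G0 (nd be) (nd ga) * U2 be * U2 ga).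
Proof.
under eq_fun do rewrite mxE /cmetric -/(Xr _) Xr_r mulr1.
apply: (jet_eq (jetD (jet_quad_Xr _ _ (fun I J => jet_cvg (jet_T I J))) (jet_cst 1))).
  by rewrite add0r.
by rewrite addr0.
Qed.

(** Orthogonality on Sigma makes the covector [T(X_i, -)] of order [t^2] on normal directions, and
    the normal part [u_r] of [Xr] tends to 0. *)
Lemma jet_quad_tr i : jet (fun t => quad (Tq t) (X i t) (Xr t)) 0 0.
Proof.
rewrite /quad; under eq_fun do rewrite exchange_big /=.
apply: jet_eq.
- apply: jet_sum => J.
  instantiate (1 := fun=> 0); instantiate (1 := fun=> 0).
  rewrite /=; case: (split_ordP J) => j ->.
    apply: (@jet_near_eq _ (fun=> 0)); last exact: jet_cst.
    by apply: nearW => t; rewrite big1 // => I _; rewrite Xr_t mulr0.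
  apply: (@jet_near_eq _ (fun t => (\sum_I (Tq t) I (nd j) * X i t (L I)) * Xr t (L (nd j)))).
    by apply: nearW => t; rewrite mulr_suml.
  have H : jet (fun t => \sum_I (Tq t) I (nd j) * X i t (L I)) 0
     (\sum_I (G2 I (nd j) * unit_t R i (L I) + G0 I (nd j) * nvec (dU2 i) (L I))).
    apply: jet_eq.
    - by apply: jet_sum => I; apply: jetM; [exact: jet_T|exact: jet_X].
    - rewrite sum_tn /unit_t (eq_bigr (fun k => (i == k)%:R * G0 (td k) (nd j))); last first.
        by move=> k _; rewrite tnr_vec_t mulrC.
      rewrite (sum_delta_l (fun k => G0 (td k) (nd j))) /G0 orth add0r big1 // => be _.
      by rewrite tnr_vec_n mulr0.
    - by [].
  apply: (jet_eq (jet0M H (cvg_Xr (L (nd j))))) => //.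
  by rewrite /rvec tnr_vec_n mulr0.
- by rewrite big1.
- by rewrite big1.
Qed.

Lemma jet_metric_tr i : jet (fun t => gm t (L' i) (rlast n)) 0 0.
Proof.
under eq_fun do rewrite mxE /cmetric -/(X i _) -/(Xr _) X_r mul0r addr0.
exact: jet_quad_tr.
Qed.

Lemma jet_metric_rt i : jet (fun t => gm t (rlast n) (L' i)) 0 0.
Proof.
apply: jet_near_eq (jet_metric_tr i).
apply: filterS near_Q => t /QS St.
by rewrite [LHS]mxE [RHS]mxE (cmetricC pT).
Qed.

Definition gtt : 'M[R]_n := ulsubmx G0.
Definition G2tt : 'M[R]_n := ulsubmx G2.
Definition normU2 : R := \sum_be \sum_ga G0 (nd be) (nd ga) * U2 be * U2 ga.

Let M0 : 'M[R]_(n + 1) := block_mx gtt 0 0 1%:M.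
Let M2 : 'M[R]_(n + 1) := block_mx G2tt 0 0 (4 * normU2)%:M.

Lemma jet_graph_metric a b : jet (fun t => gm t a b) (M0 a b) (M2 a b).
Proof.
rewrite /M0 /M2; case: (split_ordP a) => i ->; case: (split_ordP b) => j ->.
- by apply: (jet_eq (jet_metric_tt i j)); rewrite block_mxEul !mxE.
- rewrite (ord1 j); apply: (jet_eq (jet_metric_tr i)); by rewrite block_mxEur mxE.
- rewrite (ord1 i); apply: (jet_eq (jet_metric_rt j)); by rewrite block_mxEdl mxE.
- rewrite (ord1 i) (ord1 j); apply: (jet_eq jet_metric_rr); by rewrite block_mxEdr mxE.
Qed.

Lemma M0V : M0 *m block_mx (invmx gtt) 0 0 1%:M = 1%:M.
Proof.
rewrite /M0 mulmx_block !mulmx0 !mul0mx !addr0 !add0r mulmxV ?(sympos_unitmx (sympos_ulsubmx (pgb _ Ux))) // mulmx1.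
by rewrite -scalar_mx_block.
Qed.

Lemma invM0 : invmx M0 = block_mx (invmx gtt) 0 0 1%:M.
Proof. by rewrite -[LHS]mulmx1 -M0V mulKmx ?(mulmx1_unit M0V).1. Qed.

Lemma invM0M2 : invmx M0 *m M2 *m invmx M0 =
  block_mx (invmx gtt *m G2tt *m invmx gtt) 0 0 (4 * normU2)%:M.
Proof.
rewrite invM0 /M2 !mulmx_block !(mulmx0, mul0mx, addr0, add0r).
by rewrite mul1mx mulmx1.
Qed.

Lemma jet_inv a b : jet (fun t => invmx (gm t) a b) (block_mx (invmx gtt) 0 0 1%:M a b)
  (- block_mx (invmx gtt *m G2tt *m invmx gtt) 0 0 (4 * normU2)%:M a b).
Proof.
by rewrite -invM0M2 -invM0; exact: (@jet_invmx _ _ _ _ _ a b jet_graph_metric (mulmx1_unit M0V).1).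
Qed.

Lemma jet_inv_tt i j : jet (fun t => invmx (gm t) (L' i) (L' j))
  (invmx gtt i j) (- (invmx gtt *m G2tt *m invmx gtt) i j).
Proof. by apply: (jet_eq (jet_inv _ _)); rewrite block_mxEul. Qed.

Lemma jet_inv_tr i : jet (fun t => invmx (gm t) (L' i) (rlast n)) 0 0.
Proof. by apply: (jet_eq (jet_inv _ _)); rewrite block_mxEur mxE ?oppr0. Qed.

Lemma jet_inv_rt i : jet (fun t => invmx (gm t) (rlast n) (L' i)) 0 0.
Proof. by apply: (jet_eq (jet_inv _ _)); rewrite block_mxEdl mxE ?oppr0. Qed.

Lemma jet_inv_rr : jet (fun t => invmx (gm t) (rlast n) (rlast n)) 1 (- (4 * normU2)).
Proof. by apply: (jet_eq (jet_inv _ _)); rewrite block_mxEdr mxE. Qed.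

Let EE al t a b := graph_accel T u al (q t) a b.

Lemma qchr_tt K i j t :
  qchr T (Fq t) K (X i t) (X j t) = quad (gam T (Fq t) K) (X i t) (X j t).
Proof.
rewrite /qchr big1 ?mulr0 ?addr0 // => I _.
by rewrite !X_r mulr0 mul0r addr0 mulr0.
Qed.

Lemma qchr_rr K t : qchr T (Fq t) K (Xr t) (Xr t) = quad (gam T (Fq t) K) (Xr t) (Xr t)
  + \sum_be shape T (Fq t) K (nd be) * ur be t.
Proof.
rewrite /qchr; congr (_ + _); rewrite sum_tn big1 ?add0r; last first.
  by move=> k _; rewrite Xr_t mul0r mulr0 addr0 mulr0.
rewrite mulr_sumr; apply: eq_bigr => be _; rewrite Xr_n Xr_r mulr1 mul1r.
by move: (shape _ _ _ _) (pd _ _ _) => a b; field.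
Qed.

Lemma cvg_qchr K (Y Z : R -> 'I_(n + m + 1) -> R) (Y0 Z0 : 'I_(n + m + 1) -> R) :
  (forall A, (fun t => Y t A) @ 0^'+ --> Y0 A) ->
  (forall A, (fun t => Z t A) @ 0^'+ --> Z0 A) ->
  (fun t => qchr T (Fq t) K (Y t) (Z t)) @ 0^'+ --> quad (Gam0 K) Y0 Z0.
Proof.
move=> cY cZ; apply: (cvg_eqv (a := quad (Gam0 K) Y0 Z0 + 2^-1 *
  \sum_I 0 * (Y0 (L I) * Z0 (rlast (n + m)) + Y0 (rlast (n + m)) * Z0 (L I)))); last first.
  by rewrite big1 ?mulr0 ?addr0 // => I _; rewrite mul0r.
apply: cvgD; first by apply: cvg_quad => // I J; exact: jet_cvg (jet_gam K I J).
apply: cvgM; first exact: cvg_cst.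
apply: cvg_fsum => I _; apply: cvgM; first exact: cvg_shape.
by apply: cvgD; apply: cvgM.
Qed.

Lemma quad_rvec_r (M : bform) Y : quad M Y rvec = 0.
Proof.
rewrite /quad big1 // => I _; rewrite big1 // => J _; rewrite /rvec.
by case: (split_ordP J) => j ->; rewrite ?tnr_vec_t ?tnr_vec_n mulr0.
Qed.

Lemma quad_rvec_l (M : bform) Y : quad M rvec Y = 0.
Proof.
rewrite /quad big1 // => I _; rewrite big1 // => J _; rewrite /rvec.
by case: (split_ordP I) => j ->; rewrite ?tnr_vec_t ?tnr_vec_n mulr0 mul0r.
Qed.

(** Both [u_r] and [T_r] are [O(t)], so their product is [t^2] times a convergent function. *)
Lemma jet_radial_term al (Y Z : R -> 'I_(n + m + 1) -> R) (Y0 Z0 : 'I_(n + m + 1) -> R) :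
  (forall A, (fun t => Y t A) @ 0^'+ --> Y0 A) ->
  (forall A, (fun t => Z t A) @ 0^'+ --> Z0 A) ->
  jet (fun t => ur al t
        * (2^-1 * quad (rT T (Fq t)) (Y t) (Z t))) 0
    (2 * U2 al * (2^-1 * quad (fun I J => 2 * gt 2%N zS I J) Y0 Z0)).
Proof.
move=> cY cZ.
apply: (@jet_near_eq _ (fun t => t ^+ 2 * (ur al t / t
   * (2^-1 * quad (fun I J => rT T (Fq t) I J / t) (Y t) (Z t))))).
  apply: filterS (@near0_neq0 R) => t t0; rewrite -quad_divr.
  by move: (pd _ _ _) (quad _ _ _) => a b; field.
apply: jet_eq.
- apply: jet0M; first exact: jet_t2.
  apply: cvgM; first exact: jet_cvg (jet_ur al).
  apply: cvgM; first exact: cvg_cst.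
  by apply: cvg_quad => // I J; exact: cvg_rT_over.
- by [].
- by rewrite mul1r.
Qed.

(** Since [u] and its [x]-derivatives start at order [t^2], they enter linearly: through second
    derivatives, through the tilt of the two tangent vectors, and through [- u_k Gamma^k]. [Gam2] is
    the variation of the symbols along the graph. *)
Lemma jet_E_tt al i j : jet (fun t => EE al t (L' i) (L' j))
  (Gam0 (nd al) (td i) (td j))
  (ddU2 i j al + (Gam2 (nd al) (td i) (td j)
     + \sum_be dU2 i be * Gam0 (nd al) (nd be) (td j)
     + \sum_be dU2 j be * Gam0 (nd al) (td i) (nd be))
   - \sum_k dU2 k al * Gam0 (td k) (td i) (td j)
   + 2 * U2 al * gt 2%N zS (td i) (td j)).
Proof.
rewrite /EE /graph_accel -/(X i) -/(X j).
under eq_fun do rewrite -/(X i _) -/(X j _).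
apply: jet_eq.
- apply: jetD; last exact: (jet_radial_term al _ _ _ _ (cvg_X i) (cvg_X j)).
  apply: jetB; last first.
    apply: jet_sum => k; apply: jet0M; first exact: (@jet_u_pds [:: k] al).
    exact: (cvg_qchr (td k) _ _ _ _ (cvg_X i) (cvg_X j)).
  apply: jetD; first exact: (@jet_u_pds [:: i; j] al).
  under eq_fun do rewrite qchr_tt.
  exact: (jet_quad (jet_gam (nd al)) (jet_X i) (jet_X j)).
- by rewrite quad_tt big1 ?subr0 ?addr0 ?add0r.
- rewrite /= !quad_tt quad_nt quad_tn; congr (_ + _ - _ + _); last by field.
  by apply: eq_bigr => k _; rewrite quad_tt.
Qed.

(** [12 = 4 * 3] comes from [u_rr]. The factors 4 arise from [u_r = 2 t U2 + o(t)], used twice in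
    the Christoffel term and once against [T^-1 T_r = 2 t Sh + o(t)]. *)
Lemma jet_E_rr al : jet (fun t => EE al t (rlast n) (rlast n)) (2 * U2 al)
  (12 * U4 al + (4 * (\sum_be \sum_ga Gam0 (nd al) (nd be) (nd ga) * U2 be * U2 ga)
     + 4 * \sum_be Sh (nd al) (nd be) * U2 be)).
Proof.
have Jq K : jet (fun t => qchr T (Fq t) K (Xr t) (Xr t)) 0
   (4 * (\sum_be \sum_ga Gam0 K (nd be) (nd ga) * U2 be * U2 ga)
     + 4 * \sum_be Sh K (nd be) * U2 be).
  under eq_fun do rewrite qchr_rr.
  apply: jet_eq.
  - apply: jetD; first exact: (jet_quad_Xr _ _ (fun I J => jet_cvg (jet_gam K I J))).
    instantiate (1 := 4 * \sum_be Sh K (nd be) * U2 be); instantiate (1 := 0).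
    apply: (@jet_near_eq _ (fun t => t ^+ 2 * \sum_be shape T (Fq t) K (nd be) / t *
       (ur be t / t))).
      apply: filterS (@near0_neq0 R) => t t0; rewrite mulr_sumr; apply: eq_bigr => be _.
      by move: (shape _ _ _ _) (pd _ _ _) => a b; field.
    have H : (fun t => \sum_be shape T (Fq t) K (nd be) / t *
       (ur be t / t)) @ 0^'+ -->
       \sum_be (2 * Sh K (nd be)) * (2 * U2 be).
      by apply: cvg_fsum => be _; apply: cvgM; [exact: cvg_shape_over|exact: jet_cvg (jet_ur be)].
    apply: (jet_eq (jet0M (@jet_t2 R) H)) => //.
    rewrite mul1r mulr_sumr; apply: eq_bigr => be _.
    by move: (Sh _ _) (U2 be) => a b; ring.
  - by rewrite addr0.
  - by [].
rewrite /EE /graph_accel.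
apply: jet_eq.
- apply: jetD; last exact: (jet_radial_term al _ _ _ _ cvg_Xr cvg_Xr).
  apply: jetB; last first.
    apply: jet_sum => k; apply: jet0M; first exact: (@jet_u_pds [:: k] al).
    exact: (jet_cvg (Jq (td k))).
  apply: jetD; first exact: jet_urr.
  exact: (Jq (nd al)).
- by rewrite /= big1 ?subr0 ?addr0.
- rewrite /= quad_rvec_r !mulr0 addr0 -[RHS]subr0; congr (_ - _).
  by rewrite big1 // => k _; rewrite mulr0.
Qed.

(** A limit is enough here, because the mixed entries of the inverse metric are [o(t^2)]. *)
Lemma cvg_E_tr al i : (fun t => EE al t (L' i) (rlast n)) @ 0^'+ --> 0.
Proof.
apply: cvg_eqv.
- apply: cvgD; last exact: (jet_cvg (jet_radial_term al _ _ _ _ (cvg_X i) cvg_Xr)).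
  apply: cvgB.
    apply: cvgD; first exact: cvg_uir.
    exact: (cvg_qchr (nd al) _ _ _ _ (cvg_X i) cvg_Xr).
  apply: cvg_fsum => k _; apply: cvgM; first exact: jet_cvg (@jet_u_pds [:: k] al).
  exact: (cvg_qchr (td k) _ _ _ _ (cvg_X i) cvg_Xr).
- by rewrite quad_rvec_r big1 ?subr0 ?addr0 // => k _; rewrite mul0r.
Qed.

Lemma cvg_E_rt al i : (fun t => EE al t (rlast n) (L' i)) @ 0^'+ --> 0.
Proof.
apply: cvg_eqv.
- apply: cvgD; last exact: (jet_cvg (jet_radial_term al _ _ _ _ cvg_Xr (cvg_X i))).
  apply: cvgB.
    apply: cvgD; first exact: cvg_uri.
    exact: (cvg_qchr (nd al) _ _ _ _ cvg_Xr (cvg_X i)).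
  apply: cvg_fsum => k _; apply: cvgM; first exact: jet_cvg (@jet_u_pds [:: k] al).
  exact: (cvg_qchr (td k) _ _ _ _ cvg_Xr (cvg_X i)).
- by rewrite quad_rvec_l big1 ?subr0 ?addr0 // => k _; rewrite mul0r.
Qed.

(* The coefficients of r^0 and r^2 in minimal_graph_equation. *)
Lemma minimal_coefficients al :
  \sum_i \sum_j invmx gtt i j * Gam0 (nd al) (td i) (td j) + 2 * U2 al
    = (n%:R + 1) * (2 * U2 al) /\
  \sum_i \sum_j
    (- (invmx gtt *m G2tt *m invmx gtt) i j * Gam0 (nd al) (td i) (td j)
     + invmx gtt i j * (ddU2 i j al + (Gam2 (nd al) (td i) (td j)
       + \sum_be dU2 i be * Gam0 (nd al) (nd be) (td j)
       + \sum_be dU2 j be * Gam0 (nd al) (td i) (nd be))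
       - \sum_k dU2 k al * Gam0 (td k) (td i) (td j)
       + 2 * U2 al * gt 2%N zS (td i) (td j)))
  + (- (4 * normU2) * (2 * U2 al) + (12 * U4 al
     + (4 * (\sum_be \sum_ga Gam0 (nd al) (nd be) (nd ga) * U2 be * U2 ga)
     + 4 * \sum_be Sh (nd al) (nd be) * U2 be)))
  = (n%:R + 1) * (4 * U4 al).
Proof.
have J1 : jet (fun t => (n%:R + 1) * (ur al t / t))
   ((n%:R + 1) * (2 * U2 al)) ((n%:R + 1) * (4 * U4 al)).
  apply: (jet_eq (jetM (jet_cst (n%:R + 1)) (jet_ur al))) => //.
  by rewrite mul0r add0r.
(* The same function is expanded twice: [J2] passes through the minimal surface equation, [J3] goes
   term by term. *)
have J2 : jet (fun t => \sum_a \sum_b invmx (gm t) a b * EE al t a b)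
   ((n%:R + 1) * (2 * U2 al)) ((n%:R + 1) * (4 * U4 al)).
  apply: jet_near_eq J1; apply: filterS near_Q => t Qt.
  have H := minimal_graph_equation (@open_slab_lt R _ U eps oU) (@S_pos _ _ U eps) pGp sT pT GpE
    (QS _ Qt) (fun A => minF _ A Qt) al.
  by rewrite [RHS]H /q rcoord_bpt.
have J3 : jet (fun t => \sum_a \sum_b invmx (gm t) a b * EE al t a b)
   (\sum_i \sum_j invmx gtt i j * Gam0 (nd al) (td i) (td j) + 2 * U2 al)
   (\sum_i \sum_j
    (- (invmx gtt *m G2tt *m invmx gtt) i j * Gam0 (nd al) (td i) (td j)
     + invmx gtt i j * (ddU2 i j al + (Gam2 (nd al) (td i) (td j)
       + \sum_be dU2 i be * Gam0 (nd al) (nd be) (td j)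
       + \sum_be dU2 j be * Gam0 (nd al) (td i) (nd be))
       - \sum_k dU2 k al * Gam0 (td k) (td i) (td j)
       + 2 * U2 al * gt 2%N zS (td i) (td j)))
  + (- (4 * normU2) * (2 * U2 al) + (12 * U4 al
     + (4 * (\sum_be \sum_ga Gam0 (nd al) (nd be) (nd ga) * U2 be * U2 ga)
     + 4 * \sum_be Sh (nd al) (nd be) * U2 be)))).
  under eq_fun do rewrite sum_ord_last.
  apply: jet_eq.
  - apply: jetD.
      under eq_fun do under eq_bigr do rewrite sum_ord_last.
      apply: jet_sum => i; apply: jetD.
        apply: jet_sum => j; apply: jetM; [exact: jet_inv_tt|exact: jet_E_tt].
      apply: jet0M; [exact: jet_inv_tr|exact: cvg_E_tr].
    under eq_fun do rewrite sum_ord_last.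
    apply: jetD; last by apply: jetM; [exact: jet_inv_rr|exact: jet_E_rr].
    apply: jet_sum => j; apply: jet0M; [exact: jet_inv_rt|exact: cvg_E_rt].
  - rewrite /= big1_eq add0r mul1r; congr (_ + _).
    by apply: eq_bigr => i _; rewrite addr0.
  - rewrite /= mul1r; congr (_ + _); first by apply: eq_bigr => i _; rewrite mul0r addr0.
    by rewrite big1 ?add0r // => j _; rewrite mul0r.
exact: (jet_uniq J3 J2).
Qed.

End MinimalJets.

Set Implicit Arguments.

(** * Geometry of Sigma *)

(** The identity [jacobi_identity] for fixed [i], [j]. [pb] and [pi] are the derivatives of
    [Gamma^al_(ij)] in the direction [b] and of [Gamma^al_(bj)] in the direction [i]; their
    difference is the derivative part of the curvature. The [G] functions are Christoffel symbols,
    with one free index summed over [I] (tangential) or [M] (normal). *)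
Lemma jacobi_pointwise (R : realType) (I M : finType) (dd : R)
    (H dHi dHj pb pi Gjb Gib Ggij : M -> R) (dHk Gkij Gik : I -> R)
    (Gbk Gkbj : M -> I -> R) (Gbg Ggbj : M -> M -> R) :
  dd + \sum_b H b * pb b + \sum_b dHi b * Gjb b + \sum_b dHj b * Gib b
    - \sum_k dHk k * Gkij k
  = (dd + \sum_b (dHi b * Gjb b + H b * pi b)
      + \sum_b (dHj b + \sum_c H c * Ggbj c b) * Gib b
      - \sum_k Gkij k * (dHk k + \sum_b H b * Gbk b k))
    + \sum_b H b * (pb b - pi b + (\sum_k Gbk b k * Gkij k + \sum_g Gbg b g * Ggij g
        - (\sum_k Gik k * Gkbj b k + \sum_g Gib g * Ggbj b g)))
    - \sum_b H b * \sum_g Gbg b g * Ggij g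
    + \sum_b H b * \sum_k Gik k * Gkbj b k.
Proof.
have E1 : \sum_b (dHi b * Gjb b + H b * pi b) = \sum_b dHi b * Gjb b + \sum_b H b * pi b.
  by rewrite big_split.
have E2 : \sum_b (dHj b + \sum_c H c * Ggbj c b) * Gib b =
    \sum_b dHj b * Gib b + \sum_c H c * \sum_b Gib b * Ggbj c b.
  rewrite (eq_bigr _ (fun b _ => mulrDl _ _ _)) big_split /=; congr (_ + _).
  rewrite (eq_bigr _ (fun b _ => mulr_suml _ _ _ _)) exchange_big /=.
  apply: eq_bigr => c _; rewrite mulr_sumr; apply: eq_bigr => b _; by ring.
have E3 : \sum_k Gkij k * (dHk k + \sum_b H b * Gbk b k) =
    \sum_k dHk k * Gkij k + \sum_b H b * \sum_k Gbk b k * Gkij k.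
  rewrite (eq_bigr _ (fun b _ => mulrDr _ _ _)) big_split /=; congr (_ + _).
    by apply: eq_bigr => k _; rewrite mulrC.
  rewrite (eq_bigr _ (fun b _ => mulr_sumr _ _ _ _)) exchange_big /=.
  apply: eq_bigr => c _; rewrite mulr_sumr; apply: eq_bigr => b _; by ring.
have E4 : \sum_b H b * (pb b - pi b + (\sum_k Gbk b k * Gkij k + \sum_g Gbg b g * Ggij g
        - (\sum_k Gik k * Gkbj b k + \sum_g Gib g * Ggbj b g))) =
   \sum_b H b * pb b - \sum_b H b * pi b + (\sum_b H b * \sum_k Gbk b k * Gkij k
    + \sum_b H b * \sum_g Gbg b g * Ggij g
    - (\sum_b H b * \sum_k Gik k * Gkbj b k + \sum_b H b * \sum_g Gib g * Ggbj b g)).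
  rewrite -!sumrB -!big_split -!sumrB -big_split /=; apply: eq_bigr => b _.
  by ring.
rewrite E1 E2 E3 E4.
by ring.
Qed.

(** * Variation of the Levi-Civita connection *)

Section CovariantVariation.
Variables (R : realType) (k : nat) (G : 'rV[R]_k -> 'M[R]_k) (O : set 'rV[R]_k).
Hypotheses (oO : open O) (pG : forall q, O q -> sympos (G q)).
Variables (P : 'rV[R]_k -> 'I_k -> 'I_k -> R).
Hypothesis sP : forall q A B, O q -> P q A B = P q B A.

(* The variation of the Levi-Civita connection in the direction P. *)
Lemma dchr_covariant p C A B : O p ->
  dchr (invmx (G p)) (P p) (fun i j l => pd i (fun q => G q j l) p)
    (fun i j l => pd i (fun q => P q j l) p) C A B =
  2^-1 * \sum_E ginv G p C E * (cov_deriv2 G P p A E B + cov_deriv2 G P p B E A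
    - cov_deriv2 G P p E A B).
Proof.
move=> Op; rewrite /dchr; congr (_ * _).
have cs := fun D E F => christoffel_sym oO pG D E F Op.
(* Of the six Christoffel terms in the three covariant derivatives only [2 P_(EF) Gamma^F_(AB)]
   survives; it accounts for the variation of the inverse metric in [dchr]. *)
have Ecov E : cov_deriv2 G P p A E B + cov_deriv2 G P p B E A - cov_deriv2 G P p E A B =
   pd A (fun q => P q E B) p + pd B (fun q => P q E A) p - pd E (fun q => P q A B) p
   - \sum_F 2 * (P p E F * christoffel G p F A B).
  rewrite /cov_deriv2.
  have -> : \sum_F 2 * (P p E F * christoffel G p F A B) =
     \sum_F christoffel G p F A E * P p F B + \sum_F christoffel G p F A B * P p E F
     + (\sum_F christoffel G p F B E * P p F A + \sum_F christoffel G p F B A * P p E F)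
     - (\sum_F christoffel G p F E A * P p F B + \sum_F christoffel G p F E B * P p A F).
    rewrite -!big_split -sumrB /=; apply: eq_bigr => F _.
    rewrite (cs F B A) (cs F A E) (cs F B E) (sP A F Op).
    by move: (christoffel _ _ _ _ _) (christoffel _ _ _ _ _) (christoffel _ _ _ _ _) (P _ _ _) (P _ _ _) (P _ _ _) => x1 x2 x3 x4 x5 x6; ring.
  move: (pd _ _ _) (pd _ _ _) (pd _ _ _) => x1 x2 x3.
  by move: (\sum_F _) (\sum_F _) (\sum_F _) (\sum_F _) (\sum_F _) (\sum_F _) => y1 y2 y3 y4 y5 y6; ring.
rewrite (eq_bigr _ (fun E _ => congr1 (fun x => ginv G p C E * x) (Ecov E))).
rewrite big_split /= addrC.
rewrite [RHS](eq_bigr _ (fun E _ => mulrBr _ _ _)) sumrB; congr (_ + _).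
rewrite [LHS](eq_bigr _ (fun E _ => mulNr _ _)) sumrN; congr (- _).
rewrite [LHS](eq_bigr _ (fun E _ => mulr_suml _ _ _ _)) exchange_big /=.
apply: eq_bigr => F _; rewrite mulr_sumr.
rewrite [LHS](eq_bigr _ (fun E _ => mulr_suml _ _ _ _)) exchange_big /=.
apply: eq_bigr => H _; rewrite /christoffel.
rewrite [RHS](_ : _ = ginv G p C F * P p F H * \sum_E ginv G p H E *
   (pd A (fun q => G q E B) p + pd B (fun q => G q E A) p - pd E (fun q => G q A B) p)); last first.
  move: (\sum_E _) (ginv _ _ _ _) (P _ _ _) => x y z; by field.
by rewrite mulr_sumr; apply: eq_bigr => E _; rewrite !mulrA.
Qed.

Lemma cov_deriv2_sym p C A B : O p -> cov_deriv2 G P p C A B = cov_deriv2 G P p C B A.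
Proof.
move=> Op; rewrite /cov_deriv2 (pd_eq_open (g := fun q => P q B A) C oO Op) => [|q Oq]; last exact: sP.
rewrite addrAC; congr (_ - _ - _); apply: eq_bigr => E _; by rewrite (sP _ _ Op).
Qed.

End CovariantVariation.

(** * Submanifold geometry in adapted coordinates *)

Section SigmaGeometry.
Variables (R : realType) (n m : nat) (U : set 'rV[R]_(n + m)).
Variables (gb : 'rV[R]_(n + m) -> 'M[R]_(n + m)) (V : set 'rV[R]_n).
Hypotheses (oU : open U) (oV : open V).
Hypothesis sgb : forall I J, smooth_open U (fun z => gb z I J).
Hypothesis pgb : forall z, U z -> sympos (gb z).
Hypothesis VU : forall y, V y -> U (on_Sigma m y).
Hypothesis orth : forall y i be, V y -> gb (on_Sigma m y) (tdir m i) (ndir n be) = 0.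
Local Notation t := (@tdir n m).
Local Notation v := (@ndir n m).
Local Notation zS := (on_Sigma m).
Local Notation Gam := (christoffel gb).

Lemma orth' y i be : V y -> gb (zS y) (v be) (t i) = 0.
Proof. by move=> Vy; rewrite (sympos_sym _ _ (pgb (VU Vy))) orth. Qed.

Let gtt y : 'M[R]_n := ulsubmx (gb (zS y)).
Let gnn y : 'M[R]_m := drsubmx (gb (zS y)).

Lemma gb_block y : V y -> gb (zS y) = block_mx (gtt y) 0 0 (gnn y).
Proof.
move=> Vy; rewrite -[LHS]submxK; congr (block_mx _ _ _ _).
  by apply/matrixP => i j; rewrite !mxE orth.
by apply/matrixP => i j; rewrite !mxE orth'.
Qed.

Lemma gtt_gnn_unit y : V y -> gtt y \in unitmx /\ gnn y \in unitmx.
Proof.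
move=> Vy; have := sympos_unitmx (pgb (VU Vy)).
by rewrite gb_block // !unitmxE det_ublock unitrM => /andP[].
Qed.

Lemma inv_gb y : V y -> invmx (gb (zS y)) = block_mx (invmx (gtt y)) 0 0 (invmx (gnn y)).
Proof.
move=> Vy; have [ut un] := gtt_gnn_unit Vy; have ug := sympos_unitmx (pgb (VU Vy)).
set B := block_mx _ _ _ _.
suff E : gb (zS y) *m B = 1%:M by rewrite -[LHS]mulmx1 -E mulKmx.
rewrite gb_block // mulmx_block !mulmx0 !mul0mx !addr0 !add0r !mulmxV //.
by rewrite -scalar_mx_block.
Qed.

Lemma ginv_tt y i j : V y -> ginv gb (zS y) (t i) (t j) = ginv (induced_metric gb) y i j.
Proof. by move=> Vy; rewrite /ginv inv_gb // block_mxEul. Qed.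

Lemma ginv_tn y i be : V y -> ginv gb (zS y) (t i) (v be) = 0.
Proof. by move=> Vy; rewrite /ginv inv_gb // block_mxEur mxE. Qed.

Lemma ginv_nt y i be : V y -> ginv gb (zS y) (v be) (t i) = 0.
Proof. by move=> Vy; rewrite /ginv inv_gb // block_mxEdl mxE. Qed.

Lemma ginv_nnK y al ga : V y ->
  \sum_e ginv gb (zS y) (v al) (v e) * gb (zS y) (v e) (v ga) = (al == ga)%:R.
Proof.
move=> Vy; have := sum_invmxl (v al) (v ga) (sympos_unitmx (pgb (VU Vy))).
rewrite sum_tn big1 ?add0r => [|k _]; last by rewrite orth // mulr0.
by move=> ->; rewrite /ndir eq_rshift.
Qed.

(** With tangential and normal coordinate directions orthogonal on Sigma, the normal projection just
    reads off the normal components. *)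
Lemma normal_coordE y W a : V y -> normal_coord gb y W a = W (v a).
Proof.
move=> Vy; rewrite /normal_coord.
transitivity (\sum_C (v a == C)%:R * W C); last by rewrite sum_delta_l.
rewrite (eq_bigr (fun b => \sum_C ginv gb (zS y) (v a) (v b) * gb (zS y) C (v b) * W C)); last first.
  by move=> b _; rewrite mulr_sumr; apply: eq_bigr => C _; rewrite mulrA.
rewrite exchange_big /=; apply: eq_bigr => C _; rewrite -mulr_suml; congr (_ * _).
rewrite -(sum_invmxl (v a) C (sympos_unitmx (pgb (VU Vy)))) sum_tn.
rewrite [X in _ = X + _]big1 ?add0r => [|k _]; last by rewrite [invmx _ _ _]ginv_nt // mul0r.
by apply: eq_bigr => b _; rewrite (sympos_sym _ _ (pgb (VU Vy))).
Qed.

Lemma second_formE y i j a : V y -> second_form gb y i j a = Gam (zS y) (v a) (t i) (t j).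
Proof. by move=> Vy; rewrite /second_form normal_coordE. Qed.

(** The mixed components vanish along Sigma, hence also their derivatives in tangential directions.
    Their normal derivatives may well be nonzero. *)
Lemma pd_gb_tn y K i be : V y -> pd (t K) (fun z => gb z (t i) (v be)) (zS y) = 0.
Proof.
move=> Vy; rewrite -pd_on_Sigma (pd_eq_open (g := fun=> 0) K oV Vy) ?pd_cst //.
by move=> y' Vy'; rewrite orth.
Qed.

Lemma pd_gb_nt y K i be : V y -> pd (t K) (fun z => gb z (v be) (t i)) (zS y) = 0.
Proof.
move=> Vy; rewrite -pd_on_Sigma (pd_eq_open (g := fun=> 0) K oV Vy) ?pd_cst //.
by move=> y' Vy'; rewrite orth'.
Qed.

Lemma christoffel_induced y k i j : V y ->
  christoffel (induced_metric gb) y k i j = Gam (zS y) (t k) (t i) (t j).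
Proof.
move=> Vy; rewrite /christoffel; congr (_ * _).
rewrite [RHS]sum_tn [X in _ = _ + X]big1 ?addr0 => [|be _]; last by rewrite ginv_tn // mul0r.
have E e i' j' : pd e (fun q => induced_metric gb q i' j') y = pd (t e) (fun z => gb z (t i') (t j')) (zS y).
  by rewrite -pd_on_Sigma; congr (pd _ _ _); apply/funext => q; rewrite !mxE.
by apply: eq_bigr => e _; rewrite ginv_tt // !E.
Qed.

Lemma christoffel_tnt y k be j : V y -> Gam (zS y) (t k) (v be) (t j) =
  2^-1 * \sum_l ginv (induced_metric gb) y k l * pd (v be) (fun z => gb z (t l) (t j)) (zS y).
Proof.
move=> Vy; rewrite /christoffel; congr (_ * _).
rewrite sum_tn [X in _ + X]big1 ?addr0 => [|e _]; last by rewrite ginv_tn // mul0r.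
by apply: eq_bigr => l _; rewrite ginv_tt // pd_gb_tn // pd_gb_nt // subr0 addr0.
Qed.

(** With the normal index lowered, [Gamma_(b, ik)] loses its two mixed metric derivatives and is
    minus half the normal derivative of the tangential metric. Together with [christoffel_tnt] this
    allows products of second fundamental forms to be compared with variations of the induced
    metric. *)
Lemma inner_second_form y i k (nu : 'I_m -> R) : V y ->
  inner_normal gb y (second_form gb y i k) nu =
  - (2^-1 * \sum_b nu b * pd (v b) (fun z => gb z (t i) (t k)) (zS y)).
Proof.
move=> Vy; rewrite /inner_normal exchange_big /= mulr_sumr -sumrN; apply: eq_bigr => b _.
have := christoffel_lower pgb (v b) (t i) (t k) (VU Vy).
rewrite /chr_low pd_gb_nt // pd_gb_nt // !add0r sum_tn big1 ?add0r => [|l _]; last by rewrite orth // mul0r.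
rewrite -mulr_suml => E.
rewrite (eq_bigr (fun a => gb (zS y) (v a) (v b) * Gam (zS y) (v a) (t i) (t k))); last first.
  by move=> a _; rewrite second_formE.
by rewrite E; move: (pd _ _ _) (nu b) => c e; ring.
Qed.

Section Laplacian.
Variable H : 'rV[R]_n -> 'I_m -> R.
Hypothesis sH : forall b, smooth_open V (fun y => H y b).

Lemma nabla_perpE y j a : V y -> nabla_perp gb j H y a =
  pd j (fun y => H y a) y + \sum_b H y b * Gam (zS y) (v a) (v b) (t j).
Proof.
move=> Vy; congr (_ + _); apply: eq_bigr => b _; rewrite normal_coordE //.
by rewrite (christoffel_sym oU pgb _ _ _ (VU Vy)).
Qed.

(** [h], which is given on Sigma only, is extended constantly in the normal directions, so that the
    product rule applies in the ambient coordinates. *)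
Lemma pd_product_on_Sigma (h : 'rV[R]_n -> R) (f : 'rV[R]_(n + m) -> R) i y :
  differentiable h y -> differentiable f (zS y) ->
  pd i (fun y => h y * f (zS y)) y = pd i h y * f (zS y) + h y * pd (t i) f (zS y).
Proof.
move=> dh df.
have lE (y' : 'rV[R]_n) : lsubmx (zS y') = y' by rewrite /on_Sigma row_mxKl.
have dh' : differentiable (fun z : 'rV[R]_(n + m) => h (lsubmx z)) (zS y).
  by apply: differentiable_comp; [exact: differentiable_lsubmx|rewrite lE].
have -> : (fun y => h y * f (zS y)) = (fun y => h (lsubmx (zS y)) * f (zS y)).
  by apply/funext => y'; rewrite lE.
have E1 := @pd_on_Sigma R n m (fun z => h (lsubmx z) * f z) i y.
have E2 := @pd_on_Sigma R n m (fun z => h (lsubmx z)) i y.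
rewrite E1 pdM // -E2 lE.
by have -> : (fun y => h (lsubmx (zS y))) = h by apply/funext => y'; rewrite lE.
Qed.

Lemma differentiable_product_on_Sigma (h : 'rV[R]_n -> R) (f : 'rV[R]_(n + m) -> R) y :
  differentiable h y -> differentiable f (zS y) ->
  differentiable (fun y => h y * f (zS y)) y.
Proof.
move=> dh df; apply: differentiableMf => //.
apply: differentiable_comp => //.
have -> : @on_Sigma R n m = mulmxr (row_mx 1%:M 0).
  by apply/funext => y'; rewrite /= mul_mx_row mulmx1 mulmx0.
apply: linear_differentiable => y'; apply: (@cvg_rV _ _ (nbhs y') (nbhs_filter y')) => A /=.
rewrite mul_mx_row mulmx1 mulmx0; under eq_fun do rewrite mul_mx_row mulmx1 mulmx0.
case: (split_ordP A) => j ->.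
  by rewrite row_mxEl; under eq_fun do rewrite row_mxEl; exact: coord_continuous.
by rewrite row_mxEr; under eq_fun do rewrite row_mxEr; exact: cvg_cst.
Qed.

Lemma laplacian_perpE y al : V y -> laplacian_perp gb H y al =
  \sum_i \sum_j ginv (induced_metric gb) y i j *
   (pd i (pd j (fun y => H y al)) y
    + \sum_b (pd i (fun y => H y b) y * Gam (zS y) (v al) (v b) (t j)
              + H y b * pd (t i) (fun z => Gam z (v al) (v b) (t j)) (zS y))
    + \sum_b (pd j (fun y => H y b) y + \sum_c H y c * Gam (zS y) (v b) (v c) (t j))
        * Gam (zS y) (v al) (t i) (v b)
    - \sum_k Gam (zS y) (t k) (t i) (t j)
        * (pd k (fun y => H y al) y + \sum_b H y b * Gam (zS y) (v al) (v b) (t k))).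
Proof.
move=> Vy; apply: eq_bigr => i _; apply: eq_bigr => j _; congr (_ * _).
have dH b : differentiable (fun y => H y b) y by exact: (smooth_differentiable (sH b)).
have dGam K I J : differentiable (fun z => Gam z K I J) (zS y).
  exact: (differentiable_christoffel sgb pgb _ _ _ (VU Vy)).
have dHG b : differentiable (fun y => H y b * Gam (zS y) (v al) (v b) (t j)) y.
  exact: (differentiable_product_on_Sigma (h := fun y => H y b) (f := fun z => Gam z (v al) (v b) (t j))).
congr (_ - _); last first.
  by apply: eq_bigr => k _; rewrite christoffel_induced // nabla_perpE.
rewrite {1}/nabla_perp; congr (_ + _).
  rewrite (pd_eq_open i oV Vy (fun q Vq => nabla_perpE j al Vq)).
  rewrite pdD; last 2 first.
  - exact: (smooth_differentiable (smooth_pd j (sH al)) Vy).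
  - exact: differentiable_fsum.
  congr (_ + _); rewrite pd_sum //.
  apply: eq_bigr => b _.
  exact: (pd_product_on_Sigma (h := fun y => H y b) (f := fun z => Gam z (v al) (v b) (t j))).
by apply: eq_bigr => b _; rewrite nabla_perpE // normal_coordE.
Qed.

End Laplacian.

(** * The Jacobi operator *)

Section Jacobi.
Variable y : 'rV[R]_n.
Hypothesis Vy : V y.
Local Notation gi := (ginv (induced_metric gb) y).
Local Notation Gy := (Gam (zS y)).

(** The two antisymmetries turn [R_(ibje)] into [R_(biej)], whose third index is a lowered one; by
    orthogonality the inverse of the normal block raises it again. *)
Lemma riemann_normal al i j b :
  \sum_e ginv gb (zS y) (v al) (v e) * riemann gb (zS y) (t i) (v b) (t j) (v e) =
  curv gb (zS y) (v b) (t i) (t j) (v al).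
Proof.
have Uz := VU Vy.
rewrite -[RHS](sum_delta_l (fun g => curv gb (zS y) (v b) (t i) (t j) (v g))).
have E e : riemann gb (zS y) (t i) (v b) (t j) (v e) =
    \sum_g gb (zS y) (v e) (v g) * curv gb (zS y) (v b) (t i) (t j) (v g).
  rewrite riemann_antisym12 (riemann_antisym34 oU sgb pgb _ _ _ _ Uz) opprK /riemann sum_tn.
  rewrite big1 ?add0r => [|k _]; last by rewrite orth // mul0r.
  by apply: eq_bigr => g _; rewrite (sympos_sym _ _ (pgb Uz)).
rewrite (eq_bigr _ (fun e _ => congr1 (fun x => _ * x) (E e))).
rewrite (eq_bigr _ (fun e _ => mulr_sumr _ _ _ _)) exchange_big /=.
apply: eq_bigr => g _; rewrite -(ginv_nnK al g Vy) mulr_suml.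
by apply: eq_bigr => e _; rewrite mulrA.
Qed.

(* The Jacobi operator of Sigma, in terms of ordinary derivatives. *)
Lemma jacobi_identity (H : 'rV[R]_n -> 'I_m -> R) al :
  (forall b, smooth_open V (fun y => H y b)) ->
  (forall g, H y g = mean_curvature_vector gb y g) ->
  \sum_i \sum_j gi i j *
   (pd i (pd j (fun y => H y al)) y
    + \sum_b H y b * pd (v b) (fun z => Gam z (v al) (t i) (t j)) (zS y)
    + \sum_b pd i (fun y => H y b) y * Gy (v al) (v b) (t j)
    + \sum_b pd j (fun y => H y b) y * Gy (v al) (t i) (v b)
    - \sum_k pd k (fun y => H y al) y * Gy (t k) (t i) (t j)) =
  laplacian_perp gb H y al
  + \sum_i \sum_j gi i j *
      (\sum_b H y b * curv gb (zS y) (v b) (t i) (t j) (v al))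
  - \sum_b \sum_e H y b * H y e * Gy (v al) (v b) (v e)
  + \sum_i \sum_j gi i j *
      (\sum_b H y b * \sum_k Gy (v al) (t i) (t k) * Gy (t k) (v b) (t j)).
Proof.
move=> sH hH; have Uz := VU Vy.
(* As [H^e] is the trace of [Gamma^e_(ij)], the term quadratic in [H] becomes a trace too, and the
   identity can be checked summand by summand. *)
have -> : \sum_b \sum_e H y b * H y e * Gy (v al) (v b) (v e) =
   \sum_i \sum_j gi i j *
     \sum_b H y b * \sum_g Gy (v al) (v b) (v g) * Gy (v g) (t i) (t j).
  rewrite [RHS](eq_bigr _ (fun i _ => eq_bigr _ (fun j _ => mulr_sumr _ _ _ _))) exchange_big3.
  apply: eq_bigr => b _.
  rewrite [RHS](eq_bigr (fun i => \sum_j \sum_e H y b * Gy (v al) (v b) (v e)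
     * (gi i j * Gy (v e) (t i) (t j)))); last first.
    move=> i _; apply: eq_bigr => j _; rewrite !mulr_sumr; apply: eq_bigr => e _.
    by move: (ginv _ _ _ _) (H _ _) (Gam _ _ _ _) (Gam _ _ _ _) => x1 x2 x3 x4; ring.
  rewrite exchange_big3; apply: eq_bigr => e _.
  rewrite (hH e) /mean_curvature_vector mulrAC mulr_sumr; apply: eq_bigr => i _.
  rewrite mulr_sumr; apply: eq_bigr => j _; rewrite second_formE //.
rewrite laplacian_perpE // -big_split -sumrB -big_split /=; apply: eq_bigr => i _.
rewrite -big_split -sumrB -big_split /=; apply: eq_bigr => j _.
rewrite -mulrDr -mulrBr -mulrDr; congr (_ * _).
have -> : \sum_b H y b * curv gb (zS y) (v b) (t i) (t j) (v al) =
   \sum_b H y b * (pd (v b) (fun z => Gam z (v al) (t i) (t j)) (zS y)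
     - pd (t i) (fun z => Gam z (v al) (v b) (t j)) (zS y)
     + (\sum_k Gy (v al) (v b) (t k) * Gy (t k) (t i) (t j)
        + \sum_g Gy (v al) (v b) (v g) * Gy (v g) (t i) (t j)
        - (\sum_k Gy (v al) (t i) (t k) * Gy (t k) (v b) (t j)
        + \sum_g Gy (v al) (t i) (v g) * Gy (v g) (v b) (t j)))).
  by apply: eq_bigr => b _; rewrite /curv sumrB !sum_tn.
exact: (@jacobi_pointwise R _ _ _ (H y) (fun b => pd i (fun y => H y b) y)
  (fun b => pd j (fun y => H y b) y)
  (fun b => pd (v b) (fun z => Gam z (v al) (t i) (t j)) (zS y))
  (fun b => pd (t i) (fun z => Gam z (v al) (v b) (t j)) (zS y))
  (fun b => Gy (v al) (v b) (t j))
  (fun b => Gy (v al) (t i) (v b))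
  (fun g => Gy (v g) (t i) (t j))
  (fun k => pd k (fun y => H y al) y)
  (fun k => Gy (t k) (t i) (t j))
  (fun k => Gy (v al) (t i) (t k))
  (fun b k => Gy (v al) (v b) (t k))
  (fun b k => Gy (t k) (v b) (t j))
  (fun b g => Gy (v al) (v b) (v g))
  (fun b g => Gy (v g) (v b) (t j))).
Qed.

End Jacobi.

End SigmaGeometry.

(** * The fourth coefficient *)

Section DchrLinear.
Variables (R : realType) (d : nat) (Gi : 'I_d -> 'I_d -> R) (D : 'I_d -> 'I_d -> 'I_d -> R).
Implicit Types (m : 'I_d -> 'I_d -> R) (dD : 'I_d -> 'I_d -> 'I_d -> R).

Lemma dchrD m m' dD dD' C A B :
  dchr Gi (fun F H => m F H + m' F H) D (fun i j l => dD i j l + dD' i j l) C A B =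
  dchr Gi m D dD C A B + dchr Gi m' D dD' C A B.
Proof.
rewrite /dchr -mulrDr -big_split /=; congr (_ * _); apply: eq_bigr => E _.
have -> : \sum_F \sum_H Gi C F * (m F H + m' F H) * Gi H E =
  \sum_F \sum_H Gi C F * m F H * Gi H E + \sum_F \sum_H Gi C F * m' F H * Gi H E.
  rewrite -big_split; apply: eq_bigr => F _; rewrite -big_split /=; apply: eq_bigr => H _.
  by rewrite mulrDr mulrDl.
by ring.
Qed.

Lemma dchrZ a m dD C A B :
  dchr Gi (fun F H => a * m F H) D (fun i j l => a * dD i j l) C A B =
  a * dchr Gi m D dD C A B.
Proof.
rewrite /dchr mulrCA; congr (_ * _); rewrite mulr_sumr; apply: eq_bigr => E _.
have -> : \sum_F \sum_H Gi C F * (a * m F H) * Gi H E =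
  a * \sum_F \sum_H Gi C F * m F H * Gi H E.
  rewrite mulr_sumr; apply: eq_bigr => F _; rewrite mulr_sumr /=; apply: eq_bigr => H _.
  by rewrite mulrCA !mulrA.
by ring.
Qed.

Lemma eq_dchr m m' dD dD' C A B : (forall F H, m F H = m' F H) ->
  (forall i j l, dD i j l = dD' i j l) -> dchr Gi m D dD C A B = dchr Gi m' D dD' C A B.
Proof.
move=> em ed; congr (_ * _); apply: eq_bigr => E _; rewrite !ed; congr (- _ * _ + _).
by apply: eq_bigr => F _; apply: eq_bigr => H _; rewrite em.
Qed.

Lemma dchr_sum (I : Type) (r : seq I) (c : I -> R) (mm : I -> 'I_d -> 'I_d -> R)
    (dd : I -> 'I_d -> 'I_d -> 'I_d -> R) C A B :
  dchr Gi (fun F H => \sum_(b <- r) c b * mm b F H) D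
    (fun i j l => \sum_(b <- r) c b * dd b i j l) C A B =
  \sum_(b <- r) c b * dchr Gi (mm b) D (dd b) C A B.
Proof.
elim: r => [|b r IH].
  rewrite big_nil -[RHS](mul0r (dchr Gi (fun _ _ => 0) D (fun _ _ _ => 0) C A B)) -dchrZ.
  by apply: eq_dchr => *; rewrite big_nil mul0r.
rewrite big_cons -IH -dchrZ -dchrD.
by apply: eq_dchr => *; rewrite big_cons.
Qed.

End DchrLinear.

(** Here [h = H^al], [HH = |H|^2], [tP] is the tangential trace of [P], [BP] is [P] applied to [H],
    [PA] its contraction with [A], [DP] the derivative term, [CU] the curvature trace,
    [G = Gamma^al(H, H)], and [- Z / 2] is the cubic term in [A]. Multiplied by [2 N], the
    contributions are: for [Z], [- 1] from the inverse metric and [1/2] from [J]; for [tP h], [1]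
    inside [CU] and [- 2] from [T_r]; for [BP], [N] inside [CU] and [- 4] from [T^-1 T_r]; for [G],
    [- 1] from [J] and [2 / N] from the radial direction. *)
Lemma fourth_coefficient_algebra (R : realFieldType) (N u X J L CU G Z DP PA tP HH h BP : R) :
  N != 0 -> 2 * N * X = - (N * DP) -> 2 * N * J = L + CU - G + 2^-1 * Z ->
  - (- PA + (2 * N)^-1 * Z) + J - X + N^-1 * h * - tP
  + (- (4 * ((2 * N)^-2 * HH)) * (2 * ((2 * N)^-1 * h))
     + (12 * u + (4 * ((2 * N)^-2 * G) + 4 * - ((2 * N)^-1 * BP)))) = (N + 1) * (4 * u) ->
  8 * N * (N - 2) * u = L + - (2^-1 * Z) - 2 / N ^+ 2 * HH * h + (CU - N * BP - tP * h)
    + (N - 4) * BP - tP * h + 2 * N * PA + N * DP - (N - 2) / N * G.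
Proof.
move=> N0 hX hJ hu; have K0 : 2 * N != 0 by rewrite mulf_neq0 // pnatr_eq0.
have -> : 8 * N * (N - 2) * u = 2 * N * ((N + 1) * (4 * u) - 12 * u) by ring.
have hX' : X = (2 * N)^-1 * - (N * DP) by rewrite -hX mulKf.
have hJ' : J = (2 * N)^-1 * (L + CU - G + 2^-1 * Z) by rewrite -hJ mulKf.
by rewrite -hu hX' hJ'; field.
Qed.

(** * Assembly of the covariant formula *)

Section FourthCoefficient.
Variables (R : realType) (n m : nat) (U : set 'rV[R]_(n + m)).
Variables (gb : 'rV[R]_(n + m) -> 'M[R]_(n + m)) (V : set 'rV[R]_n).
Hypotheses (oU : open U) (oV : open V).
Hypothesis sgb : forall I J, smooth_open U (fun z => gb z I J).
Hypothesis pgb : forall z, U z -> sympos (gb z).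
Hypothesis VU : forall y, V y -> U (on_Sigma m y).
Hypothesis orth : forall y i be, V y -> gb (on_Sigma m y) (tdir m i) (ndir n be) = 0.
Variables (gt2 : 'rV[R]_(n + m) -> 'M[R]_(n + m)) (c2 : 'rV[R]_n -> 'rV[R]_m) (x : 'rV[R]_n).
Hypothesis n0 : (0 < n)%N.
Local Notation P := (schouten gb).
Hypothesis gt2E : forall z i j, U z -> gt2 z i j = - P z i j.
Hypothesis gt2C : forall z i j, U z -> gt2 z i j = gt2 z j i.
Hypothesis dgt2 : forall w I J, U w -> differentiable (fun w => gt2 w I J) w.
Hypothesis sc2 : forall b, smooth_open V (fun y => c2 y 0 b).
Hypothesis hH : forall y b, V y -> mean_curvature_vector gb y b = 2 * n%:R * c2 y 0 b.
Hypothesis Vx : V x.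
Local Notation t := (@tdir n m).
Local Notation v := (@ndir n m).
Local Notation z := (on_Sigma m x).
Local Notation Gam := (christoffel gb z).
Local Notation H := (mean_curvature_vector gb).
Local Notation A := (second_form gb x).
Local Notation gi := (ginv (induced_metric gb) x).
Local Notation gbi a b := (ginv gb z (v a) (v b)).
Let Uz : U z := VU Vx.
Let g2 : 'M[R]_(n + m) := \matrix_(I, J) (gt2 z I J + \sum_b c2 x 0 b * pd (v b) (fun z => gb z I J) z).

Local Notation cd := (cov_deriv2 gb P z).
Local Notation ig := (invmx (induced_metric gb x)).
Local Notation dg b k l := (pd (v b) (fun w => gb w (t k) (t l)) z).
Local Notation dGam := (dchr (invmx (gb z)) g2 (fun K I J => pd K (fun w => gb w I J) z)
  (fun K I J => pd K (fun w => gt2 w I J) z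
     + \sum_b c2 x 0 b * pd (v b) (fun w => pd K (fun w => gb w I J) w) z)).

Lemma schoutenC w I J : U w -> P w I J = P w J I.
Proof. by move=> Uw; apply: oppr_inj; rewrite -!gt2E // gt2C. Qed.

Lemma giC i j : gi i j = gi j i.
Proof. by rewrite -!(ginv_tt pgb VU orth) // /ginv (invmx_sym _ _ (pgb Uz)). Qed.

(** [dchr] is linear in the variation. The part [- P] gives covariant derivatives of [P]; the part
    coming from the displacement [c2] gives the derivative of the Christoffel symbols in that
    direction. *)
Lemma connection_variation C I J :
  dGam C I J =
  - (2^-1 * \sum_E ginv gb z C E * (cd I E J + cd J E I
       - cd E I J))
  + \sum_b c2 x 0 b * pd (v b) (fun z => christoffel gb z C I J) z.
Proof.
rewrite -(dchr_covariant oU pgb schoutenC C I J Uz) -mulN1r -dchrZ.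
rewrite [X in _ = _ + X](eq_bigr _ (fun b _ => congr1 (fun y => c2 x 0 b * y)
  (pd_christoffel sgb pgb (v b) C I J Uz))).
rewrite -dchr_sum -dchrD; apply: eq_dchr => [F K|i j l].
  by rewrite mxE gt2E // mulN1r.
congr (_ + _); rewrite [in RHS](pd_eq_open (g := fun z => - gt2 z j l) i oU Uz) => [|w Uw]; last first.
  by rewrite gt2E // opprK.
by rewrite pdN ?mulN1r ?opprK //; exact: dgt2.
Qed.

Lemma trace_tr (g f : 'I_n -> 'I_n -> R) : (forall i j, g i j = g j i) ->
  \sum_i \sum_j g i j * f j i = \sum_i \sum_j g i j * f i j.
Proof.
move=> gC; rewrite exchange_big /=; apply: eq_bigr => i _; apply: eq_bigr => j _.
by rewrite gC.
Qed.

(** Only normal [E] contribute, by orthogonality, and under the symmetric trace the first two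
    covariant derivatives coincide. *)
Lemma trace_schouten_variation al :
  2 * n%:R * \sum_i \sum_j gi i j * (2^-1 * \sum_E ginv gb z (v al) E *
     (cd (t i) E (t j) + cd (t j) E (t i)
       - cd E (t i) (t j))) =
  - (n%:R * \sum_e \sum_i \sum_j gbi al e * gi i j *
        (cd (v e) (t i) (t j)
         - 2 * cd (t i) (t j) (v e))).
Proof.
rewrite -mulrA mulrCA -mulrN; congr (_ * _); rewrite mulr_sumr -sumrN.
rewrite (eq_bigr (fun i => \sum_j \sum_e gi i j * (gbi al e *
   (cd (t i) (t j) (v e) + cd (t j) (t i) (v e)
    - cd (v e) (t i) (t j))))); last first.
  move=> i _; rewrite mulr_sumr; apply: eq_bigr => j _.
  rewrite sum_tn big1 ?add0r => [|k _]; last by rewrite (ginv_nt pgb VU orth) // mul0r.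
  rewrite mulrCA [2 * _]mulrA divff ?pnatr_eq0 // mul1r -mulr_sumr; congr (_ * _).
  apply: eq_bigr => e _.
  by rewrite (cov_deriv2_sym gb oU schoutenC (t i) (t j) _ Uz) (cov_deriv2_sym gb oU schoutenC (t j) (t i) _ Uz).
rewrite exchange_big3; apply: eq_bigr => e _; rewrite -sumrN.
transitivity (gbi al e * (\sum_i \sum_j gi i j * cd (t i) (t j) (v e)
   + \sum_i \sum_j gi i j * cd (t j) (t i) (v e)
   - \sum_i \sum_j gi i j * cd (v e) (t i) (t j))).
  rewrite -big_split -sumrB mulr_sumr /=; apply: eq_bigr => i _.
  rewrite -big_split -sumrB mulr_sumr /=; apply: eq_bigr => j _.
  by move: (gi i j) (gbi al e) (cd _ _ _) (cd _ _ _) (cd _ _ _) => a b c d f; ring.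
rewrite (trace_tr (fun i j => cd (t i) (t j) (v e)) giC).
rewrite -big_split -sumrB mulr_sumr /=; apply: eq_bigr => i _.
rewrite -big_split -sumrB mulr_sumr -sumrN /=; apply: eq_bigr => j _.
by move: (gi i j) (gbi al e) (cd _ _ _) (cd _ _ _) => a b c d; ring.
Qed.

Lemma trace_induced : \sum_i \sum_j gi i j * gb z (t i) (t j) = n%:R.
Proof.
have u : induced_metric gb x \in unitmx by have [] := gtt_gnn_unit pgb VU orth Vx.
transitivity (\sum_(i < n) (1 : R)); last by rewrite sumr_const card_ord.
apply: eq_bigr => i _; have := sum_invmxl i i u; rewrite eqxx mulr1n => <-.
by apply: eq_bigr => j _; rewrite !mxE (sympos_sym _ _ (pgb Uz)).
Qed.

(** Of the four products of [P] with the metric in the Weyl decomposition, two contain a mixed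
    metric component and vanish. The trace of the other two gives the factor [n] and the trace of
    [P]. *)
Lemma trace_weyl (h : 'I_m -> R) al :
  \sum_i \sum_j \sum_b \sum_e gi i j * gbi al e * h b * weyl gb z (t i) (v b) (t j) (v e) =
  \sum_i \sum_j gi i j * (\sum_b h b * curv gb z (v b) (t i) (t j) (v al))
  - n%:R * (\sum_b \sum_e gbi al e * P z (v b) (v e) * h b)
  - (\sum_i \sum_j gi i j * P z (t i) (t j)) * h al.
Proof.
rewrite -[in RHS]trace_induced !mulr_suml -!sumrB; apply: eq_bigr => i _.
rewrite !mulr_suml -!sumrB; apply: eq_bigr => j _.
rewrite -(sum_delta_l h al) mulr_sumr mulr_sumr mulr_sumr -!sumrB; apply: eq_bigr => b _.
rewrite -(riemann_normal oU sgb pgb VU orth Vx al i j b) -(ginv_nnK pgb VU orth al b Vx).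
rewrite mulr_suml !mulr_sumr -!sumrB; apply: eq_bigr => e _.
rewrite /weyl orth // (orth' pgb VU orth) // (sympos_sym (v b) (v e) (pgb Uz)).
by move: (gi i j) (gbi al e) (h b) (riemann _ _ _ _ _ _) (P _ _ _) (P _ _ _) (P _ _ _) (P _ _ _) (gb _ _ _) (gb _ _ _) => a1 a2 a3 a4 a5 a6 a7 a8 a9 a0; ring.
Qed.

(** The derivative of the tangential metric in the direction [H]; by [inner_second_form] it equals
    [-2 <A_(kl), H>]. Hence [- Z / 2] is the term of the formula containing [<A, H> A]. *)
Let h k l := \sum_b H x b * dg b k l.
Let Z al := \sum_i \sum_j \sum_k \sum_l gi i k * gi j l * h k l * A i j al.

Lemma variation_tC b k l :
  dg b k l = dg b l k.
Proof. by apply: (pd_eq_open _ oU Uz) => w Uw; exact: sympos_sym (pgb Uw). Qed.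

Lemma curvature_term al :
  \sum_i \sum_j \sum_k \sum_l gi i j * gi k l * inner_normal gb x (A i k) (H x) * A j l al =
  - (2^-1 * Z al).
Proof.
rewrite /Z mulr_sumr -sumrN exchange_big /=; apply: eq_bigr => i _.
transitivity (\sum_k \sum_l \sum_j gi k i * gi l j * inner_normal gb x (A k l) (H x) * A i j al).
  by apply: eq_bigr => k _; apply: eq_bigr => l _.
rewrite exchange_big3 mulr_sumr -sumrN; apply: eq_bigr => j _.
rewrite mulr_sumr -sumrN; apply: eq_bigr => k _; rewrite mulr_sumr -sumrN; apply: eq_bigr => l _.
rewrite (inner_second_form oV pgb VU orth) // -/(h k l) (giC k i) (giC l j).
by move: (gi i k) (gi j l) (h k l) (A _ _ _) => a b c d; ring.
Qed.

Lemma quadratic_term al :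
  \sum_i \sum_j gi i j * (\sum_b H x b * \sum_k Gam (v al) (t i) (t k) * Gam (t k) (v b) (t j)) =
  2^-1 * Z al.
Proof.
rewrite /Z mulr_sumr; apply: eq_bigr => i _.
rewrite mulr_sumr [RHS](eq_bigr _ (fun j _ => mulr_sumr _ _ _ _)) [RHS]exchange_big /=.
apply: eq_bigr => k _.
transitivity (\sum_b \sum_j \sum_l 2^-1 * (gi i k * gi j l *
    (H x b * dg b k l) * A i j al)).
  rewrite mulr_sumr; apply: eq_bigr => b _; rewrite mulr_sumr mulr_sumr; apply: eq_bigr => j _.
  rewrite (christoffel_tnt oV pgb VU orth) // !mulr_sumr; apply: eq_bigr => l _.
  rewrite (second_formE pgb VU orth) // (variation_tC b k l).
  by move: (gi i k) (gi j l) (H x b) (pd _ _ _) (Gam _ _ _) => a c d e f; ring.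
rewrite -exchange_big3; apply: eq_bigr => j _; rewrite mulr_sumr; apply: eq_bigr => l _.
by rewrite -mulr_sumr -mulr_suml -mulr_sumr.
Qed.

(** The tangential metric varies by [- P] and by the displacement [c2 = H / (2 n)]; this is the sum
    of the two parts with indices raised. *)
Lemma inverse_variation i j :
  (ig *m ulsubmx g2 *m ig) i j =
  - (\sum_k \sum_l gi i k * gi j l * P z (t k) (t l))
  + (2 * n%:R)^-1 * \sum_k \sum_l gi i k * gi j l * h k l.
Proof.
have K0 : 2 * n%:R != 0 :> R by rewrite mulf_neq0 ?pnatr_eq0 // -lt0n.
rewrite mxE mulr_sumr -sumrN -big_split /=.
under eq_bigr do rewrite mxE mulr_suml.
rewrite exchange_big /=; apply: eq_bigr => k _.
rewrite mulr_sumr -sumrN -big_split /=; apply: eq_bigr => l _.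
rewrite !mxE gt2E // /h.
have -> : \sum_b H x b * dg b k l =
  2 * n%:R * \sum_b c2 x 0 b * dg b k l.
  by rewrite mulr_sumr; apply: eq_bigr => b _; rewrite hH // !mulrA.
rewrite -[invmx _ _ _]/(gi i k) -[invmx _ l j]/(gi l j) (giC l j).
by move: (\sum_b _) (gi i k) (gi j l) (P _ _ _) => a b c e; field; move: K0; rewrite mulf_eq0 negb_or => /andP[].
Qed.

Let sH b : smooth_open V (fun y => H y b).
Proof.
apply: (smooth_eq (f := fun y => 2 * n%:R * c2 y 0 b) oV) => [y Vy|]; first by rewrite hH.
exact: (smoothM oV (@smooth_cst R n V _) (sc2 b)).
Qed.

Lemma pd_H i b y : V y -> pd i (fun y => H y b) y = 2 * n%:R * pd i (fun y => c2 y 0 b) y.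
Proof.
move=> Vy; rewrite (pd_eq_open i oV Vy (fun y Vy => hH b Vy)) pdZ //.
exact: (smooth_differentiable (sc2 b)).
Qed.

Lemma pd_pd_H i j b :
  pd i (pd j (fun y => H y b)) x = 2 * n%:R * pd i (pd j (fun y => c2 y 0 b)) x.
Proof.
rewrite (pd_eq_open i oV Vx (fun y Vy => pd_H j b Vy)) pdZ //.
exact: (smooth_differentiable (smooth_pd j (sc2 b))).
Qed.

(** [H = 2 n c2] holds on all of [V], so it may be differentiated, and [jacobi_identity] for [H]
    becomes a statement about [c2]. *)
Lemma jacobi_c2 al :
  2 * n%:R * (\sum_i \sum_j gi i j *
   (pd i (pd j (fun y => c2 y 0 al)) x
    + \sum_b c2 x 0 b * pd (v b) (fun z => christoffel gb z (v al) (t i) (t j)) z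
    + \sum_b pd i (fun y => c2 y 0 b) x * Gam (v al) (v b) (t j)
    + \sum_b pd j (fun y => c2 y 0 b) x * Gam (v al) (t i) (v b)
    - \sum_k pd k (fun y => c2 y 0 al) x * Gam (t k) (t i) (t j))) =
  laplacian_perp gb H x al
  + \sum_i \sum_j gi i j * (\sum_b H x b * curv gb z (v b) (t i) (t j) (v al))
  - \sum_b \sum_e H x b * H x e * Gam (v al) (v b) (v e)
  + 2^-1 * Z al.
Proof.
rewrite -quadratic_term -(jacobi_identity oU oV sgb pgb VU orth Vx al sH (fun _ => erefl)).
rewrite mulr_sumr; apply: eq_bigr => i _; rewrite mulr_sumr; apply: eq_bigr => j _.
rewrite mulrCA; congr (_ * _); rewrite pd_pd_H.
have -> : \sum_b H x b * pd (v b) (fun z => christoffel gb z (v al) (t i) (t j)) z =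
  2 * n%:R * \sum_b c2 x 0 b * pd (v b) (fun z => christoffel gb z (v al) (t i) (t j)) z.
  by rewrite mulr_sumr; apply: eq_bigr => b _; rewrite hH // -!mulrA.
have Ed l (f : 'I_m -> R) : \sum_b pd l (fun y => H y b) x * f b =
  2 * n%:R * \sum_b pd l (fun y => c2 y 0 b) x * f b.
  by rewrite mulr_sumr; apply: eq_bigr => b _; rewrite pd_H // -!mulrA.
rewrite (Ed i (fun b => Gam (v al) (v b) (t j))) (Ed j (fun b => Gam (v al) (t i) (v b))).
have -> : \sum_k pd k (fun y => H y al) x * Gam (t k) (t i) (t j) =
  2 * n%:R * \sum_k pd k (fun y => c2 y 0 al) x * Gam (t k) (t i) (t j).
  by rewrite mulr_sumr; apply: eq_bigr => k _; rewrite pd_H // -!mulrA.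
move: (pd _ _ _) => a0.
by move: (\sum_b _) (\sum_b _) (\sum_b _) (\sum_b _) => a b c e; ring.
Qed.

(** Each group of summands in the [r^2] equation is replaced by its tensorial form; afterwards the
    sums are atoms and [fourth_coefficient_algebra] compares coefficients. *)
Lemma fourth_coefficient al (u4 : R) :
  \sum_i \sum_j
    (- (ig *m ulsubmx g2 *m ig) i j
         * Gam (v al) (t i) (t j)
     + gi i j * (pd i (pd j (fun y => c2 y 0 al)) x
       + (dGam (v al) (t i) (t j)
       + \sum_be pd i (fun y => c2 y 0 be) x * Gam (v al) (v be) (t j)
       + \sum_be pd j (fun y => c2 y 0 be) x * Gam (v al) (t i) (v be))
       - \sum_k pd k (fun y => c2 y 0 al) x * Gam (t k) (t i) (t j)
       + 2 * c2 x 0 al * gt2 z (t i) (t j)))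
  + (- (4 * \sum_a \sum_b gb z (v a) (v b) * c2 x 0 a * c2 x 0 b) * (2 * c2 x 0 al)
     + (12 * u4
     + (4 * (\sum_be \sum_ga Gam (v al) (v be) (v ga) * c2 x 0 be * c2 x 0 ga)
     + 4 * \sum_be (\sum_J invmx (gb z) (v al) J * gt2 z J (v be)) * c2 x 0 be)))
  = (n%:R + 1) * (4 * u4) ->
  8 * n%:R * (n%:R - 2) * u4 =
    laplacian_perp gb H x al
    + \sum_i \sum_j \sum_k \sum_l
        gi i j * gi k l * inner_normal gb x (A i k) (H x) * A j l al
    - 2 / n%:R ^+ 2 * inner_normal gb x (H x) (H x) * H x al
    + \sum_i \sum_j \sum_b \sum_e
        gi i j * gbi al e * H x b * weyl gb z (t i) (v b) (t j) (v e)
    + (n%:R - 4) * \sum_b \sum_e gbi al e * P z (v b) (v e) * H x b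
    - (\sum_i \sum_j gi i j * P z (t i) (t j)) * H x al
    + 2 * n%:R * \sum_i \sum_j \sum_k \sum_l
        gi i k * gi j l * P z (t k) (t l) * A i j al
    + n%:R * \sum_e \sum_i \sum_j gbi al e * gi i j *
        (cd (v e) (t i) (t j)
         - 2 * cd (t i) (t j) (v e))
    - (n%:R - 2) / n%:R * \sum_b \sum_e H x b * H x e * Gam (v al) (v b) (v e).
Proof.
have N0 : n%:R != 0 :> R by rewrite pnatr_eq0 -lt0n.
have K0 : 2 * n%:R != 0 :> R by rewrite mulf_neq0 ?pnatr_eq0 // -lt0n.
have c2E b : c2 x 0 b = (2 * n%:R)^-1 * H x b.
  by rewrite hH // (mulKf K0).
have E1 : \sum_i \sum_j (ig *m ulsubmx g2 *m ig) i j
         * Gam (v al) (t i) (t j) =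
   - (\sum_i \sum_j \sum_k \sum_l gi i k * gi j l * P z (t k) (t l) * A i j al)
   + (2 * n%:R)^-1 * Z al.
  rewrite /Z mulr_sumr -sumrN -big_split /=; apply: eq_bigr => i _.
  rewrite mulr_sumr -sumrN -big_split /=; apply: eq_bigr => j _.
  rewrite inverse_variation mulrDl mulNr -mulrA !mulr_suml.
  rewrite (second_formE pgb VU orth) //.
  by congr (- _ + _ * _); apply: eq_bigr => k _; rewrite mulr_suml.
have EQ : \sum_a \sum_b gb z (v a) (v b) * c2 x 0 a * c2 x 0 b =
   (2 * n%:R)^-2 * inner_normal gb x (H x) (H x).
  rewrite /inner_normal mulr_sumr; apply: eq_bigr => a _; rewrite mulr_sumr; apply: eq_bigr => b _.
  by rewrite !c2E; move: (gb _ _ _) (H x a) (H x b) => p q s; field.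
have EG : \sum_be \sum_ga Gam (v al) (v be) (v ga) * c2 x 0 be * c2 x 0 ga =
   (2 * n%:R)^-2 * \sum_b \sum_e H x b * H x e * Gam (v al) (v b) (v e).
  rewrite mulr_sumr; apply: eq_bigr => a _; rewrite mulr_sumr; apply: eq_bigr => b _.
  by rewrite !c2E; move: (Gam _ _ _) (H x a) (H x b) => p q s; field.
have ES : \sum_be (\sum_J invmx (gb z) (v al) J * gt2 z J (v be)) * c2 x 0 be =
   - ((2 * n%:R)^-1 * \sum_b \sum_e gbi al e * P z (v b) (v e) * H x b).
  rewrite mulr_sumr -sumrN; apply: eq_bigr => b _.
  rewrite sum_tn big1 ?add0r => [|k _]; last by rewrite [invmx _ _ _](ginv_nt pgb VU orth) // mul0r.
  rewrite mulr_suml mulr_sumr -sumrN; apply: eq_bigr => e _.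
  rewrite gt2E // (schoutenC (v e) (v b) Uz) c2E -[invmx _ _ _]/(gbi al e).
  by move: (gbi al e) (P _ _ _) (H x b) => p q s; ring.
have ET : \sum_i \sum_j gi i j * gt2 z (t i) (t j) = - (\sum_i \sum_j gi i j * P z (t i) (t j)).
  rewrite -sumrN; apply: eq_bigr => i _; rewrite -sumrN; apply: eq_bigr => j _.
  by rewrite gt2E // mulrN.
have := jacobi_c2 al; have := trace_schouten_variation al.
rewrite curvature_term trace_weyl.
rewrite EQ EG ES (c2E al) => D1 D2.
(* The tangential trace falls into four parts: the variation of the inverse metric, the displacement
   by [c2], the variation of the connection by [- P], and the term with [T_r], where
   [2 * c2 = H / n]. *)
rewrite [X in X + _ = _](_ : _ =
  - (\sum_i \sum_j (ig *m ulsubmx g2 *m ig) i j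
         * Gam (v al) (t i) (t j))
  + (\sum_i \sum_j gi i j *
   (pd i (pd j (fun y => c2 y 0 al)) x
    + \sum_b c2 x 0 b * pd (v b) (fun z => christoffel gb z (v al) (t i) (t j)) z
    + \sum_b pd i (fun y => c2 y 0 b) x * Gam (v al) (v b) (t j)
    + \sum_b pd j (fun y => c2 y 0 b) x * Gam (v al) (t i) (v b)
    - \sum_k pd k (fun y => c2 y 0 al) x * Gam (t k) (t i) (t j)))
  - \sum_i \sum_j gi i j * (2^-1 * \sum_E ginv gb z (v al) E *
     (cd (t i) E (t j) + cd (t j) E (t i)
       - cd E (t i) (t j)))
  + n%:R^-1 * H x al * \sum_i \sum_j gi i j * gt2 z (t i) (t j)); last first.
  rewrite [X in _ = _ + X]mulr_sumr -sumrN -big_split -sumrB -big_split /=; apply: eq_bigr => i _.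
  rewrite [X in _ = _ + X]mulr_sumr -sumrN -big_split -sumrB -big_split /=; apply: eq_bigr => j _.
  rewrite connection_variation.
  move: (pd i (pd j _) x) (Gam _ _ _) (gi i j) ((_ *m _) i j) (H x al) (gt2 _ _ _) => a1 a2 a3 a4 a5 a6.
  move: (\sum_E _) (\sum_b _) (\sum_b _) (\sum_b _) (\sum_b _) => b1 b2 b3 b4 b5.
  by field.
rewrite E1 ET; move: D1 D2; clear E1 EQ EG ES ET.
move: (\sum_i \sum_j gi i j * (2^-1 * _)) (\sum_i \sum_j gi i j * (pd _ _ _ + _ + _ + _ - _)) => X J.
move: (laplacian_perp _ _ _ _) (inner_normal _ _ _ _) (Z al) (H x al) => L HH z0 h0.
move: (\sum_e \sum_i \sum_j _) (\sum_i \sum_j \sum_k \sum_l _) (\sum_i \sum_j gi i j * (\sum_b _)) => DP PA CU.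
move: (\sum_i \sum_j gi i j * _) => tP.
move: (\sum_b \sum_e _ * Gam _ _ _) => G.
move: (\sum_b \sum_e _) => BP.
exact: fourth_coefficient_algebra.
Qed.

End FourthCoefficient.

Lemma sympos_scale (R : realType) k (a : R) (M : 'M[R]_k) : 0 < a -> sympos M -> sympos (a *: M).
Proof.
move=> a0 [sM pM]; split=> [|w w0]; first by rewrite linearZ /= sM.
by rewrite -scalemxAr -scalemxAl mxE mulr_gt0 // pM.
Qed.

(** * The metric in a normal form chart *)

Section NormalFormChart.
Variables (R : realType) (n m : nat) (X : bmanifold R (n + m)).
Variables (gp : tensor2 X) (r : X -> R) (c : hchart R X (n + m)).
Hypotheses (hgp : interior_metric gp) (hc : normal_form_chart gp r c).
Variables (U : set 'rV[R]_(n + m)) (eps : R).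
Hypotheses (oU : open U) (eps0 : 0 < eps).
Hypothesis cimgE : cimg c = [set v | U (lsubmx v) /\ 0 <= rcoord v < eps].
Let S := [set v : 'rV[R]_(n + m + 1) | U (lsubmx v) /\ 0 < rcoord v < eps].

Lemma cint_slab : cint c = S.
Proof.
rewrite /cint cimgE; apply/seteqP; split=> w /=.
  by move=> [[Uw /andP[_ we] w0]]; split=> //; apply/andP.
by move=> [Uw /andP[w0 we]]; split=> //; split=> //; rewrite (ltW w0).
Qed.

Lemma cbnd_slab : cbnd c = U.
Proof.
rewrite /cbnd cimgE; apply/seteqP; split=> w /=; rewrite /at_boundary row_mxKl.
  by case.
by move=> Uw; rewrite rcoord_row mxE lexx eps0.
Qed.

Lemma defining_function_rcoord w : S w -> r (cinv c w) = rcoord w.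
Proof.
rewrite -cint_slab => -[[p cp <-] _]; case: hc => ac _ hr _.
by case: (atlas_hchart ac) => _ _ -> // _ _; rewrite hr.
Qed.

Lemma compactifiedE w : S w -> compactified r gp c w = rcoord w ^+ 2 *: gp c w.
Proof. by move=> Sw; rewrite /compactified defining_function_rcoord. Qed.

Lemma rcoord_S_gt0 w : S w -> 0 < rcoord w.
Proof. by move=> [_ /andP[]]. Qed.

Lemma sympos_gp w : S w -> sympos (gp c w).
Proof. by rewrite -cint_slab; case: hc => ac _ _ _; case: (hgp ac) => _ + _; apply. Qed.

Lemma sympos_compactified w : S w -> sympos (compactified r gp c w).
Proof.
move=> Sw; rewrite compactifiedE //; apply: sympos_scale (sympos_gp Sw).
by rewrite exprn_gt0 // rcoord_S_gt0.
Qed.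

(** In the chart [r] is the last coordinate, so the gradient condition says that the last column of
    the inverse metric is a unit vector; multiplication by the metric transfers this to the metric
    itself. *)
Lemma compactified_last w A : S w ->
  compactified r gp c w A (rlast (n + m)) = (A == rlast (n + m))%:R.
Proof.
move=> Sw; set h := compactified r gp c.
have E B : ginv h w B (rlast (n + m)) = (B == rlast (n + m))%:R.
  case: hc => _ _ _ /(_ w B); rewrite cint_slab => /(_ Sw) <-.
  rewrite /gradient -[LHS](sum_delta_r (ginv h w B)); apply: eq_bigr => C _; congr (_ * _).
  rewrite (pd_eq_open (g := fun w => w 0 (rlast (n + m))) C (@open_slab_lt R _ U eps oU) Sw) ?pd_coord //.
  by move=> w' Sw'; exact: defining_function_rcoord.
rewrite -(sum_invmxr A (rlast (n + m)) (sympos_unitmx (sympos_compactified Sw))).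
rewrite -[LHS](sum_delta_r (h w A)); apply: eq_bigr => B _.
by rewrite -E.
Qed.

Lemma normal_form w : S w ->
  gp c w = (rcoord w ^+ 2)^-1 *: block_mx (ulsubmx (compactified r gp c w)) 0 0 1%:M.
Proof.
move=> Sw; have sh := sympos_compactified Sw.
have <- : compactified r gp c w = block_mx (ulsubmx (compactified r gp c w)) 0 0 1%:M.
  have cl := fun A => compactified_last A Sw.
  move: (compactified r gp c w) sh cl => h sh cl.
  have E1 k : rshift (n + m) k = rlast (n + m) :> 'I_(n + m + 1) by rewrite ord1.
  rewrite -[LHS]submxK; congr (block_mx _ _ _ _); apply/matrixP => i j; rewrite !mxE.
  - by rewrite E1 cl /rlast eq_lrshift.
  - by rewrite E1 (sympos_sym _ _ sh) cl /rlast eq_lrshift.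
  - by rewrite !E1 cl !ord1 !eqxx.
rewrite compactifiedE // scalerA mulVf ?scale1r // expf_neq0 //.
by rewrite gt_eqF // rcoord_S_gt0.
Qed.

Lemma smooth_gp A B : smooth_open S (fun w => gp c w A B).
Proof. by rewrite -cint_slab; case: hc => ac _ _ _; case: (hgp ac). Qed.

Lemma smooth_compactified i j : smooth_open S (fun w => ulsubmx (compactified r gp c w) i j).
Proof.
have oS := @open_slab_lt R _ U eps oU.
apply: (smooth_eq (f := fun w => w 0 (rlast (n + m)) * w 0 (rlast (n + m)) * gp c w (lshift 1 i) (lshift 1 j)) oS).
  by move=> w Sw; rewrite compactifiedE // !mxE expr2.
apply: (smoothM oS) (smooth_gp _ _); apply: (smoothM oS); exact: smooth_coord.
Qed.

End NormalFormChart.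

(** * The minimal submanifold as a graph in the chart *)

Section Graph.
Variables (R : realType) (n m : nat) (X : bmanifold R (n + m)) (c : hchart R X (n + m)).
Variables (Y : set X) (V : set 'rV[R]_n) (delta : R) (u : 'rV[R]_(n + 1) -> 'rV[R]_m).
Hypotheses (ac : atlas c) (hu : is_graph c Y V delta u).
Let Q := [set q : 'rV[R]_(n + 1) | V (lsubmx q) /\ 0 < rcoord q < delta].

Lemma graph_in_chart q : Q q -> cint c (graph_map u q) /\ Y (cinv c (graph_map u q)).
Proof.
move=> Qq; case: hu => _ _ _ [N [_ Nc _ E]].
have : (graph_map u @` Q) (graph_map u q) by exists q.
rewrite -E => -[p [Yp Np] Ep]; have cp := Nc _ Np; rewrite -Ep.
case: (atlas_hchart ac) => _ _ -> // _ _; split=> //; split; first by exists p.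
by rewrite /= Ep rcoord_graph_map; case: Qq => _ /andP[].
Qed.

Lemma boundary_in_chart y : V y -> cbnd c (on_Sigma m y).
Proof.
by move=> Vy; case: hu => _ _ _ [N [_ Nc /(_ y Vy) [p Np Ep] _]]; exists p => //; exact: Nc.
Qed.

Lemma smooth_graph_map A : smooth_open Q (fun q => graph_map u q 0 A).
Proof.
case: hu => -[oV d0] su _ _.
destruct (tnrP A) as [k|be|].
- have -> : (fun q => graph_map u q 0 (lshift 1 (tdir m k))) = (fun q => q 0 (lshift 1 k)).
    by apply/funext => q; rewrite graph_map_t.
  exact: smooth_coord.
- have -> : (fun q => graph_map u q 0 (lshift 1 (ndir n be))) = (fun q => u q 0 be).
    by apply/funext => q; rewrite graph_map_n.
  exact: su.
have -> : (fun q => graph_map u q 0 (rlast (n + m))) = (fun q => q 0 (rlast n)).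
  by apply/funext => q; rewrite graph_map_r.
exact: smooth_coord.
Qed.

End Graph.

Theorem theorem1p1 (R : realType) (n m : nat) (hn : (3 <= n)%N) (hm : (1 <= m)%N)
    (X : bmanifold R (n + m)) (gp : tensor2 X) (gb : btensor2 X) (r : X -> R)
    (hgp : conformally_compact_einstein gp)
    (hgb : boundary_metric gb)
    (hr : special_defining_function gp gb r)
    (Sigma Y : set X)
    (hSigma : boundary_submanifold n Sigma)
    (hY : minimal_submanifold gp (n + 1) Y)
    (hYSigma : asymptotic_to Y Sigma)
    (c : hchart R X (n + m))
    (hc : adapted_chart gp gb r c Sigma)
    (gt : nat -> 'rV[R]_(n + m) -> 'M[R]_(n + m))
    (hgt : metric_expansion gp gb r c gt)
    (V : set 'rV[R]_n) (delta : R) (u : 'rV[R]_(n + 1) -> 'rV[R]_m)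
    (hu : is_graph c Y V delta u)
    (uc : nat -> 'rV[R]_n -> 'rV[R]_m)
    (huc : graph_expansion V u uc)
    (x : 'rV[R]_n) (hx : V x) (al : 'I_m) :
  let z := on_Sigma m x in
  let g := induced_metric (gb c) in
  let A := second_form (gb c) x in
  let H := mean_curvature_vector (gb c) in
  let P := schouten (gb c) in
  let t := @tdir n m in
  let v := @ndir n m in
  let gi i j := ginv g x i j in
  let gbi a b := ginv (gb c) z (v a) (v b) in
  8 * n%:R * (n%:R - 2) * uc 4%N x 0 al =
    laplacian_perp (gb c) H x al
    + \sum_i \sum_j \sum_k \sum_l
        gi i j * gi k l * inner_normal (gb c) x (A i k) (H x) * A j l al
    - 2 / n%:R ^+ 2 * inner_normal (gb c) x (H x) (H x) * H x al
    + \sum_i \sum_j \sum_b \sum_e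
        gi i j * gbi al e * H x b * weyl (gb c) z (t i) (v b) (t j) (v e)
    + (n%:R - 4) * \sum_b \sum_e gbi al e * P z (v b) (v e) * H x b
    - (\sum_i \sum_j gi i j * P z (t i) (t j)) * H x al
    + 2 * n%:R * \sum_i \sum_j \sum_k \sum_l
        gi i k * gi j l * P z (t k) (t l) * A i j al
    + n%:R * \sum_e \sum_i \sum_j gbi al e * gi i j *
        (cov_deriv2 (gb c) P z (v e) (t i) (t j)
         - 2 * cov_deriv2 (gb c) P z (t i) (t j) (v e))
    - (n%:R - 2) / n%:R * \sum_b \sum_e
        H x b * H x e * christoffel (gb c) z (v al) (v b) (v e).
Proof.
case: hgp => ig ein _; case: hc => nc _ hort.
have [ac [U [eps [oU eps0 cE]]] _ _] := nc.
have bE := cbnd_slab eps0 cE; have sE := cint_slab cE.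
have [[oV d0] su _ _] := hu.
case: hgt => gt0E eT; case: huc => uc0 eu.
have [_ pgb _] := hgb c ac.
rewrite bE in gt0E eT pgb.
have QF q (Qq : V (lsubmx q) /\ 0 < rcoord q < delta) := graph_in_chart ac hu Qq.
have VU y : V y -> U (on_Sigma m y) by move=> Vy; rewrite -bE; exact: (boundary_in_chart hu Vy).
have orth y i be : V y -> gb c (on_Sigma m y) (tdir m i) (ndir n be) = 0.
  move=> Vy; have := hort y (boundary_in_chart hu Vy) => /matrixP/(_ i be).
  by rewrite !mxE.
have pGp := sympos_gp ig nc cE.
have sT := smooth_compactified ig nc oU cE.
have GpE := normal_form ig nc oU cE.
have pT w (Sw : U (lsubmx w) /\ 0 < rcoord w < eps) := sympos_ulsubmx (sympos_compactified ig nc cE Sw).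
have nm3 : (3 < n + m)%N by rewrite -addn1 leq_add.
have nm2 : (2 < n + m)%N by exact: ltnW.
(* Here [n >= 3] enters: the expansion of [u] has order [n + 2], and [r^4] must lie strictly below
   its logarithmic or last term. *)
have n4 : (4 < n + 2)%N by rewrite -[4%N]/(2 + 2)%N ltn_add2r.
have n0 : (0 < n)%N by exact: leq_trans hn.
have QS q (Qq : V (lsubmx q) /\ 0 < rcoord q < delta) :
    U (lsubmx (graph_map u q)) /\ 0 < rcoord (graph_map u q) < eps.
  by have [+ _] := QF q Qq; rewrite sE.
have minF q A (Qq : V (lsubmx q) /\ 0 < rcoord q < delta) :
    mean_curvature (gp c) (graph_map u) q A = 0.
  apply: (hY.2 c [set q | V (lsubmx q) /\ 0 < rcoord q < delta]) => //.
  - exact: open_slab_lt.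
  - exact: smooth_graph_map hu.
  by move=> q' Qq'; apply: sympos_unitmx; apply: first_form_sympos; apply: pGp; exact: QS.
have sgb := sgb oU eT gt0E.
have gt2E w i j : U w -> gt 2%N w i j = - schouten (gb c) w i j.
  apply: (gt2_schouten oU eps0 nm2 pGp sT pT GpE eT gt0E pgb) => // w' A B.
  by rewrite -sE; exact: ein.
have gt2C w i j : U w -> gt 2%N w i j = gt 2%N w j i.
  exact: (gt2_sym oU eps0 nm2 sT pT eT gt0E).
have sc2 b : smooth_open V (fun y => uc 2%N y 0 b).
  by apply: (expansion_smooth (eu b)); rewrite leq_addl.
have sg2 w I J : U w -> differentiable (fun w => gt 2%N w I J) w.
  by apply: smooth_differentiable; apply: (expansion_smooth (eT I J)); exact: ltnW.
(* The comparison of coefficients is made at every point of [V], since [H = 2 n u2] has to be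
   differentiated twice along Sigma. *)
have mc y (Vy : V y) := minimal_coefficients R n m U eps (gp c) _ (gb c) gt _ oU eps0 nm2 pGp sT pT
  GpE eT gt0E pgb V delta (n + 2) u uc oV d0 n4 su eu uc0 QS minF y Vy (VU y Vy)
  (fun i be => orth y i be Vy).
(* The [r^0] equation is [H + 2 u2 = (n + 1) (2 u2)]. *)
have hH y b : V y -> mean_curvature_vector (gb c) y b = 2 * n%:R * uc 2%N y 0 b.
  move=> Vy; have [/= E _] := mc y Vy b.
  rewrite -[RHS](_ : (n%:R + 1) * (2 * uc 2%N y 0 b) - 2 * uc 2%N y 0 b = _); last by ring.
  rewrite -E addrK; apply: eq_bigr => i _; apply: eq_bigr => j _.
  by rewrite (second_formE pgb VU orth).
move=> z g A H P t v gi gbi.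
have [_ B] := mc x hx al.
exact: (fourth_coefficient oU oV sgb pgb VU orth n0 gt2E gt2C sg2 sc2 hH hx B).
Qed.
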